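(* Let $c$ be a Coxeter element of a finite Coxeter group $W$. For every $c$-sortable element $w$, the following are equivalent: (1) the descents of $w$ pairwise commute; (2) the interval $[\mathrm{pop}^{\downarrow}_{\mathrm{Weak}(W)}(w),w]$ of $\mathrm{Weak}(W)$ is a distributive lattice; (3) this interval is a Boolean lattice; (4) the interval $[\mathrm{pop}^{\downarrow}_{\mathrm{Camb}_c}(w),w]$ of $\mathrm{Camb}_c$ is a distributive lattice; (5) this interval is a Boolean lattice; (6) the interval $[\mathrm{pop}^{\downarrow}_{\mathrm{Camb}_c}(w),w]$ of $\mathrm{Camb}_c$ equals the interval $[\mathrm{pop}^{\downarrow}_{\mathrm{Weak}(W)}(w),w]$ of $\mathrm{Weak}(W)$.
   Context: $(W,S)$ is a finite Coxeter system with length function $\ell$. The (right) weak order $\mathrm{Weak}(W)$: $u\le v$ iff some reduced word for $v$ has a reduced word for $u$ as a prefix; it is a lattice. A descent of $w$ is $s\in S$ with $\ell(ws)<\ell(w)$. A Coxeter element is a product of all simple reflections, each once, in some order. Fix a reduced word $\mathsf{c}$ for $c$ and let $\mathsf{c}^\infty=\mathsf{c}\mathsf{c}\mathsf{c}\cdots$. The $\mathsf{c}$-sorting word of $w$ is the reduced word for $w$ that is lexicographically first (in terms of positions) among subwords of $\mathsf{c}^\infty$; let $I^{(k)}(w)$ be the set of simple reflections it uses from the $k$-th copy of $\mathsf{c}$. $w$ is $c$-sortable if $I^{(1)}(w)\supseteq I^{(2)}(w)\supseteq\cdots$ (this does not depend on the choice of $\mathsf{c}$). The $c$-Cambrian lattice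 $\mathrm{Camb}_c$ is the set of $c$-sortable elements with the induced weak order; it is a sublattice of $\mathrm{Weak}(W)$. For a finite lattice $L$, $\mathrm{pop}^{\downarrow}_L(x)=x\wedge\bigwedge\{y:y\lessdot x\}$ (covers and meets taken in $L$). *)

(* Defs.v *)
From HB Require Import structures.
From mathcomp Require Import all_boot all_order all_fingroup.
Set Implicit Arguments. Unset Strict Implicit. Unset Printing Implicit Defensive.

Local Open Scope group_scope.

(* An abstract (possibly infinite) group, used to state the universal
   property of a Coxeter presentation. *)
Record abs_group := AbsGroup {
  ag_carrier :> Type;
  ag_mul : ag_carrier -> ag_carrier -> ag_carrier;
  ag_one : ag_carrier;
  ag_inv : ag_carrier -> ag_carrier;
  ag_mulA : forall x y z, ag_mul x (ag_mul y z) = ag_mul (ag_mul x y) z;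
  ag_mul1 : forall x, ag_mul ag_one x = x;
  ag_mulV : forall x, ag_mul (ag_inv x) x = ag_one
}.

Fixpoint ag_pow (H : abs_group) (x : H) (n : nat) : H :=
  if n is n'.+1 then ag_mul x (ag_pow x n') else ag_one H.

Section Coxeter.
Variable gT : finGroupType.
Implicit Types (S : {set gT}).

(* (W,S) with W = gT is a Coxeter system: S is a set of involutions
   generating W, and W has the Coxeter presentation
   < S | (st)^{m(s,t)} = 1 >, where m(s,t) is the order of st
   (m(s,s) = 1); the presentation is expressed by its universal property
   with respect to arbitrary groups. *)
Definition coxeter_system S : Prop :=
  [/\ (1 \notin S), {in S, forall s, s * s = 1}, <<S>> = [set: gT] &
    forall (H : abs_group) (f : gT -> H),
      {in S &, forall s t, ag_pow (ag_mul (f s) (f t)) #[s * t] = ag_one H} ->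
      exists phi : gT -> H,
        (forall x y, phi (x * y) = ag_mul (phi x) (phi y)) /\
        {in S, forall s, phi s = f s}].

Definition prodw s : gT := \prod_(a <- s) a.

Fixpoint ball S n : {set gT} :=
  if n is n'.+1 then ball S n' :|: (ball S n' * S) else [set 1].

Definition ell S w : nat := find (fun n => w \in ball S n) (iota 0 #|gT|).

Definition reduced S s : bool := all (mem S) s && (size s == ell S (prodw s)).

Definition weak_le S u v : Prop :=
  exists s1 s2, [/\ reduced S s1, reduced S (s1 ++ s2),
                    prodw s1 = u & prodw (s1 ++ s2) = v].

Definition descent S w a : Prop := a \in S /\ ell S (w * a) < ell S w.

Definition coxeter_word S (cw : seq gT) : Prop := perm_eq cw (enum S).

(* letter at position i (0-based) of c^infinity *)
Definition letter (cw : seq gT) (i : nat) : gT := nth 1 cw (i %% size cw).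

Fixpoint lex_le (p q : seq nat) : bool :=
  match p, q with
  | [::], _ => true
  | _ :: _, [::] => false
  | a :: p', b :: q' => (a < b) || ((a == b) && lex_le p' q')
  end.

(* p : increasing list of positions in c^infinity giving the c-sorting
   word of w (lexicographically first reduced subword for w) *)
Definition sorting_pos S cw w (p : seq nat) : Prop :=
  [/\ sorted ltn p, reduced S (map (letter cw) p),
      prodw (map (letter cw) p) = w &
      forall q, sorted ltn q -> reduced S (map (letter cw) q) ->
        prodw (map (letter cw) q) = w -> lex_le p q].

(* I^(k+1)(w): letters used from the (k+1)-st copy of c (k 0-based) *)
Definition Iblock (cw : seq gT) (p : seq nat) (k : nat) : {set gT} :=
  [set a in map (letter cw) [seq i <- p | i %/ size cw == k]].

Definition sortable S cw w : Prop :=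
  exists p, sorting_pos S cw w p /\
            forall k, Iblock cw p k.+1 \subset Iblock cw p k.

Definition Weak : gT -> Prop := fun _ => True.
Definition Camb S cw : gT -> Prop := fun w => sortable S cw w.

Definition pairp x y : gT -> Prop := fun a => a = x \/ a = y.

Definition covered (P : gT -> Prop) (le : gT -> gT -> Prop) y x : Prop :=
  [/\ P y, P x, le y x, y <> x &
      forall z, P z -> le y z -> le z x -> z = y \/ z = x].

Definition is_glb (P : gT -> Prop) (le : gT -> gT -> Prop) (A : gT -> Prop) z :=
  [/\ P z, (forall a, A a -> le z a) &
      forall z', P z' -> (forall a, A a -> le z' a) -> le z' z].

Definition is_lub (P : gT -> Prop) (le : gT -> gT -> Prop) (A : gT -> Prop) z :=
  [/\ P z, (forall a, A a -> le a z) &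
      forall z', P z' -> (forall a, A a -> le a z') -> le z z'].

Definition is_pop (P : gT -> Prop) (le : gT -> gT -> Prop) x z : Prop :=
  is_glb P le (fun a => a = x \/ covered P le a x) z.

Definition interval (P : gT -> Prop) (le : gT -> gT -> Prop) a b : gT -> Prop :=
  fun y => [/\ P y, le a y & le y b].

Definition is_lattice (Q : gT -> Prop) (le : gT -> gT -> Prop) : Prop :=
  forall x y, Q x -> Q y ->
    (exists m, is_glb Q le (pairp x y) m) /\ (exists j, is_lub Q le (pairp x y) j).

Definition distributive_lattice (Q : gT -> Prop) (le : gT -> gT -> Prop) : Prop :=
  is_lattice Q le /\
  forall x y z a b c d, Q x -> Q y -> Q z ->
    is_lub Q le (pairp y z) a -> is_glb Q le (pairp x a) b ->
    is_glb Q le (pairp x y) c -> is_glb Q le (pairp x z) d ->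
    is_lub Q le (pairp c d) b.

Definition boolean_lattice (Q : gT -> Prop) (le : gT -> gT -> Prop) : Prop :=
  exists n (f : gT -> {set 'I_n}),
    [/\ (forall x y, Q x -> Q y -> f x = f y -> x = y),
        (forall A, exists x, Q x /\ f x = A) &
        (forall x y, Q x -> Q y -> (le x y <-> f x \subset f y))].

End Coxeter.

(* Main.v *)
(* In the geometric representation an element [w] is determined by its set of
   inversions (positive roots made negative by [w^-1]), and the weak order is
   inclusion of these sets.  Reading the Coxeter word [c] cyclically, a
   [c]-sortable element comes with the list [L] of its inversions in sorting
   order and, for every letter, the root met when this letter is skipped for the
   first time.  The nonsymmetric Euler form [E_c], with [E_c + E_c^T] the
   invariant form, controls both: [E_c (b, g) <= E_c (g, b)] when [b] precedes
   [g] in [L], the skipped roots are triangular for [E_c], and the (negated)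
   cover reflections of [w] are skipped roots.

   Consequently, if [s] is the first letter of [c] and a cover reflection of [w],
   the other covers avoid [s].  If moreover all descents commute, then they all
   commute with [s], and deleting any set of descents preserves sortability: both
   intervals are the same Boolean lattice.

   Conversely let [a], [b] be noncommuting descents of [w].  Then [w a], [w b]
   and [w b a] span a pentagon in the weak order, and one of [w a], [w b] is not
   sortable.  In the Cambrian lattice the projections of these elements still
   span a pentagon; that they are distinct is seen from the prefixes of the
   sorting word, which are sortable.  The projection (largest sortable element
   below a given one) exists because [s \/ u] is sortable for [u] sortable in the
   parabolic subgroup omitting the first letter [s]; this follows by counting
   sortable elements along the rotations of [c]. *)

From mathcomp Require Import all_boot all_order all_fingroup all_algebra cyclic.
From mathcomp Require Import zify ring lra.
From mathcomp Require Import boolp Rstruct.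
From Stdlib Require Rtrigo.
Require Import Defs.

Set Implicit Arguments. Unset Strict Implicit. Unset Printing Implicit Defensive.
Import Order.TTheory GRing.Theory Num.Theory.
Local Open Scope ring_scope.

(** * Chebyshev polynomials and the geometric representation *)

(** The presentation is available only as a universal property, so it is exploited through
    homomorphisms. Two are used: signs in [bool_group], and bijections of [V]. For the second the
    braid relations of the reflections must be verified; powers of a product of two reflections have
    Chebyshev coefficients, and the zeros of these at [2 cos (pi / m)] give the relations.

    Sortability is defined by positions in an infinite word, an awkward object for induction. [srt]
    replaces it: its rules strip the first letter, and the Euler form is unchanged when that letter
    moves to the end and the roots are reflected. Facts on inversions and skipped roots thus reduce
    to the first letter, whose coordinate the form reads off. The asymmetry of the form matters: on
    two cover roots, one of them [alpha s], it vanishes in one of the two orders, and either order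
    forces a zero coordinate.

    That joins [s \/ u] are sortable amounts to the surjectivity of a projection. Its injectivity
    follows from the shape of the cover roots; equality of cardinals does the rest. *)

Notation R := Rdefinitions.R.

(* [cheb x k = sin (k theta) / sin theta] when [x = 2 cos theta]. *)
Fixpoint cheb2 (x : R) (k : nat) : R * R :=
  if k is k'.+1 then let: (a, b) := cheb2 x k' in (b, x * b - a) else (0, 1).
Definition cheb x k := (cheb2 x k).1.

Lemma cheb0 x : cheb x 0 = 0. Proof. by []. Qed.
Lemma cheb1 x : cheb x 1 = 1. Proof. by []. Qed.
Lemma chebSS x k : cheb x k.+2 = x * cheb x k.+1 - cheb x k.
Proof. by rewrite /cheb /=; case: (cheb2 x k). Qed.

(** Minus the entry of the Coxeter form for a pair of order [m], scaled so that roots have square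
    length 2. The value at [m = 1] is [-2], so the diagonal needs no separate case. *)
Definition kap (m : nat) : R :=
  2 * Rtrigo_def.cos (Rdefinitions.Rdiv Rtrigo1.PI (Raxioms.INR m)).

Lemma cheb_sin th k :
  cheb (2 * Rtrigo_def.cos th) k * Rtrigo_def.sin th = Rtrigo_def.sin (k%:R * th).
Proof.
suff: cheb (2 * Rtrigo_def.cos th) k * Rtrigo_def.sin th = Rtrigo_def.sin (k%:R * th) /\
  cheb (2 * Rtrigo_def.cos th) k.+1 * Rtrigo_def.sin th = Rtrigo_def.sin (k.+1%:R * th) by case.
elim: k => [|k [IH1 IH2]].
  by rewrite cheb0 !mul0r Rtrigo_def.sin_0 cheb1 !mul1r.
split=> //; rewrite chebSS mulrBl IH1 -[X in X - _]mulrA IH2.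
have -> : k.+2%:R * th = k%:R * th + th + th :> R by rewrite -!natr1; ring.
have -> : k.+1%:R * th = k%:R * th + th :> R by rewrite -!natr1; ring.
move: (k%:R * th) => a.
have h : Rtrigo_def.sin th * Rtrigo_def.sin th + Rtrigo_def.cos th * Rtrigo_def.cos th = 1.
  exact: Rtrigo1.sin2_cos2.
rewrite !sinD cosD.
have {}h : Rtrigo_def.sin th * Rtrigo_def.sin th = 1 - Rtrigo_def.cos th * Rtrigo_def.cos th by rewrite -h addrK.
by move: h; move: (Rtrigo_def.sin a) (Rtrigo_def.cos a) (Rtrigo_def.sin th) (Rtrigo_def.cos th) => x y z t h; ring: h.
Qed.

(** At this argument [cheb] is [sin (k pi / m) / sin (pi / m)]. Together with [kap1] this is all
    that later proofs use of the cosine: the sign and the vanishing of [kap m] are read from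
    [cheb _ 2]. *)
Lemma kapP m : (1 < m)%N ->
  cheb (kap m) m = 0 /\ forall k, (0 < k < m)%N -> 0 < cheb (kap m) k.
Proof.
move=> m1; rewrite /kap RdivE INRE.
set th := Rtrigo1.PI / m%:R.
have pi0 : 0 < Rtrigo1.PI by apply/RltP/Rtrigo1.PI_RGT_0.
have m0 : 0 < m%:R :> R by rewrite ltr0n (ltn_trans _ m1).
have sin_gt0 x : 0 < x -> x < Rtrigo1.PI -> 0 < Rtrigo_def.sin x.
  by move=> /RltP x0 /RltP xp; apply/RltP/Rtrigo1.sin_gt_0.
have sp k : (0 < k < m)%N -> 0 < Rtrigo_def.sin (k%:R * th).
  case/andP=> k0 km; apply: sin_gt0.
    by apply: mulr_gt0; [rewrite ltr0n | apply: divr_gt0].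
  by rewrite mulrA ltr_pdivrMr // mulrC ltr_pM2l // ltr_nat.
have s1 : 0 < Rtrigo_def.sin th by have := sp 1%N m1; rewrite mul1r.
split=> [|k km].
  apply: (mulIf (lt0r_neq0 s1)); rewrite cheb_sin mul0r /th mulrC divfK ?lt0r_neq0 //.
  exact: Rtrigo1.sin_PI.
by rewrite -(pmulr_lgt0 _ s1) cheb_sin sp.
Qed.

Lemma kap1 : kap 1 = -2.
Proof.
have cosPI : Rtrigo_def.cos Rtrigo1.PI = -1 by exact: Rtrigo1.cos_PI.
by rewrite /kap RdivE INRE divr1 cosPI mulrN1.
Qed.

Lemma kap_ge0 m : (1 < m)%N -> 0 <= kap m.
Proof.
move=> m1; have [h0 hp] := kapP m1.
have c2 : cheb (kap m) 2 = kap m by rewrite chebSS cheb1 cheb0 subr0 mulr1.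
rewrite -c2; case: (ltngtP 2 m) => [m2|m2|->]; last by rewrite h0.
  by rewrite ltW // hp.
by rewrite ltnNge m1 in m2.
Qed.

Lemma kap_eq0 m : (1 < m)%N -> (kap m == 0) = (m == 2%N).
Proof.
move=> m1; have [h0 hp] := kapP m1.
have c2 : cheb (kap m) 2 = kap m by rewrite chebSS cheb1 cheb0 subr0 mulr1.
rewrite -c2; case: (ltngtP 2 m) => [m2|m2|e]; last by rewrite e h0 !eqxx.
  by rewrite gt_eqF ?hp.
by rewrite ltnNge m1 in m2.
Qed.

(** The recurrence reads the same backwards, so the sequence is antisymmetric about each of its
    zeros. The sums in [cheb_sum_odd] and [cheb_sum_even] then cancel in pairs. *)
Lemma cheb_anti x m i : cheb x m = 0 -> (i <= m)%N ->
  cheb x (m + i) = - cheb x (m - i).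
Proof.
move=> h; suff: forall i, ((i <= m)%N -> cheb x (m + i) = - cheb x (m - i)) /\
   ((i < m)%N -> cheb x (m + i.+1) = - cheb x (m - i.+1)) by move=> H; case: (H i).
elim=> [|{}i [IH1 IH2]]; split=> // im.
- by rewrite addn0 subn0 h oppr0.
- case: m h im => // m h _; rewrite subSS subn0 addn1 chebSS h mulr0 sub0r.
  by [].
- have IH1' := IH1 (ltnW (ltnW im)); have IH2' := IH2 (ltnW im).
  rewrite !addnS chebSS -addnS IH2' IH1'.
  have -> : (m - i)%N = (m - i.+2).+2 by lia.
  have -> : (m - i.+1)%N = (m - i.+2).+1 by lia.
  by rewrite chebSS; ring.
Qed.

Lemma sumr_anti (m : nat) (F : nat -> R) :
  (forall j, (j < m)%N -> F (m.-1 - j)%N = - F j) -> \sum_(j < m) F j = 0.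
Proof.
move=> H; set s := \sum_(j < m) F j.
have e : s = - s.
  rewrite {1}/s (reindex_inj rev_ord_inj) /= -sumrN; apply: eq_bigr => j _.
  by rewrite -H //; congr F; case: m {H s} j => [[]//|m] j; rewrite subSS.
by lra.
Qed.

Lemma cheb_rev x m i : cheb x m = 0 -> (i <= m.*2)%N ->
  cheb x (m.*2 - i) = - cheb x i.
Proof.
move=> h im; case: (leqP i m) => im'.
  rewrite (_ : m.*2 - i = m + (m - i))%N; last by lia.
  by rewrite cheb_anti ?leq_subr // subKn.
rewrite (_ : m.*2 - i = m - (i - m))%N; last by lia.
rewrite -[LHS]opprK -cheb_anti //; last by lia.
by rewrite subnKC // ltnW.
Qed.

Lemma cheb_sum_odd x m : cheb x m = 0 -> \sum_(j < m) cheb x j.*2.+1 = 0.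
Proof.
move=> h; apply: (sumr_anti (F := fun j => cheb x j.*2.+1)) => j jm.
by rewrite -(cheb_rev h); [congr cheb | ]; lia.
Qed.

Lemma cheb_sum_even x m : cheb x m = 0 -> \sum_(j < m.+1) cheb x j.*2 = 0.
Proof.
move=> h; apply: (sumr_anti (F := fun j => cheb x j.*2)) => j jm /=.
by rewrite -(cheb_rev h); [congr cheb | ]; lia.
Qed.

(** * The Coxeter form, its simple reflections and their braid relations *)

Section Form.
Context {gT : finGroupType}.
Implicit Types (a b s t w g : gT).

(** Coordinates are indexed by all of [gT], so the form and the reflections do not mention [S];
    [root_supp] shows that roots are supported on [S]. *)
Definition V := {ffun gT -> R^o}.
Implicit Types (x y z : V).

Definition kf a b : R := - kap #[a * b]%g.

Lemma kfC a b : kf a b = kf b a.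
Proof.
rewrite /kf -(orderJ (a * b)%g a); congr (- kap #[_]%g).
by rewrite conjgE mulgA mulgA mulVg mul1g.
Qed.

Lemma kf1 a : (a * a = 1)%g -> kf a a = 2.
Proof. by rewrite /kf => ->; rewrite order1 kap1 opprK. Qed.

Lemma order_mul_gt1 a b : (a * a = 1)%g -> a != b -> (1 < #[a * b]%g)%N.
Proof.
move=> aa ab; rewrite order_gt1; apply: contra_neq ab => e.
by rewrite -[b]mul1g -aa -mulgA e mulg1.
Qed.

Lemma kf_le0 a b : (a * a = 1)%g -> a != b -> kf a b <= 0.
Proof. by move=> aa ab; rewrite oppr_le0 kap_ge0 ?order_mul_gt1. Qed.

Lemma kf_eq0 a b : (a * a = 1)%g -> (b * b = 1)%g -> a != b ->
  (kf a b == 0) = (a * b == b * a)%g.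
Proof.
move=> aa bb ab; rewrite oppr_eq0 kap_eq0 ?order_mul_gt1 //.
have ai : (a^-1 = a)%g by apply/eqP; rewrite eq_invg_mul aa.
have bi : (b^-1 = b)%g by apply/eqP; rewrite eq_invg_mul bb.
have e : ((a * b) ^+ 2 == 1)%g = (a * b == b * a)%g.
  by rewrite expgS expg1 -eq_invg_mul invMg ai bi eq_sym.
rewrite -e -order_dvdn; move: (order_mul_gt1 aa ab).
by case: #[_]%g => [|[|[|n]]].
Qed.

Definition bil x y : R := \sum_a \sum_b x a * y b * kf a b.
Definition alpha a : V := [ffun b => (b == a)%:R].

Lemma alphaE a b : alpha a b = (b == a)%:R. Proof. by rewrite ffunE. Qed.
Lemma addE x y a : (x + y) a = x a + y a. Proof. by rewrite ffunE. Qed.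
Lemma oppE x a : (- x) a = - x a. Proof. by rewrite ffunE. Qed.
Lemma scaleE (k : R) x a : (k *: x) a = k * x a. Proof. by rewrite ffunE. Qed.
Definition vE := (addE, oppE, scaleE, alphaE).

Lemma bilC x y : bil x y = bil y x.
Proof.
rewrite /bil exchange_big; apply: eq_bigr => b _; apply: eq_bigr => a _.
by rewrite kfC [x a * _]mulrC.
Qed.

Lemma bilDl x y z : bil (x + y) z = bil x z + bil y z.
Proof.
rewrite /bil -big_split; apply: eq_bigr => a _; rewrite -big_split.
by apply: eq_bigr => b _; rewrite addE !mulrDl.
Qed.

Lemma bilZl k x z : bil (k *: x) z = k * bil x z.
Proof.
rewrite /bil mulr_sumr; apply: eq_bigr => a _; rewrite mulr_sumr.
by apply: eq_bigr => b _; rewrite scaleE !mulrA.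
Qed.

Lemma bilDr x y z : bil z (x + y) = bil z x + bil z y.
Proof. by rewrite !(bilC z) bilDl. Qed.
Lemma bilZr k x z : bil z (k *: x) = k * bil z x.
Proof. by rewrite !(bilC z) bilZl. Qed.
Lemma bilNl x z : bil (- x) z = - bil x z.
Proof. by rewrite -scaleN1r bilZl mulN1r. Qed.
Lemma bilNr x z : bil z (- x) = - bil z x.
Proof. by rewrite !(bilC z) bilNl. Qed.
Definition bilE := (bilDl, bilDr, bilNl, bilNr, bilZl, bilZr).

Lemma bil_alphal a x : bil (alpha a) x = \sum_b x b * kf a b.
Proof.
rewrite /bil (bigD1 a) //= [X in _ + X]big1 ?addr0 => [|c ca].
  by apply: eq_bigr => b _; rewrite alphaE eqxx mul1r.
by apply: big1 => b _; rewrite alphaE (negbTE ca) !mul0r.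
Qed.

Lemma bil_alpha a b : bil (alpha a) (alpha b) = kf a b.
Proof.
rewrite bil_alphal (bigD1 b) //= [X in _ + X]big1 ?addr0 => [|c cb].
  by rewrite alphaE eqxx mul1r.
by rewrite alphaE (negbTE cb) mul0r.
Qed.

Definition refl a x : V := x - bil (alpha a) x *: alpha a.

Lemma reflD a x y : refl a (x + y) = refl a x + refl a y.
Proof. by rewrite /refl bilDr scalerDl opprD addrACA. Qed.
Lemma reflZ a k x : refl a (k *: x) = k *: refl a x.
Proof. by rewrite /refl bilZr scalerBr scalerA. Qed.
Lemma reflE a x b : refl a x b = x b - bil (alpha a) x * (b == a)%:R.
Proof. by rewrite /refl !vE. Qed.
Lemma refl_neq a x b : b != a -> refl a x b = x b.
Proof. by rewrite reflE => /negbTE ->; rewrite mulr0 subr0. Qed.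

Lemma bil_refl a x y : (a * a = 1)%g -> bil (refl a x) (refl a y) = bil x y.
Proof.
move=> aa; rewrite /refl !bilE bil_alpha kf1 // [bil x (alpha a)]bilC.
by ring.
Qed.

Lemma reflK a : (a * a = 1)%g -> involutive (refl a).
Proof.
move=> aa x; rewrite /refl !bilE bil_alpha kf1 //.
by apply/ffunP => b; rewrite !vE; ring.
Qed.

(** Argued on coefficients, which avoids splitting off the orthogonal complement of a plane: each
    reflection subtracts a multiple of a simple root, these multiples obey the Chebyshev recurrence,
    and over [m] rounds they add up to zero. *)
Lemma refl_braid s t x : (s * s = 1)%g -> (t * t = 1)%g -> s != t ->
  iter #[s * t]%g (refl s \o refl t) x = x.
Proof.
move=> ss tt st; set m := #[_]%g; set K := kap m.
have [um _] := kapP (order_mul_gt1 ss st).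
have kst : bil (alpha s) (alpha t) = - K by rewrite bil_alpha.
have kts : bil (alpha t) (alpha s) = - K by rewrite bilC.
have kss : bil (alpha s) (alpha s) = 2 by rewrite bil_alpha kf1.
have ktt : bil (alpha t) (alpha t) = 2 by rewrite bil_alpha kf1.
pose b := bil (alpha t) x; pose b' := bil (alpha s) x.
(* [q] lists the multiples in the order of subtraction: even indices belong to [alpha t], odd ones
   to [alpha s]. *)
pose q i := cheb K i.+1 * b + cheb K i * b'.
have qS i : q i.+2 = K * q i.+1 - q i by rewrite /q !chebSS; ring.
have H n : [/\ bil (alpha t) (iter n (refl s \o refl t) x) = q n.*2,
   bil (alpha s) (iter n (refl s \o refl t) x) = q n.*2.+1 - K * q n.*2 &
   iter n (refl s \o refl t) x = x - (\sum_(j < n) q j.*2) *: alpha t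
      - (\sum_(j < n) q j.*2.+1) *: alpha s].
  elim: n => [|n [IH1 IH2 IH3]].
    rewrite /q chebSS cheb0 cheb1 !big_ord0 !scale0r !subr0 -/b -/b'.
    by split=> //; ring.
  have e : iter n.+1 (refl s \o refl t) x = iter n (refl s \o refl t) x
      - q n.*2 *: alpha t - q n.*2.+1 *: alpha s.
    rewrite iterS /= /refl IH1 !bilE IH2 kst; congr (_ - _ *: _); ring.
  rewrite e !bilE IH1 IH2 kst kts kss ktt doubleS !qS; split; [ring|ring|].
  rewrite IH3 !big_ord_recr /=; apply/ffunP => c; rewrite !vE; ring.
have [_ _ ->] := H m.
have -> : \sum_(j < m) q j.*2 = 0.
  rewrite big_split /= -!mulr_suml cheb_sum_odd // mul0r add0r.
  have := cheb_sum_even um; rewrite big_ord_recr /= => e.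
  have u2 : cheb K m.*2 = 0.
    by have := cheb_anti um (leqnn m); rewrite addnn subnn cheb0 oppr0.
  by move: e; rewrite u2 addr0 => ->; rewrite mul0r.
have -> : \sum_(j < m) q j.*2.+1 = 0.
  rewrite big_split /= -!mulr_suml cheb_sum_odd // mul0r addr0.
  have := cheb_sum_even um; rewrite big_ord_recl /= cheb0 add0r => e.
  by under eq_bigr do rewrite -doubleS; rewrite e mul0r.
by rewrite !scale0r !subr0.
Qed.

Record bij := Bij { bfun : V -> V; binv : V -> V;
  bfunK : cancel bfun binv; binvK : cancel binv bfun }.

Lemma bij_ext (f g : bij) : bfun f =1 bfun g -> f = g.
Proof.
case: f g => [f f' fK Kf] [g g' gK Kg] /= /funext e; subst g.
have e : f' = g' by apply: funext => x; rewrite -{1}(Kg x) fK.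
by subst g'; congr Bij; apply: Prop_irrelevance.
Qed.

Definition bij_mul (f g : bij) : bij :=
  Bij (can_comp (bfunK f) (bfunK g)) (can_comp (binvK g) (binvK f)).
Definition bij_one : bij := @Bij id id (fun=> erefl) (fun=> erefl).
Definition bij_inv (f : bij) : bij := Bij (binvK f) (bfunK f).

Definition bij_group : abs_group.
Proof.
refine (@AbsGroup bij bij_mul bij_one bij_inv _ _ _).
- by move=> f g h; apply: bij_ext.
- by move=> f; apply: bij_ext.
- by move=> f; apply: bij_ext => x /=; rewrite bfunK.
Defined.

Lemma bij_powE (f : bij) n x : bfun (@ag_pow bij_group f n) x = iter n (bfun f) x.
Proof. by elim: n => //= n ->. Qed.

Definition bij_refl a : bij :=
  if @idP (a * a == 1)%g is ReflectT e then
    Bij (reflK (eqP e)) (reflK (eqP e)) else bij_one.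

Lemma bij_reflE a : (a * a = 1)%g -> bfun (bij_refl a) =1 refl a.
Proof.
by move=> aa; rewrite /bij_refl; case: {-}_ / idP => // h; rewrite aa eqxx in h.
Qed.

End Form.
Arguments V : clear implicits.

Section Action.
Context {gT : finGroupType} (S : {set gT}).

(** Choosing a reduced word makes [geo] a total definition, free of the Coxeter hypothesis. That
    such a word is found is [rwordP]; that every other word gives the same map is [act_word]. *)
Definition rword w : seq gT :=
  oapp val [::] [pick t : (ell S w).-tuple gT | all (mem S) t && (prodw t == w)].

Definition geo w (x : V gT) : V gT := foldr (@refl gT) x (rword w).

Definition pos (x : V gT) : bool := [forall a, 0 <= x a].

(** The last factor is [t] whatever the parity of [k]; the first one depends on the parity, see
    [alt_left]. *)
Fixpoint alt (s t : gT) k : gT := if k is k'.+1 then (alt t s k' * t)%g else 1%g.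

End Action.

Section Roots.
Context {gT : finGroupType} (S : {set gT}).
Implicit Types (w s : gT) (x : V gT).

Definition root x : Prop := exists g s, s \in S /\ x = geo S g (alpha s).
Definition inv w x : Prop := [/\ root x, pos x & pos (- geo S w^-1%g x)].
Definition des w s : bool := (s \in S) && (ell S (w * s)%g < ell S w)%N.
Definition wsub u v : Prop := forall x, inv u x -> inv v x.
Definition supp (J : {pred gT}) x : bool := [forall a, (a \notin J) ==> (x a == 0)].
End Roots.

Section Sortable.
Context {gT : finGroupType} (S : {set gT}).
Implicit Types (w s : gT) (c : seq gT) (x y : V gT).

(* The Euler form: [eul c (alpha a) (alpha b)] is [kf a b] when [a] occurs before
   [b] in [c], [1] when [a = b], and [0] otherwise. *)
Fixpoint eul c x y : R :=
  if c is s :: c' then x s * (y s + \sum_(b <- c') y b * kf s b) + eul c' x y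
  else 0.

(* [srt c w L F]: reading [c] cyclically and dropping a letter for good the first
   time it is skipped, one spells [w]; [L] lists the inversions of [w] in this
   order, and [F] the root skipped together with its letter. *)
Inductive srt : seq gT -> gT -> seq (V gT) -> seq (V gT * gT) -> Prop :=
| srt_nil : srt [::] 1%g [::] [::]
| srt_take s c w L F : s \in S -> ~ inv S w (alpha s) ->
    srt (rcons c s) w L F ->
    srt (s :: c) (s * w)%g (alpha s :: map (refl s) L)
      [seq (refl s p.1, p.2) | p <- F]
| srt_skip s c w L F : s \in S -> ~ inv S w (alpha s) ->
    srt c w L F -> srt (s :: c) w L ((alpha s, s) :: F).

Definition Srt c w := exists L F, srt c w L F.

(** The bipolar form of the closed convex cone generated by [P]. Membership is only ever tested on
    particular functionals, so no explicit nonnegative coefficients have to be carried along. *)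
Definition cone (P : V gT -> Prop) x : Prop :=
  forall f : V gT -> R, (forall k y z, f (k *: y + z) = k * f y + f z) ->
  (forall y, P y -> f y <= 0) -> f x <= 0.

Definition wf c : bool := uniq c && all (mem S) c.
End Sortable.

(** * Length, roots and the weak order *)

Section Coxeter.
Context {gT : finGroupType} {S : {set gT}} (HS : coxeter_system S).

Implicit Types (a b s t u v w g : gT) (l c : seq gT).
Local Notation inS l := (all (mem S) l).
Local Notation reduced l := (reduced S l).
Local Notation ell w := (Defs.ell S w%g).
Local Notation le := (weak_le S).
Local Notation act w := (geo S w%g).
Local Notation root := (root S).
Local Notation inv w := (inv S w%g).
Local Notation des w := (des S w%g).
Local Notation wsub u v := (wsub S u%g v%g).
Local Notation srt := (srt S).
Local Notation Srt := (Srt S).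
Local Notation wf := (wf S).

(** * The length function, its parity, and the action on [V] *)

Section Length.
Local Open Scope group_scope.

Lemma invol s : s \in S -> s * s = 1.
Proof. by case: HS => _ h _ _; apply: h. Qed.
Lemma involV s : s \in S -> s^-1 = s.
Proof. by move=> /invol h; apply/eqP; rewrite eq_invg_mul h. Qed.
Lemma involK s w : s \in S -> s * (s * w) = w.
Proof. by move=> h; rewrite mulgA invol // mul1g. Qed.
Lemma involKr s w : s \in S -> w * s * s = w.
Proof. by move=> h; rewrite -mulgA invol // mulg1. Qed.

Lemma prodw_nil : prodw [::] = 1 :> gT. Proof. by rewrite /prodw big_nil. Qed.
Lemma prodw_cons a l : prodw (a :: l) = a * prodw l.
Proof. by rewrite /prodw big_cons. Qed.
Lemma prodw_cat l1 l2 : prodw (l1 ++ l2) = prodw l1 * prodw l2.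
Proof. by rewrite /prodw big_cat. Qed.
Lemma prodw_rcons l a : prodw (rcons l a) = prodw l * a.
Proof. by rewrite -cats1 prodw_cat prodw_cons prodw_nil mulg1. Qed.

Lemma ballP n w :
  reflect (exists l, [/\ inS l, (size l <= n)%N & prodw l = w]) (w \in ball S n).
Proof.
elim: n w => [|n IH] w /=.
  rewrite inE; apply: (iffP eqP) => [->|[[|a l] [_ // _ <-]]]; last exact: prodw_nil.
  by exists [::]; rewrite prodw_nil.
rewrite inE; apply: (iffP orP) => [[/IH[l [h1 h2 h3]]|/mulsgP[u s]]|[l]].
- by exists l; split => //; apply: leqW.
- move=> /IH[l [h1 h2 h3]] sS ->; exists (rcons l s).
  by rewrite all_rcons /= sS h1 size_rcons prodw_rcons h3.
- case/lastP: l => [|l s]; first by move=> [_ _ <-]; left; apply/IH; exists [::].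
  rewrite all_rcons size_rcons prodw_rcons => -[/= /andP[sS lS] le <-]; right.
  by apply/mulsgP; exists (prodw l) s => //; apply/IH; exists l.
Qed.

Lemma ball_mono n m : (n <= m)%N -> ball S n \subset ball S m.
Proof.
move=> nm; apply/subsetP => w /ballP[l [h1 h2 h3]].
by apply/ballP; exists l; split=> //; apply: leq_trans nm.
Qed.

Lemma ball_word w : exists l, inS l /\ prodw l = w.
Proof.
have : w \in <<S>> by case: HS => _ _ -> _; rewrite inE.
case/gen_prodgP => n [c hc ->]; exists [seq c i | i <- index_enum 'I_n]; split.
  by apply/allP => x /mapP[i _ ->]; apply: hc.
by rewrite /prodw big_map.
Qed.

Lemma ball_stab n : ball S n.+1 = ball S n -> forall w, w \in ball S n.
Proof.
move=> e w; have [l [lS <-]] := ball_word w.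
elim/last_ind: l lS => [|l s IH]; first by move=> _; apply/ballP; exists [::].
rewrite all_rcons prodw_rcons => /= /andP[sS lS].
by rewrite -e /= inE mem_mulg ?orbT // IH.
Qed.

(** Balls grow strictly until they are stable, and a stable ball is everything. Hence the search in
    [ell], which stops before [#|gT|], always succeeds. *)
Lemma ball_full w : w \in ball S #|gT|.-1.
Proof.
have H n : (forall w, w \in ball S n) \/ (n < #|ball S n|)%N.
  elim: n => [|n [IH|IH]]; first by right; rewrite /= cards1.
    by left=> v; apply: (subsetP (ball_mono (leqnSn n))).
  have [e|e] := eqVneq (ball S n.+1) (ball S n); first by left=> v; rewrite e ball_stab.
  right; apply: leq_ltn_trans IH _; apply: proper_card.
  by rewrite properEneq eq_sym e ball_mono.
have [//|h] := H #|gT|.-1.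
suff /eqP -> : ball S #|gT|.-1 == setT by rewrite inE.
rewrite eqEcard subsetT cardsT; apply: leq_trans h.
by rewrite prednK //; apply/card_gt0P; exists 1.
Qed.

Lemma ell_le w n : (ell w <= n)%N = (w \in ball S n).
Proof.
rewrite /Defs.ell; set P := fun n => _; set N := #|gT|.
have N0 : (0 < N)%N by apply/card_gt0P; exists 1.
have hP : has P (iota 0 N).
  by apply/hasP; exists N.-1; rewrite ?mem_iota ?add0n ?leq0n ?prednK //= /P ball_full.
apply/idP/idP => [|wn].
  move=> /ball_mono/subsetP; apply; rewrite -/(P _).
  have := nth_find 0%N hP; rewrite nth_iota ?add0n //.
  by move: hP; rewrite has_find size_iota.
rewrite leqNgt; apply/negP => h; have := before_find 0%N h.
rewrite nth_iota ?add0n /P ?wn //.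
by apply: (ltn_trans h); move: hP; rewrite has_find size_iota.
Qed.

Lemma ell_word w : exists l, [/\ inS l, prodw l = w & size l = ell w].
Proof.
have : w \in ball S (ell w) by rewrite -ell_le.
case/ballP => l [h1 h2 h3]; exists l; split=> //; apply/eqP; rewrite eqn_leq h2 ell_le.
by apply/ballP; exists l.
Qed.

Lemma ell_prodw l : inS l -> (ell (prodw l) <= size l)%N.
Proof. by move=> h; rewrite ell_le; apply/ballP; exists l. Qed.

Lemma ell1 : ell 1 = 0%N.
Proof. by apply/eqP; rewrite -leqn0 -prodw_nil ell_prodw. Qed.

Lemma ell_eq0 w : (ell w == 0%N) = (w == 1).
Proof.
apply/eqP/eqP => [h|->]; last exact: ell1.
have [l [_ e]] := ell_word w; rewrite h -e; case: l {e} => // _.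
exact: prodw_nil.
Qed.

Lemma ellM u v : (ell (u * v) <= ell u + ell v)%N.
Proof.
have [l [h1 h2 <-]] := ell_word u; have [l' [h1' h2' <-]] := ell_word v.
by rewrite -h2 -h2' -prodw_cat -size_cat ell_prodw // all_cat h1.
Qed.

Lemma ellV_le w : (ell w^-1 <= ell w)%N.
Proof.
have [l [h1 <- <-]] := ell_word w.
suff -> : (prodw l)^-1 = prodw (rev l) by rewrite -size_rev ell_prodw ?all_rev.
elim: l h1 => [|a l IH] /=; first by rewrite prodw_nil invg1.
by case/andP=> aS lS; rewrite prodw_cons invMg rev_cons prodw_rcons IH // involV.
Qed.

Lemma ellV w : ell w^-1 = ell w.
Proof. by apply/eqP; rewrite eqn_leq ellV_le -{1}[w]invgK ellV_le. Qed.

Lemma ell_gen s : s \in S -> (ell s <= 1)%N.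
Proof. by move=> h; rewrite ell_le; apply/ballP; exists [:: s]; rewrite prodw_cons prodw_nil mulg1 /= h. Qed.

Definition bool_group : abs_group.
Proof.
by refine (@AbsGroup bool addb false id _ _ _) => [[] [] []|[]|[]].
Defined.

(** The sign character: each generator goes to [true] in the group of order 2, where every relation
    holds trivially. It excludes [ell (w * s) = ell w]. *)
Lemma parity : exists sg : gT -> bool, forall l, inS l -> sg (prodw l) = odd (size l).
Proof.
case: (HS) => _ _ _ /(_ bool_group (fun=> true)).
case=> [s t _ _ /=|sg [sgM sgS]].
  by elim: #[_] => //= n ->.
exists sg; have sg1 : sg 1 = false by have := sgM 1 1; rewrite mulg1 /=; case: (sg 1).
elim=> [|a l IH] /=; first by rewrite prodw_nil.
by case/andP=> aS lS; rewrite prodw_cons sgM /= IH // sgS //= .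
Qed.

Lemma ell_mulr w s : s \in S ->
  ell (w * s) = (ell w).+1 \/ ell w = (ell (w * s)).+1.
Proof.
move=> sS; have [sg sgP] := parity.
have [l [h1 h2 h3]] := ell_word w; have [l' [h1' h2' h3']] := ell_word (w * s).
have o1 : odd (ell (w * s)) = ~~ odd (ell w).
  rewrite -h3 -h3' -!sgP // h2' -h2 -prodw_rcons sgP ?all_rcons /= ?sS //.
  by rewrite size_rcons sgP.
have l1 : (ell (w * s) <= (ell w).+1)%N.
  by apply: (leq_trans (ellM _ _)); rewrite -addn1 leq_add2l ell_gen.
have l2 : (ell w <= (ell (w * s)).+1)%N.
  by rewrite -{1}(involKr w sS); apply: (leq_trans (ellM _ _)); rewrite -addn1 leq_add2l ell_gen.
by move: (ell w) (ell _) o1 l1 l2 => a b; lia.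
Qed.

Lemma ell_mull w s : s \in S ->
  ell (s * w) = (ell w).+1 \/ ell w = (ell (s * w)).+1.
Proof.
move=> sS; have := ell_mulr w^-1 sS.
by rewrite !ellV -[w^-1 * s]invgK ellV invMg invgK involV.
Qed.

Lemma rep : exists phi : gT -> @bij gT,
  (forall x y, phi (x * y) = bij_mul (phi x) (phi y)) /\
  {in S, forall s, phi s = bij_refl s}.
Proof.
case: (HS) => _ _ _ /(_ (@bij_group gT) (@bij_refl gT)); apply=> s t sS tS.
apply: bij_ext => x; rewrite bij_powE /=.
have hs := invol sS; have ht := invol tS.
transitivity (iter #[s * t] (refl s \o refl t) x).
  by elim: #[_] => //= n ->; rewrite !bij_reflE.
have [<-|st] := eqVneq s t; last by rewrite refl_braid.
by rewrite hs order1 /= reflK.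
Qed.

End Length.

(** * Roots, their signs, and faithfulness of the geometric representation *)

Section RootSystem.
Implicit Types (x y z : V gT) (J K : {pred gT}).

Lemma rwordP w : [/\ inS (rword S w), prodw (rword S w) = w & size (rword S w) = ell w].
Proof.
rewrite /rword; case: pickP => [t /andP[h1 /eqP h2]|h] /=; first by rewrite size_tuple.
have [l [h1 h2 h3]] := ell_word w.
by have := h (tcast h3 (in_tuple l)); rewrite val_tcast /= h1 h2 eqxx.
Qed.

Lemma act_word l x : inS l -> act (prodw l) x = foldr (@refl gT) x l.
Proof.
have [phi [phiM phiS]] := rep.
have phi1 y : bfun (phi 1%g) y = y.
  have := phiM 1%g 1%g; rewrite mulg1 => e.
  by rewrite -[LHS](bfunK (phi 1%g)) -[X in binv _ X]/(bfun (bij_mul _ _) y) -e bfunK.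
have H l' y : inS l' -> foldr (@refl gT) y l' = bfun (phi (prodw l')) y.
  elim: l' => [|s l' IH] /=; first by rewrite prodw_nil phi1.
  case/andP=> sS l'S; rewrite IH // prodw_cons phiM (phiS s) //.
  by rewrite -[RHS]/(bfun (bij_refl s) _) bij_reflE ?invol.
move=> lS; rewrite H // /geo H; first by have [_ -> _] := rwordP (prodw l).
by case: (rwordP (prodw l)).
Qed.

Lemma act1 x : act 1 x = x.
Proof. by rewrite -prodw_nil act_word. Qed.

Lemma actM v w x : act (v * w) x = act v (act w x).
Proof.
have [h1 e1 _] := rwordP v; have [h2 e2 _] := rwordP w.
by rewrite -{1}e1 -{1}e2 -prodw_cat act_word ?all_cat ?h1 // foldr_cat.
Qed.

Lemma act_gen s x : s \in S -> act s x = refl s x.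
Proof.
move=> sS; have e : prodw [:: s] = s by rewrite prodw_cons prodw_nil mulg1.
by rewrite -{1}e act_word //= sS.
Qed.

Lemma act_ind (P : (V gT -> V gT) -> Prop) :
  P id -> (forall s f, s \in S -> P f -> P (refl s \o f)) -> forall w, P (act w).
Proof.
move=> P0 PS w; have [h _ _] := rwordP w.
suff: P (fun x => foldr (@refl gT) x (rword S w)) by [].
elim: (rword S w) h => //= s l IH /andP[sS lS].
exact: (PS s (fun x => foldr (@refl gT) x l) sS (IH lS)).
Qed.

Lemma actD w x y : act w (x + y) = act w x + act w y.
Proof.
move: x y; apply: (act_ind (P := fun f => forall x y, f (x + y) = f x + f y)) => //.
by move=> s f _ IH x y /=; rewrite IH reflD.
Qed.
Lemma actZ w k x : act w (k *: x) = k *: act w x.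
Proof.
move: x; apply: (act_ind (P := fun f => forall x, f (k *: x) = k *: f x)) => //.
by move=> s f _ IH x /=; rewrite IH reflZ.
Qed.
Lemma actN w x : act w (- x) = - act w x.
Proof. by rewrite -scaleN1r actZ scaleN1r. Qed.
Lemma actB w x y : act w (x - y) = act w x - act w y.
Proof. by rewrite actD actN. Qed.
Lemma act_bil w x y : bil (act w x) (act w y) = bil x y.
Proof.
move: x y; apply: (act_ind (P := fun f => forall x y, bil (f x) (f y) = bil x y)) => //.
by move=> s f sS IH x y /=; rewrite bil_refl ?invol.
Qed.
Lemma actK w x : act w^-1 (act w x) = x.
Proof. by rewrite -actM mulVg act1. Qed.
Lemma actVK w x : act w (act w^-1 x) = x.
Proof. by rewrite -actM mulgV act1. Qed.

Lemma posP x : reflect (forall a, 0 <= x a) (pos x).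
Proof. exact: forallP. Qed.
Lemma posD x y : pos x -> pos y -> pos (x + y).
Proof. by move=> /posP hx /posP hy; apply/posP => a; rewrite addE addr_ge0. Qed.
Lemma posZ k x : 0 <= k -> pos x -> pos (k *: x).
Proof. by move=> hk /posP hx; apply/posP => a; rewrite scaleE mulr_ge0. Qed.
Lemma pos_alpha s : pos (alpha s).
Proof. by apply/posP => a; rewrite alphaE ler0n. Qed.
Lemma pos_antisym x : pos x -> pos (- x) -> x = 0.
Proof.
move=> /posP h /posP h'; apply/ffunP => a; rewrite ffunE; apply/eqP.
by rewrite eq_le h -oppr_ge0 -oppE h'.
Qed.

Lemma alt_left s t k : alt s t k.+1 = ((if odd k then s else t) * alt s t k)%g.
Proof.
elim: k s t => [|k IH] s t; first by rewrite /= mulg1 mul1g.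
rewrite -[LHS]/(alt t s k.+1 * t)%g IH -mulgA -[(alt t s k * t)%g]/(alt s t k.+1) /=.
by case: (odd k).
Qed.

Lemma expg_shift (x y : gT) k : (x * (y * x) ^+ k * y)%g = ((x * y) ^+ k.+1)%g.
Proof.
elim: k => [|k IH]; first by rewrite expg0 mulg1 expg1.
by rewrite [in RHS]expgS -IH expgS !mulgA.
Qed.

Lemma alt_quot s t k : s \in S -> t \in S ->
  (alt s t k * (alt t s k)^-1)%g = ((if odd k then t * s else s * t) ^+ k)%g.
Proof.
move=> sS tS; elim: k => [|k IH]; first by rewrite /= invg1 mulg1.
rewrite !alt_left invMg mulgA -(mulgA _ (alt s t k)) IH /=.
by case: (odd k) => /=; rewrite involV // expg_shift.
Qed.

Lemma alt_braid s t : s \in S -> t \in S ->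
  alt s t #[s * t]%g = alt t s #[s * t]%g.
Proof.
move=> sS tS; apply/eqP; rewrite eq_mulgV1 alt_quot //.
have e : #[t * s]%g = #[s * t]%g.
  by rewrite -(orderJ (s * t)%g s) conjgE !mulgA mulVg mul1g.
by case: ifP => _; rewrite ?expg_order // -e expg_order.
Qed.

Lemma alt_word s t k : s \in S -> t \in S ->
  exists l, [/\ inS l, prodw l = alt s t k & size l = k].
Proof.
elim: k s t => [|k IH] s t sS tS; first by exists [::]; rewrite prodw_nil.
have [l [h1 h2 h3]] := IH t s tS sS; exists (rcons l t).
by rewrite all_rcons /= tS h1 prodw_rcons h2 size_rcons h3.
Qed.

Lemma ell_alt s t k : s \in S -> t \in S -> (ell (alt s t k) <= k)%N.
Proof. by move=> sS tS; have [l [h1 <- <-]] := alt_word k sS tS; apply: ell_prodw. Qed.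

Lemma act_alt s t k : s \in S -> t \in S ->
  act (alt s t k) (alpha s) =
  cheb (kap #[s * t]%g) k.+1 *: alpha (if odd k then t else s) +
  cheb (kap #[s * t]%g) k *: alpha (if odd k then s else t).
Proof.
move=> sS tS; set K := kap _; have hs : (s * s = 1)%g by exact: invol.
have ht : (t * t = 1)%g by exact: invol.
have kst : kf s t = - K by [].
have kts : kf t s = - K by rewrite kfC.
elim: k => [|k IH]; first by rewrite /= act1 cheb0 cheb1 scale1r scale0r addr0.
rewrite alt_left actM IH act_gen; last by case: ifP.
rewrite reflD !reflZ /refl !bil_alpha /= chebSS.
by case: (odd k) => /=; rewrite ?(kf1 hs) ?(kf1 ht) ?kst ?kts; apply/ffunP => c; rewrite !vE; ring.
Qed.

(* Write [w = v * alt s t k] with [k] maximal; then [v] lengthens both [s] and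
   [t], and [alt s t k] sends [alpha s] to a nonnegative combination of both. *)
Lemma root_pos w s : s \in S -> (ell w < ell (w * s))%N -> pos (act w (alpha s)).
Proof.
move: {2}(ell w) (leqnn (ell w)) => n; elim: n w s => [|n IH] w s len sS ws.
  by move: len; rewrite leqn0 ell_eq0 => /eqP ->; rewrite act1 pos_alpha.
have [w1|w1] := eqVneq w 1%g; first by rewrite w1 act1 pos_alpha.
have [l [lS lw lsz]] := ell_word w.
case/lastP: l lS lw lsz => [_ w1' _|l t]; first by rewrite -w1' prodw_nil eqxx in w1.
rewrite all_rcons prodw_rcons size_rcons => /= /andP[tS lS] lw lsz.
have wt : ell w = (ell (w * t)).+1.
  case: (ell_mulr w tS) => // h.
  have : (ell (w * t) <= size l)%N by rewrite -lw involKr // ell_prodw.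
  by rewrite h -lsz; lia.
have st : s != t by apply: contraTneq ws => ->; rewrite wt -leqNgt leqnSn.
pose P k := [exists v, (w == v * alt s t k)%g && (ell w == ell v + k)%N].
have P1 : P 1%N.
  apply/existsP; exists (w * t)%g; rewrite /= mul1g involKr // eqxx /=.
  by rewrite wt addn1.
have Pk k : P k -> (k <= ell w)%N by case/existsP=> v /andP[_ /eqP ->]; rewrite leq_addl.
have exP : exists k, P k by exists 1%N.
case: (ex_maxnP exP Pk) => k /existsP[v /andP[/eqP wv /eqP lv]] kmax.
have k0 : (0 < k)%N by apply: kmax.
pose e := if odd k then s else t; pose o := if odd k then t else s.
have eS : e \in S by rewrite /e; case: ifP.
have oS : o \in S by rewrite /o; case: ifP.
have ve : (ell v < ell (v * e))%N.
  case: (ell_mulr v eS) => [->//|h]; exfalso.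
  have /kmax : P k.+1; last by rewrite ltnn.
  apply/existsP; exists (v * e)%g; rewrite alt_left -/e -mulgA involK // -wv eqxx /=.
  by rewrite lv h addSnnS.
have down k' : P k'.+1 -> P k'.
  case/existsP=> v' /andP[/eqP wv' /eqP lv']; apply/existsP.
  rewrite alt_left mulgA in wv'; set f := if _ then _ else _ in wv'.
  have fS : f \in S by rewrite /f; case: ifP.
  exists (v' * f)%g; rewrite -wv' eqxx /= lv' addnS eq_sym.
  have := ellM (v' * f) (alt s t k'); rewrite -wv' lv'.
  have := ell_alt k' sS tS.
  by case: (ell_mulr v' fS); move: (ell (v' * f)) (ell v') (ell (alt s t k')) => a b c; lia.
have vo : (ell v < ell (v * o))%N.
  case: k k0 {kmax} @e @o {eS oS ve} wv lv => // k _ e o wv lv.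
  rewrite /o /= if_neg; move: wv; rewrite alt_left mulgA; set f := if _ then _ else _ => wv.
  have := ellM (v * f) (alt s t k); rewrite -wv lv; have := ell_alt k sS tS.
  by move: (ell (v * f)) (ell v) (ell (alt s t k)) => a b c; lia.
(* A tail of length [m] or more could be shortened by [down] to exactly [m]; the braid relation
   would then let [w] end in [s], although [s] lengthens [w]. *)
have km : (k < #[s * t]%g)%N.
  rewrite ltnNge; apply/negP => mk.
  have : P #[s * t]%g.
    have : P k by apply/existsP; exists v; rewrite -wv -lv !eqxx.
    by rewrite -(subnK mk); elim: (k - _)%N => //= j IHj /down.
  case/existsP=> v' /andP[/eqP wv' /eqP lv'].
  have e1 : (w * s = v' * (alt t s #[s * t] * s))%g by rewrite wv' alt_braid // mulgA.
  move: ws; rewrite e1 lv' ltnNge => /negP; apply.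
  case: #[_]%g (order_gt0 (s * t)%g) => // m _.
  rewrite -[alt t s m.+1]/(alt s t m * s)%g involKr //.
  by apply: (leq_trans (ellM _ _)); rewrite leq_add2l (leq_trans (ell_alt m sS tS)).
have [_ chpos] := kapP (order_mul_gt1 (invol sS) st).
have chm : cheb (kap #[s * t]%g) #[s * t]%g = 0 by case: (kapP (order_mul_gt1 (invol sS) st)).
have vn : (ell v <= n)%N by move: len; rewrite lv -(prednK k0) addnS ltnS; apply: leq_trans (leq_addr _ _).
rewrite wv actM act_alt // actD !actZ -/e -/o; apply: posD; apply: posZ.
- have [->|h] := eqVneq k.+1 #[s * t]%g; first by rewrite chm.
  by apply: ltW; apply: chpos; rewrite /= ltn_neqAle h.
- exact: IH.
- by apply: ltW; apply: chpos; rewrite k0.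
- exact: IH.
Qed.

Lemma suppP J x : reflect (forall a, a \notin J -> x a = 0) (supp J x).
Proof.
apply: (iffP forallP) => H a; first by move=> aJ; apply/eqP; move: (H a); rewrite aJ.
by apply/implyP => /H ->.
Qed.

Lemma suppD J x y : supp J x -> supp J y -> supp J (x + y).
Proof. by move=> /suppP hx /suppP hy; apply/suppP => a aJ; rewrite addE hx // hy // addr0. Qed.
Lemma suppZ J k x : supp J x -> supp J (k *: x).
Proof. by move=> /suppP hx; apply/suppP => a aJ; rewrite scaleE hx // mulr0. Qed.
Lemma suppN J x : supp J (- x) = supp J x.
Proof.
suff H y : supp J y -> supp J (- y) by apply/idP/idP => [/H|/H//]; rewrite opprK.
by move=> h; rewrite -scaleN1r suppZ.
Qed.
Lemma supp_alpha J s : s \in J -> supp J (alpha s).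
Proof.
move=> sJ; apply/suppP => a aJ; rewrite alphaE.
by case: eqVneq aJ => // ->; rewrite sJ.
Qed.
Lemma supp_sub J K x : {subset J <= K} -> supp J x -> supp K x.
Proof. by move=> JK /suppP h; apply/suppP => a aK; apply: h; apply: contra aK; apply: JK. Qed.

Lemma refl_self s : s \in S -> refl s (alpha s) = - alpha s.
Proof.
move=> sS; rewrite /refl bil_alpha kf1 ?invol //.
by apply/ffunP => a; rewrite !vE; ring.
Qed.

Lemma reflN s x : refl s (- x) = - refl s x.
Proof. by rewrite -scaleN1r reflZ scaleN1r. Qed.

Lemma refl_inv s x : s \in S -> refl s (refl s x) = x.
Proof. by move=> sS; rewrite reflK // invol. Qed.

Lemma supp_refl J s x : s \in J -> s \in S -> supp J (refl s x) = supp J x.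
Proof.
move=> sJ sS; suff H y : supp J y -> supp J (refl s y).
  by apply/idP/idP => [/H|/H//]; rewrite refl_inv.
by move=> h; rewrite /refl -scaleNr suppD // suppZ // supp_alpha.
Qed.

Lemma root_alpha s : s \in S -> root (alpha s).
Proof. by exists 1%g, s; rewrite act1. Qed.

Lemma root_act w x : root x -> root (act w x).
Proof. by case=> g [s [sS ->]]; exists (w * g)%g, s; rewrite actM. Qed.

Lemma root_refl s x : s \in S -> root x -> root (refl s x).
Proof. by move=> sS h; rewrite -act_gen //; apply: root_act. Qed.

Lemma root_opp x : root x -> root (- x).
Proof.
case=> g [s [sS ->]]; exists (g * s)%g, s; split => //.
by rewrite actM (act_gen _ sS) refl_self // actN.
Qed.

Lemma root_bil x : root x -> bil x x = 2.
Proof. by case=> g [s [sS ->]]; rewrite act_bil bil_alpha kf1 // invol. Qed.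

Lemma root_neq0 x : root x -> x != 0.
Proof.
move=> /root_bil; apply: contra_eq_neq => ->.
rewrite -(scale0r (0 : V gT)) bilZl mul0r; apply/eqP; lra.
Qed.

Lemma root_sign x : root x -> pos x \/ pos (- x).
Proof.
case=> g [s [sS ->]]; case: (ell_mulr g sS) => h.
  by left; apply: root_pos; rewrite // h.
right; have -> : - act g (alpha s) = act (g * s) (alpha s).
  by rewrite actM (act_gen _ sS) refl_self // actN.
by apply: root_pos; rewrite // involKr // h.
Qed.

Lemma root_pos_neg x : root x -> pos x -> pos (- x) -> False.
Proof. by move=> /root_neq0 /eqP h p n; apply: h; apply: pos_antisym. Qed.

Lemma root_negP x : root x -> ~~ pos x -> pos (- x).
Proof. by case/root_sign => // ->. Qed.

Lemma root_supp x : root x -> supp (mem S) x.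
Proof.
case=> g [s [sS ->]]; move: (alpha s) (supp_alpha (J := mem S) sS).
apply: (act_ind (P := fun f => forall y, supp (mem S) y -> supp (mem S) (f y))) => //.
by move=> t f tS IH y /IH; rewrite /= supp_refl.
Qed.

(** [refl s] alters only the [s]-coordinate, so every other coordinate of [x] has both signs and
    vanishes; square length 2 fixes the remaining one. *)
Lemma simple_flip s x : s \in S -> root x -> pos x -> pos (- refl s x) -> x = alpha s.
Proof.
move=> sS rx /posP px /posP nx.
have x0 a : a != s -> x a = 0.
  move=> /refl_neq e; apply/eqP; rewrite eq_le px andbT.
  by have := nx a; rewrite oppE e oppr_ge0.
have e : x = x s *: alpha s.
  apply/ffunP => a; rewrite !vE; case: (eqVneq a s) => [->|/x0 ->]; first by rewrite mulr1.
  by rewrite mulr0.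
have := root_bil rx; rewrite e bilZl bilZr bil_alpha kf1 ?invol // => h.
suff e1 : x s = 1 by rewrite e1 scale1r.
have := px s; move: (x s) h => c h c0.
have : (c - 1) * (c + 1) = 0 by lra.
by move/eqP; rewrite mulf_eq0 => /orP[] /eqP; lra.
Qed.

Lemma pos_refl s x : s \in S -> root x -> pos x -> x != alpha s -> pos (refl s x).
Proof.
move=> sS rx px xs; case: (root_sign (root_refl sS rx)) => // h.
by case/eqP: xs; apply: simple_flip.
Qed.

Lemma ell_neg w s : s \in S -> (ell (w * s) < ell w)%N = pos (- act w (alpha s)).
Proof.
move=> sS; apply/idP/idP => h.
  have -> : - act w (alpha s) = act (w * s) (alpha s).
    by rewrite actM (act_gen _ sS) refl_self // actN.
  by apply: root_pos; rewrite ?involKr.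
case: (ell_mulr w sS) => e; last by rewrite e.
exfalso; apply: (root_pos_neg (root_act w (root_alpha sS)) _ h).
by apply: root_pos; rewrite // e.
Qed.

Lemma des_S w s : des w s -> s \in S.
Proof. by case/andP. Qed.
Lemma des_neg w s : des w s -> pos (- act w (alpha s)).
Proof. by case/andP=> sS; rewrite ell_neg. Qed.
Lemma desI w s : s \in S -> pos (- act w (alpha s)) -> des w s.
Proof. by move=> sS h; apply/andP; rewrite ell_neg. Qed.

Lemma des_exists w : w != 1%g -> exists s, des w s.
Proof.
have [l [lS <- lsz]] := ell_word w.
case/lastP: l lS lsz => [|l t]; first by rewrite prodw_nil eqxx.
rewrite all_rcons size_rcons prodw_rcons => /andP[/= tS lS] lsz _.
by exists t; rewrite /Defs.ell; apply/andP; split => //; rewrite involKr // -lsz ltnS ell_prodw.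
Qed.

Lemma faithful g : {in S, forall s, act g (alpha s) = alpha s} -> g = 1%g.
Proof.
move=> H; apply/eqP; apply/negPn/negP => /des_exists[s hs].
have sS := des_S hs; have := des_neg hs; rewrite H // => h.
exact: root_pos_neg (root_alpha sS) (pos_alpha s) h.
Qed.

Lemma act_conj w s x : s \in S ->
  act (w * s * w^-1) x = x - bil (act w (alpha s)) x *: act w (alpha s).
Proof.
move=> sS; rewrite !actM (act_gen _ sS) /refl actB actZ actVK; congr (_ - _ *: _).
by rewrite -(act_bil w) actVK.
Qed.

Lemma act_simple w s t : s \in S -> t \in S -> act w (alpha s) = alpha t ->
  (w * s = t * w)%g.
Proof.
move=> sS tS e; suff h : (w * s * w^-1 * t = 1)%g.
  have {}h : (w * s * w^-1 = t)%g by rewrite -[LHS](involKr _ tS) h mul1g.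
  by rewrite -h mulgKV.
apply: faithful => r rS; rewrite actM act_conj // e -/(refl t _) act_gen //.
exact: refl_inv.
Qed.

(** * Inversion sets, the weak order, parabolic projections and meets *)

Lemma inv_alpha w s : s \in S -> inv w (alpha s) <-> (ell (s * w) < ell w)%N.
Proof.
move=> sS; have -> : (ell (s * w) < ell w)%N = (ell (w^-1 * s) < ell w^-1)%N.
  by rewrite ellV -(ellV (s * w)) invMg (involV sS).
rewrite ell_neg //; split=> [[_ _ ]//|h]; split=> //; first exact: root_alpha.
exact: pos_alpha.
Qed.

Lemma inv1 x : ~ inv 1 x.
Proof. by case=> rx px; rewrite invg1 act1; apply: root_pos_neg. Qed.

Lemma inv_mul s w x : s \in S -> ~ inv w (alpha s) ->
  inv (s * w) x <-> (x = alpha s \/ inv w (refl s x)).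
Proof.
move=> sS nw; have e y : act (s * w)^-1 y = act w^-1 (refl s y).
  by rewrite invMg actM (involV sS) (act_gen _ sS).
split=> [[rx px nx]|].
  have [->|xs] := eqVneq x (alpha s); [by left|right].
  by split; [apply: root_refl|apply: pos_refl|rewrite -e].
case=> [->|[rx px nx]].
  split; [exact: root_alpha|exact: pos_alpha|rewrite e refl_self // actN opprK].
  case: (root_sign (root_act w^-1 (root_alpha sS))) => // h.
  by case: nw; split; [apply: root_alpha|apply: pos_alpha|].
split; [by rewrite -(refl_inv x sS); apply: root_refl| |by rewrite e].
rewrite -(refl_inv x sS); apply: pos_refl => //.
by apply/eqP => ex; apply: nw; rewrite -ex.
Qed.

Lemma inv_nmul s w : s \in S -> inv w (alpha s) -> ~ inv (s * w) (alpha s).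
Proof. by move=> sS; rewrite !inv_alpha // involK // => h1 h2; lia. Qed.

Lemma inv_mulN s w x : s \in S -> inv w (alpha s) ->
  inv (s * w) x <-> (inv w (refl s x) /\ x <> - alpha s).
Proof.
move=> sS h; have := inv_mul (refl s x) sS (inv_nmul sS h).
rewrite involK // refl_inv // => H; split=> [hx|[/H[e|//] ne]].
  split; first by apply/H; right.
  by move=> ex; case: hx => _; rewrite ex => /posP /(_ s); rewrite oppE alphaE eqxx oppr_ge0 ler10.
by case: ne; rewrite -(refl_inv x sS) e refl_self.
Qed.

Lemma inv_head w x : inv w x -> exists s, s \in S /\ inv w (alpha s).
Proof.
move=> h; have w1 : w^-1%g != 1%g.
  by apply/eqP => e; move: h; rewrite (_ : w = 1%g) ?(inv1 _) => [/inv1//|]; rewrite -[w]invgK e invg1.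
have [s hs] := des_exists w1; exists s; have sS := des_S hs; split => //.
by split; [apply: root_alpha|apply: pos_alpha|apply: des_neg].
Qed.

Lemma ell_inv w s : s \in S -> inv w (alpha s) -> ell w = (ell (s * w)).+1.
Proof. by move=> sS /(inv_alpha w sS); case: (ell_mull w sS) => -> //; rewrite ltnNge leqnSn. Qed.

Lemma ell_ninv w s : s \in S -> ~ inv w (alpha s) -> ell (s * w) = (ell w).+1.
Proof. by move=> sS h; case: (ell_mull w sS) => // e; case: h; apply/inv_alpha; rewrite // e. Qed.

Lemma inv_ind (P : gT -> Prop) : P 1%g ->
  (forall s w, s \in S -> ~ inv w (alpha s) -> P w -> P (s * w)%g) -> forall w, P w.
Proof.
move=> P1 PS w; move: {2}(ell w) (erefl (ell w)) => n; elim: n w => [|n IH] w e.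
  by move/eqP: e; rewrite ell_eq0 => /eqP ->.
have w1 : w^-1%g != 1%g by rewrite -ell_eq0 ellV e.
have [s hs] := des_exists w1; have sS := des_S hs.
have hi : inv w (alpha s) by split; [apply: root_alpha|apply: pos_alpha|apply: des_neg].
rewrite -(involK w sS); apply: PS => //; first exact: inv_nmul.
by apply: IH; move: e; rewrite (ell_inv sS hi) => -[].
Qed.

(** Induction strips a common first letter: [alpha s] is an inversion of [u], and either side of the
    equivalence transfers it to [v]. *)
Lemma wsub_lenP u v : wsub u v <-> ell v = (ell u + ell (u^-1 * v))%N.
Proof.
elim/inv_ind: u v => [|s u sS nu IH] v.
  by rewrite ell1 invg1 mul1g; split=> // _ x /inv1.
rewrite (ell_ninv sS nu) invMg (involV sS) -mulgA; split=> [H|e].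
  have hv : inv v (alpha s) by apply: H; apply/(inv_mul _ sS nu); left.
  rewrite (ell_inv sS hv) addSn; congr _.+1; apply/IH => x hx.
  apply/(inv_mulN _ sS hv); split.
    by apply: H; apply/(inv_mul _ sS nu); right; rewrite refl_inv.
  by move=> ex; case: hx => _; rewrite ex => /posP /(_ s); rewrite oppE alphaE eqxx oppr_ge0 ler10.
have l1 : (ell (s * v) <= ell u + ell (u^-1 * (s * v)))%N.
  by apply: leq_trans (ellM _ _); rewrite mulgA mulgV mul1g.
have hv : inv v (alpha s).
  apply/(inv_alpha _ sS); case: (ell_mull v sS) => h; last by rewrite h.
  move: l1 e; rewrite h.
  by move: (ell v) (ell u) (ell (u^-1 * (s * v))) => a b c; lia.
have e' : ell (s * v) = (ell u + ell (u^-1 * (s * v)))%N.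
  by move: e; rewrite (ell_inv sS hv) addSn => -[].
move=> x /(inv_mul _ sS nu)[->//|/(proj2 (IH _) e')].
by move/(inv_mulN _ sS hv) => []; rewrite refl_inv.
Qed.

Lemma wsub_trans v u w : wsub u v -> wsub v w -> wsub u w.
Proof. by move=> h1 h2 x /h1/h2. Qed.

Lemma wsub_anti u v : wsub u v -> wsub v u -> u = v.
Proof.
move=> /wsub_lenP h1 /wsub_lenP h2; have : ell (u^-1 * v) == 0%N.
  by move: (ell v) (ell u) (ell (u^-1 * v)) (ell (v^-1 * u)) h1 h2 => a b c d; lia.
by rewrite ell_eq0 -eq_mulVg1 => /eqP.
Qed.

Lemma wsub1 u : wsub 1 u. Proof. by move=> x /inv1. Qed.

Lemma inv_eq u v : (forall x, inv u x <-> inv v x) -> u = v.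
Proof. by move=> H; apply: wsub_anti => x /H. Qed.

Lemma inv_des w s : des w s -> inv w (- act w (alpha s)).
Proof.
move=> h; have sS := des_S h; split; [|exact: des_neg|].
  by apply: root_opp; apply: root_act; apply: root_alpha.
by rewrite actN actK opprK pos_alpha.
Qed.

(** The positive root [- act w (alpha s)] stands for the cover reflection [w s w^-1]; descents are
    handled through it from here on. *)
Lemma inv_mulr w s x : des w s ->
  inv (w * s) x <-> (inv w x /\ x <> - act w (alpha s)).
Proof.
move=> h; have sS := des_S h.
have e : act (w * s)^-1 x = refl s (act w^-1 x) by rewrite invMg (involV sS) actM (act_gen _ sS).
split=> [[rx px]|[[rx px nx] ne]].
  rewrite e => n; split; last first.
    move=> ex; move: n; rewrite ex actN actK reflN refl_self // !opprK => /posP /(_ s).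
    by rewrite oppE alphaE eqxx oppr_ge0 ler10.
  split => //; case: (root_sign (root_act w^-1 rx)) => // p; exfalso.
  have ex : act w^-1 x = alpha s by apply: simple_flip => //; apply: root_act.
  have := des_neg h; rewrite -ex actVK; exact: root_pos_neg.
split=> //; rewrite e -reflN; apply: pos_refl => //; first by apply/root_opp/root_act.
by apply/eqP => ex; apply: ne; rewrite -ex actN actVK opprK.
Qed.

Lemma wsub_des w s : des w s -> wsub (w * s) w.
Proof. by move=> h x /(inv_mulr _ h)[]. Qed.

Lemma wsub_desN u w s : des w s -> wsub u w -> ~ inv u (- act w (alpha s)) ->
  wsub u (w * s).
Proof. by move=> h uw nu x hx; apply/(inv_mulr _ h); split; [apply: uw|move=> e; apply: nu; rewrite -e]. Qed.

Lemma wsub_lower u w : wsub u w -> u <> w -> exists s, des w s /\ wsub u (w * s).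
Proof.
move=> uw ne; have : (u^-1 * w)%g != 1%g by rewrite -eq_mulVg1; apply/eqP.
move=> /des_exists[s hs]; have sS := des_S hs; exists s.
have /andP[_ h1] := hs.
have e := proj1 (wsub_lenP u w) uw.
have h2 : (ell (w * s) <= ell u + ell (u^-1 * w * s))%N.
  by apply: leq_trans (ellM _ _); rewrite !mulgA mulgV mul1g.
have h4 : ell (u^-1 * w) = (ell (u^-1 * w * s)).+1.
  by move: h1; case: (ell_mulr (u^-1 * w) sS) => // ->; move: (ell (u^-1 * w)) => a; lia.
have h3 : ell w = (ell (w * s)).+1.
  case: (ell_mulr w sS) => // h3; exfalso; move: h2 e; rewrite h3 h4.
  by move: (ell w) (ell u) (ell (u^-1 * w * s)) => a b c; lia.
split; first by apply/andP; split; rewrite // h3.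
by apply/wsub_lenP; rewrite mulgA; move: e; rewrite h3 h4 addnS => -[].
Qed.

Lemma actVdecomp w x : act w x = \sum_a x a *: act w (alpha a).
Proof.
have e : x = \sum_a x a *: alpha a.
  apply/ffunP => b; rewrite sum_ffunE (bigD1 b) //= big1 => [|a ab].
    by rewrite addr0 !vE eqxx mulr1.
  by rewrite !vE eq_sym (negbTE ab) mulr0.
have act0 : act w 0 = 0 by rewrite -(scale0r (0 : V gT)) actZ !scale0r.
rewrite {1}e (big_morph (act w) (actD w) act0).
by apply: eq_bigr => a _; rewrite actZ.
Qed.

Lemma pos_comb g x : pos x -> (forall a, x a != 0 -> pos (act g (alpha a))) ->
  pos (act g x).
Proof.
move=> /posP px H; rewrite actVdecomp; apply/posP => b; rewrite sum_ffunE.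
apply: sumr_ge0 => a _; have [->|xa] := eqVneq (x a) 0; first by rewrite !vE mul0r.
by rewrite scaleE mulr_ge0 //; apply/posP/H.
Qed.

(** [v] is the factor of [w] in the parabolic subgroup of [J]. Simple inversions in [J] are peeled
    off from the left; when none is left, [w^-1] keeps every simple root of [J] positive, hence
    every positive root supported on [J]. *)
Lemma proj J w : exists v, forall x, inv v x <-> (inv w x /\ supp J x).
Proof.
move: {2}(ell w) (leqnn (ell w)) => n; elim: n w => [|n IH] w len.
  exists 1%g => x; split=> [/inv1//|[]].
  by move: len; rewrite leqn0 ell_eq0 => /eqP -> /inv1.
have [[s [sS sJ hs]]|H] := pselect (exists s, [/\ s \in S, s \in J & inv w (alpha s)]).
  have [|v hv] := IH (s * w)%g; first by move: len; rewrite (ell_inv sS hs).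
  have nv : ~ inv v (alpha s) by move=> /hv[/(inv_nmul sS hs)].
  have nw := inv_nmul sS hs.
  exists (s * v)%g => x; rewrite (inv_mul _ sS nv) hv supp_refl // -{2}(involK w sS).
  rewrite (inv_mul _ sS nw); split=> [[->|[]]|[[]]]; try tauto.
  by split; [left|apply: supp_alpha].
exists 1%g => x; split=> [/inv1//|[[rx px nx] /suppP sx]]; exfalso.
apply: (root_pos_neg (root_act w^-1 rx) _ nx); apply: pos_comb => // a xa.
have aJ : a \in J by apply: contraNT xa => /sx ->.
have aS : a \in S by apply: contraNT xa => h; apply/eqP; move/suppP: (root_supp rx); apply.
case: (root_sign (root_act w^-1 (root_alpha aS))) => // h; case: H.
by exists a; split=> //; split; [apply: root_alpha|apply: pos_alpha|].
Qed.

(** Otherwise the projection to [J] would lie strictly below [w], hence below some lower cover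
    [w * s], although it contains the very root removed there. *)
Lemma cov_supp J w : (forall s, des w s -> supp J (act w (alpha s))) ->
  forall x, inv w x -> supp J x.
Proof.
move=> H; have [v hv] := proj J w.
suff -> : w = v by move=> x /hv[].
apply: contrapT => ne; have vw : wsub v w by move=> x /hv[].
have [s [ds vs]] := wsub_lower vw (nesym ne).
have /vs/(inv_mulr _ ds)[_ //] : inv v (- act w (alpha s)).
by apply/hv; split; [apply: inv_des|rewrite suppN; apply: H].
Qed.

Lemma inv_closed w x y z (c d : R) : inv w x -> inv w y -> 0 <= c -> 0 <= d ->
  z = c *: x + d *: y -> root z -> inv w z.
Proof.
move=> [_ px nx] [_ py ny] c0 d0 -> rz; split=> //; first by apply: posD; apply: posZ.
by rewrite actD !actZ opprD -!scalerN; apply: posD; apply: posZ.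
Qed.

Lemma ninv_closed w x y z (c d : R) : root x -> root y -> pos x -> pos y ->
  ~ inv w x -> ~ inv w y -> 0 <= c -> 0 <= d ->
  z = c *: x + d *: y -> ~ inv w z.
Proof.
move=> rx ry px py nx ny c0 d0 -> [rz _]; apply: root_pos_neg; first exact: root_act.
rewrite actD !actZ; apply: posD; apply: posZ => //.
  by case: (root_sign (root_act w^-1 rx)) => // h; case: nx.
by case: (root_sign (root_act w^-1 ry)) => // h; case: ny.
Qed.

Lemma supp_pair s t x : s != t -> supp [pred a | (a == s) || (a == t)] x ->
  x = x s *: alpha s + x t *: alpha t.
Proof.
move=> st /suppP h; apply/ffunP => a; rewrite !vE.
have [->|as_] := eqVneq a s; first by rewrite (negbTE st) mulr1 mulr0 addr0.
have [->|at_] := eqVneq a t; first by rewrite mulr0 mulr1 add0r.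
by rewrite !mulr0 addr0 h // inE negb_or as_ at_.
Qed.

Lemma inv_pair w s t x : s \in S -> t \in S -> inv w (alpha s) -> inv w (alpha t) ->
  root x -> pos x -> supp [pred a | (a == s) || (a == t)] x -> inv w x.
Proof.
move=> sS tS hs ht rx px sx; have /posP p := px.
have [e|st] := eqVneq s t; last by apply: (inv_closed hs ht (p s) (p t)) => //; apply: supp_pair.
subst t; apply: (inv_closed hs hs (p s) (lexx 0)) => //.
move/suppP: sx => sx; rewrite scale0r addr0; apply/ffunP => a; rewrite !vE.
by have [->|h] := eqVneq a s; rewrite ?mulr1 // mulr0 sx // inE orbb.
Qed.

(** For a common simple inversion [s], induction gives the largest common lower bound containing
    [alpha s]. The bounds for [s] and [t] are compared through the longest element of the rank two
    parabolic, a common lower bound containing both simple roots. *)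
Lemma meet u v : exists m, [/\ wsub m u, wsub m v &
  forall z : gT, wsub z u -> wsub z v -> wsub z m].
Proof.
move: {2}(ell u) (leqnn (ell u)) => n; elim: n u v => [|n IH] u v len.
  exists 1%g; split; try exact: wsub1.
  by move: len; rewrite leqn0 ell_eq0 => /eqP ->.
have step s : s \in S -> inv u (alpha s) -> inv v (alpha s) ->
  exists m, [/\ wsub m u, wsub m v, inv m (alpha s) &
    forall z : gT, inv z (alpha s) -> wsub z u -> wsub z v -> wsub z m].
  move=> sS hu hv; have [|m [mu mv mz]] := IH (s * u)%g (s * v)%g.
    by move: len; rewrite (ell_inv sS hu).
  have nm : ~ inv m (alpha s) by move/mu; apply: inv_nmul.
  exists (s * m)%g; split.
  - by move=> x /(inv_mul _ sS nm)[->//|/mu/(inv_mulN _ sS hu)]; rewrite refl_inv // => -[].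
  - by move=> x /(inv_mul _ sS nm)[->//|/mv/(inv_mulN _ sS hv)]; rewrite refl_inv // => -[].
  - by apply/(inv_mul _ sS nm); left.
  move=> z hz zu zv x hx; have [->|xs] := eqVneq x (alpha s).
    by apply/(inv_mul _ sS nm); left.
  apply/(inv_mul _ sS nm); right; apply: (mz (s * z)%g).
  - by move=> y /(inv_mulN _ sS hz)[/zu h1 h2]; apply/(inv_mulN _ sS hu).
  - by move=> y /(inv_mulN _ sS hz)[/zv h1 h2]; apply/(inv_mulN _ sS hv).
  apply/(inv_mulN _ sS hz); rewrite refl_inv //; split=> // e.
  by case/eqP: xs; rewrite -(refl_inv x sS) e reflN refl_self // opprK.
have [[s [sS hu hv]]|H] := pselect (exists s, [/\ s \in S, inv u (alpha s) & inv v (alpha s)]); last first.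
  exists 1%g; split; try exact: wsub1.
  move=> z zu zv x hx; exfalso; have [s [sS hs]] := inv_head hx.
  by apply: H; exists s; split=> //; [apply: zu|apply: zv].
have [m [mu mv ms mz]] := step s sS hu hv; exists m; split=> // z zu zv x hx.
have [t [tS ht]] := inv_head hx.
have [m' [mu' mv' mt' mz']] := step t tS (zu _ ht) (zv _ ht).
have [p hp] := proj [pred a | (a == s) || (a == t)] u.
have pu : wsub p u by move=> y /hp[].
have pv : wsub p v.
  by move=> y /hp[[ry py _] sy]; apply: (inv_pair sS tS) => //; apply: zv.
have sp : inv p (alpha s) by apply/hp; split=> //; apply: supp_alpha; rewrite inE eqxx.
have tp : inv p (alpha t) by apply/hp; split; [apply: zu|apply: supp_alpha; rewrite inE eqxx orbT].
have pm : wsub p m' by apply: mz'.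
have m'm : wsub m' m by apply: mz => //; apply: pm.
by apply/m'm; move: x hx; apply: mz'.
Qed.

(** * The Euler form of a Coxeter word and its skew part *)

Lemma wf_cons s c : wf (s :: c) = [&& s \notin c, s \in S & wf c].
Proof. by rewrite /wf /= andbACA -!andbA. Qed.
Lemma wf_rcons s c : wf (rcons c s) = wf (s :: c).
Proof. by rewrite /wf rcons_uniq all_rcons. Qed.
Lemma wfS c s : wf c -> s \in c -> s \in S.
Proof. by case/andP=> _ /allP h /h. Qed.

Lemma eul_linr c x k y z : eul c x (k *: y + z) = k * eul c x y + eul c x z.
Proof.
elim: c => [|s c IH] /=; first by rewrite mulr0 addr0.
rewrite IH addE scaleE.
have -> : \sum_(b <- c) (k *: y + z) b * kf s b =
   k * (\sum_(b <- c) y b * kf s b) + \sum_(b <- c) z b * kf s b.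
  by rewrite mulr_sumr -big_split; apply: eq_bigr => b _ /=; rewrite addE scaleE; ring.
ring.
Qed.
Lemma eul_linl c x k y z : eul c (k *: y + z) x = k * eul c y x + eul c z x.
Proof.
elim: c => [|s c IH] /=; first by rewrite mulr0 addr0.
by rewrite IH addE scaleE; ring.
Qed.
Lemma eul0r c x : eul c x 0 = 0.
Proof. by have := eul_linr c x (-1) 0 0; rewrite scaler0 addr0 => h; lra. Qed.
Lemma eul0l c x : eul c 0 x = 0.
Proof. by have := eul_linl c x (-1) 0 0; rewrite scaler0 addr0 => h; lra. Qed.
Lemma eulNr c x y : eul c x (- y) = - eul c x y.
Proof. by have := eul_linr c x (-1) y 0; rewrite addr0 scaleN1r eul0r addr0 mulN1r. Qed.
Lemma eulNl c x y : eul c (- y) x = - eul c y x.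
Proof. by have := eul_linl c x (-1) y 0; rewrite addr0 scaleN1r eul0l addr0 mulN1r. Qed.
Lemma eulDr c x y z : eul c x (y + z) = eul c x y + eul c x z.
Proof. by have := eul_linr c x 1 y z; rewrite scale1r mul1r. Qed.
Lemma eulDl c x y z : eul c (y + z) x = eul c y x + eul c z x.
Proof. by have := eul_linl c x 1 y z; rewrite scale1r mul1r. Qed.

Lemma eul_ext c x x' y y' : {in c, x =1 x'} -> {in c, y =1 y'} ->
  eul c x y = eul c x' y'.
Proof.
elim: c => //= s c IH hx hy; rewrite hx ?mem_head // hy ?mem_head //.
congr (_ * (_ + _) + _).
  by apply: eq_big_seq => b bc; rewrite hy // inE bc orbT.
by apply: IH => a ac; [apply: hx|apply: hy]; rewrite inE ac orbT.
Qed.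

Lemma bil_alpha_supp s c y : wf (s :: c) -> supp (mem (s :: c)) y ->
  bil (alpha s) y = 2 * y s + \sum_(b <- c) y b * kf s b.
Proof.
move=> W /suppP sy; rewrite bil_alphal (bigID (mem (s :: c))) /= addrC big1 => [|a ha].
  have [Wu _] := andP W; rewrite add0r -big_uniq // big_cons kf1 ?invol ?(wfS W) ?mem_head //.
  by rewrite mulrC.
by rewrite sy // mul0r.
Qed.

Lemma eul_head s c x : s \notin c -> eul (s :: c) x (alpha s) = x s.
Proof.
move=> sc /=; have h : {in c, alpha s =1 (0 : V gT)}.
  by move=> a ac; rewrite !ffunE; case: eqVneq ac sc => // -> ->.
rewrite (eul_ext (x' := x) (y' := 0)) // eul0r alphaE eqxx big_seq big1 ?addr0 ?mulr1 //.
by move=> a ac; rewrite h // ffunE mul0r.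
Qed.

Lemma eul_headl s c y : s \notin c ->
  eul (s :: c) (alpha s) y = y s + \sum_(b <- c) y b * kf s b.
Proof.
move=> sc /=; have h : {in c, alpha s =1 (0 : V gT)}.
  by move=> a ac; rewrite !ffunE; case: eqVneq ac sc => // -> ->.
by rewrite (eul_ext (x' := 0) (y' := y)) // eul0l alphaE eqxx mul1r addr0.
Qed.

Lemma eul_rcons c s x y : eul (rcons c s) x y =
  eul c x y + (x s + \sum_(b <- c) x b * kf b s) * y s.
Proof.
elim: c => [|a c IH] /=; first by rewrite !big_nil; ring.
by rewrite IH -cats1 big_cat /= big_seq1 big_cons; ring.
Qed.

Lemma eul_last s c y : s \notin c -> eul (rcons c s) (alpha s) y = y s.
Proof.
move=> sc; rewrite eul_rcons; have h : {in c, alpha s =1 (0 : V gT)}.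
  by move=> a ac; rewrite !ffunE; case: eqVneq ac sc => // -> ->.
rewrite (eul_ext (x' := 0) (y' := y)) // eul0l alphaE eqxx big_seq big1 => [|a ac].
  by rewrite add0r addr0 mul1r.
by rewrite h // ffunE mul0r.
Qed.

Lemma eul_bil c x y : wf c -> supp (mem c) x -> supp (mem c) y ->
  eul c x y + eul c y x = bil x y.
Proof.
elim: c x y => [|s c IH] x y W.
  move=> /suppP hx _; have -> : x = 0 by apply/ffunP => a; rewrite hx // ffunE.
  by rewrite -(scale0r (0 : V gT)) bilZl mul0r /= addr0.
move=> hx hy; have := W; rewrite wf_cons => /and3P[sc sS Wc].
pose x' := x - x s *: alpha s; pose y' := y - y s *: alpha s.
have ex : {in c, x =1 x'}.
  move=> a ac; rewrite /x' !vE; suff /negbTE -> : a != s by rewrite mulr0 subr0.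
  by apply: contraNneq sc => <-.
have ey : {in c, y =1 y'}.
  move=> a ac; rewrite /y' !vE; suff /negbTE -> : a != s by rewrite mulr0 subr0.
  by apply: contraNneq sc => <-.
have sx' : supp (mem c) x'.
  apply/suppP => a ac; rewrite /x' !vE; have [->|as_] := eqVneq; first by rewrite mulr1 subrr.
  by rewrite (suppP _ _ hx) ?inE ?negb_or ?as_ // mulr0 subr0.
have sy' : supp (mem c) y'.
  apply/suppP => a ac; rewrite /y' !vE; have [->|as_] := eqVneq; first by rewrite mulr1 subrr.
  by rewrite (suppP _ _ hy) ?inE ?negb_or ?as_ // mulr0 subr0.
have bx := bil_alpha_supp W hx; have byy := bil_alpha_supp W hy.
rewrite /= (eul_ext ex ey) (eul_ext ey ex).
have := IH _ _ Wc sx' sy'; rewrite /x' /y' !bilE bil_alpha kf1 ?invol // byy (bilC x (alpha s)) bx.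
by move=> h; lra.
Qed.

(** The counterpart of rotation: [srt_take] moves [s] to the end of the word and reflects the roots
    by [s], and the form follows. *)
Lemma eul_refl s c x y : wf (s :: c) -> supp (mem (s :: c)) x -> supp (mem (s :: c)) y ->
  eul (rcons c s) (refl s x) (refl s y) = eul (s :: c) x y.
Proof.
move=> W hx hy; have := W; rewrite wf_cons => /and3P[sc sS Wc].
have e z : {in c, refl s z =1 z}.
  by move=> a ac; apply: refl_neq; apply: contraNneq sc => <-.
rewrite eul_rcons /= (eul_ext (e x) (e y)) !reflE eqxx !mulr1.
rewrite (bil_alpha_supp W hx) (bil_alpha_supp W hy).
have -> : \sum_(b <- c) refl s x b * kf b s = \sum_(b <- c) x b * kf s b.
  by apply: eq_big_seq => b bc; rewrite e // kfC.
by ring.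
Qed.

(** Nonpositivity of the skew form [eul c x y - eul c y x]. Being linear in each argument, the
    inequality passes to cones. *)
Definition omle c x y := eul c x y <= eul c y x.

Lemma sum_head_le0 s c x : wf (s :: c) -> pos x -> \sum_(b <- c) x b * kf s b <= 0.
Proof.
rewrite wf_cons => /and3P[sc sS Wc] /posP px; rewrite big_seq sumr_le0 // => b bc.
rewrite mulr_ge0_le0 // kf_le0 ?invol //.
by apply: contraNneq sc => ->.
Qed.

Lemma sum_head_eq0 s c x : wf (s :: c) -> pos x -> \sum_(b <- c) x b * kf s b = 0 ->
  {in c, forall b, x b * kf s b = 0}.
Proof.
rewrite wf_cons => /and3P[sc sS Wc] /posP px h b bc.
have le a : a \in c -> 0 <= - (x a * kf s a).
  move=> ac; rewrite oppr_ge0 mulr_ge0_le0 // kf_le0 ?invol //.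
  by apply: contraNneq sc => ->.
have : \sum_(a <- c) - (x a * kf s a) == 0 by rewrite sumrN h oppr0.
rewrite big_seq psumr_eq0 // => /allP /(_ b bc); rewrite bc /= oppr_eq0 => /eqP //.
Qed.

(** Both values contain the coordinate [x s]; they differ by a combination of off-diagonal form
    entries, which are nonpositive. Dually, the last letter comes after every positive root. *)
Lemma omle_head s c x : wf (s :: c) -> pos x -> omle (s :: c) (alpha s) x.
Proof.
move=> W px; have := W; rewrite wf_cons => /and3P[sc sS Wc].
by rewrite /omle eul_head // eul_headl // gerDl sum_head_le0.
Qed.

Lemma omle_last s c x : wf (s :: c) -> pos x -> omle (rcons c s) x (alpha s).
Proof.
move=> W px; have := W; rewrite wf_cons => /and3P[sc sS Wc].
rewrite /omle eul_last // eul_rcons alphaE eqxx mulr1.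
rewrite (eul_ext (x' := x) (y' := 0)) // ?eul0r ?add0r; last first.
  by move=> a ac; rewrite !ffunE; case: eqVneq ac sc => // -> ->.
rewrite gerDl (eq_bigr (fun b => x b * kf s b)) ?sum_head_le0 // => b _.
by rewrite kfC.
Qed.

(** * Cones of inversions *)

Lemma cone_pos P x : (forall y, P y -> pos y) -> cone P x -> pos x.
Proof.
move=> H hx; apply/posP => a; rewrite -oppr_le0.
apply: (hx (fun y : V gT => - y a)) => [k y z|y /H /posP /(_ a)].
  by rewrite !vE; ring.
by rewrite oppr_le0.
Qed.

Lemma cone_refl s P Q x : (forall y, P y -> Q (refl s y)) -> cone P x -> cone Q (refl s x).
Proof.
move=> H hx f lf Qf; apply: (hx (fun y => f (refl s y))).
  by move=> k y z; rewrite reflD reflZ lf.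
by move=> y /H /Qf.
Qed.

(** Here [s] does not occur in [w]. Each letter [b] put in front adds the new inversion [alpha b]
    with coefficient [- kf b s], which is nonnegative as [b] differs from [s]. *)
Lemma cone_act w s : s \in S -> (forall x, inv w x -> x s = 0) ->
  cone (inv w) (act w (alpha s) - alpha s).
Proof.
move=> sS; elim/inv_ind: w => [_|b w bS nb IH H] f lf Hf.
  have f0 : f 0 = 0 by have := lf (-1) 0 0; rewrite scaler0 addr0 mulN1r addNr.
  by rewrite act1 subrr f0.
have bi : inv (b * w) (alpha b) by apply/(inv_mul _ bS nb); left.
have bs : b != s.
  by apply/eqP => e; have := H _ bi; rewrite alphaE e eqxx => /eqP; rewrite oner_eq0.
rewrite actM (act_gen _ bS).
have -> : refl b (act w (alpha s)) - alpha s =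
   (- kf b s) *: alpha b + refl b (act w (alpha s) - alpha s).
  rewrite reflD reflN /refl bil_alpha; apply/ffunP => a; rewrite !vE; ring.
rewrite lf; have h1 := Hf _ bi; have h2 := kf_le0 (invol bS) bs.
have H' x : inv w x -> inv (b * w) (refl b x).
  by move=> hx; apply/(inv_mul _ bS nb); right; rewrite refl_inv.
have h3 : f (refl b (act w (alpha s) - alpha s)) <= 0.
  apply: (cone_refl (P := inv w) (Q := inv (b * w)) (s := b)) => //.
  by apply: IH => x /H' /H; rewrite refl_neq // eq_sym.
by nra.
Qed.

Lemma act_coef w s : s \in S -> (forall x, inv w x -> x s = 0) -> act w (alpha s) s = 1.
Proof.
move=> sS H; have C := cone_act sS H.
have h1 : (act w (alpha s) - alpha s) s <= 0.
  by apply: (C (fun y : V gT => y s)) => [k y z|y /H ->]; rewrite ?vE.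
have h2 : - (act w (alpha s) - alpha s) s <= 0.
  apply: (C (fun y : V gT => - y s)) => [k y z|y /H ->]; rewrite ?oppr0 //.
  by rewrite !vE; ring.
by move: h1 h2; rewrite !vE eqxx /= => h1 h2; lra.
Qed.

(** * Sorting words *)

Arguments eul : simpl never.

Lemma memhd s c : s \in mem (s :: c). Proof. exact: mem_head. Qed.
Lemma memlast s c : s \in mem (rcons c s).
Proof. by change (s \in rcons c s); rewrite mem_rcons mem_head. Qed.
Lemma supp_notin J x a : supp J x -> a \notin J -> x a = 0.
Proof. by move/suppP; apply. Qed.

Lemma inv_root w x : inv w x -> root x. Proof. by case. Qed.
Lemma inv_pos w x : inv w x -> pos x. Proof. by case. Qed.

Lemma eul_refl' s c x y : wf (s :: c) -> supp (mem (s :: c)) x -> supp (mem (s :: c)) y ->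
  eul (s :: c) (refl s x) (refl s y) = eul (rcons c s) x y.
Proof.
move=> W hx hy; have sS : s \in S by move: W; rewrite wf_cons => /and3P[].
have sm : s \in mem (s :: c) by rewrite memhd.
by rewrite -eul_refl ?supp_refl // !refl_inv.
Qed.

Lemma eul_skip s c x y : x s = 0 -> eul (s :: c) x y = eul c x y.
Proof. by move=> h; rewrite /eul h mul0r add0r. Qed.

Lemma supp_eq J K x : J =i K -> supp J x = supp K x.
Proof. by move=> e; apply/idP/idP; apply: supp_sub => a; rewrite e. Qed.

Lemma supp_rcons s c x : supp (mem (rcons c s)) x = supp (mem (s :: c)) x.
Proof. by apply: supp_eq => a; rewrite !inE mem_rcons inE. Qed.

Lemma supp_cons s c x : supp (mem c) x -> supp (mem (s :: c)) x.
Proof. by apply: supp_sub => a; rewrite !inE => ->; rewrite orbT. Qed.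

Lemma mem_map_refl s L x : s \in S -> (x \in map (refl s) L) = (refl s x \in L).
Proof.
move=> sS; apply/mapP/idP => [[y yL ->]|h]; first by rewrite refl_inv.
by exists (refl s x); rewrite // refl_inv.
Qed.

Lemma srt_invP c w L F : srt c w L F -> forall x, x \in L <-> inv w x.
Proof.
elim=> [|{}s {}c {}w {}L {}F sS nw _ IH|{}s {}c {}w {}L {}F sS nw _ IH] x //.
  by split=> // /inv1.
rewrite inE mem_map_refl // (inv_mul _ sS nw); split=> [/orP[/eqP ->|/IH]|[->|/IH ->]].
- by left.
- by right.
- by rewrite eqxx.
- by rewrite orbT.
Qed.

Lemma srt_supp c w L F : srt c w L F -> forall x, inv w x -> supp (mem c) x.
Proof.
elim=> [|{}s {}c {}w {}L {}F sS nw _ IH|{}s {}c {}w {}L {}F sS nw _ IH] x.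
- by move/inv1.
- move/(inv_mul _ sS nw) => [->|/IH]; first by apply: supp_alpha; rewrite memhd.
  by rewrite supp_rcons supp_refl // memhd.
- by move/IH; apply: supp_cons.
Qed.

(** Taking [s] puts [alpha s] in front, where [omle_head] applies, and reflects the rest, where the
    form is invariant; skipping [s] leaves only roots without [s]-coordinate. *)
Lemma srt_sorted c w L F : wf c -> srt c w L F -> pairwise (omle c) L.
Proof.
move=> W h; elim: h W => [|{}s {}c {}w {}L {}F sS nw h IH|{}s {}c {}w {}L {}F sS nw h IH] W //.
- have W' : wf (rcons c s) by rewrite wf_rcons.
  have hL x : x \in L -> supp (mem (s :: c)) x.
    by move/(srt_invP h)/(srt_supp h); rewrite supp_rcons.
  rewrite pairwise_cons; apply/andP; split.
    apply/allP => x; rewrite mem_map_refl // => hx; apply: omle_head => //.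
    suff /inv_pos : inv (s * w) x by [].
    by apply/(inv_mul _ sS nw); right; apply/(srt_invP h).
  rewrite pairwise_map; apply: (sub_in_pairwise (P := mem L) _ _ (IH W')); last first.
    by apply/allP.
  move=> x y xL yL xy; change (omle (s :: c) (refl s x) (refl s y)).
  by rewrite /omle !eul_refl' // ?hL.
- move: (W); rewrite wf_cons => /and3P[sc _ Wc].
  have hL x : x \in L -> x s = 0.
    by move/(srt_invP h)/(srt_supp h) => hx; apply: supp_notin hx _.
  apply: (sub_in_pairwise (P := mem L) _ _ (IH Wc)); last by apply/allP.
  by move=> x y xL yL; rewrite /omle !eul_skip // ?hL.
Qed.

Lemma srt_F c w L F : srt c w L F -> forall p, p \in F ->
  root p.1 /\ supp (mem c) p.1.
Proof.
elim=> [|{}s {}c {}w {}L {}F sS nw _ IH|{}s {}c {}w {}L {}F sS nw _ IH] p //.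
- case/mapP=> q /IH[rq]; rewrite supp_rcons => sq -> /=; split; first exact: root_refl.
  by rewrite supp_refl // memhd.
- rewrite inE => /orP[/eqP -> /=|/IH[rp sp]]; last by split=> //; apply: supp_cons.
  by split; [apply: root_alpha|apply: supp_alpha; rewrite memhd].
Qed.

(** A skipped [alpha s] is followed only by roots without [s]-coordinate, and pairing with [alpha s]
    on the right reads off that coordinate. *)
Lemma srt_tri c w L F : wf c -> srt c w L F ->
  pairwise (fun p q => eul c q.1 p.1 == 0) F.
Proof.
move=> W h; elim: h W => [|{}s {}c {}w {}L {}F sS nw h IH|{}s {}c {}w {}L {}F sS nw h IH] W //.
- have W' : wf (rcons c s) by rewrite wf_rcons.
  have hF p : p \in F -> supp (mem (s :: c)) p.1.
    by move/(srt_F h) => []; rewrite supp_rcons.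
  rewrite pairwise_map; apply: (sub_in_pairwise (P := mem F) _ _ (IH W')); last first.
    by apply/allP.
  move=> p q pF qF pq; change (eul (s :: c) (refl s q.1) (refl s p.1) == 0).
  by rewrite eul_refl' // ?hF.
- move: (W); rewrite wf_cons => /and3P[sc _ Wc].
  have hF p : p \in F -> p.1 s = 0.
    by move/(srt_F h) => [_ hx]; apply: supp_notin hx _.
  rewrite pairwise_cons; apply/andP; split.
    by apply/allP => p /hF e; rewrite eul_head // e.
  apply: (sub_in_pairwise (P := mem F) _ _ (IH Wc)); last by apply/allP.
  by move=> p q pF qF; rewrite eul_skip // hF.
Qed.

Lemma srt_mem c w L F r : srt c w L F -> r \in c -> exists C, (C, r) \in F.
Proof.
elim=> [|{}s {}c {}w {}L {}F sS nw _ IH|{}s {}c {}w {}L {}F sS nw _ IH] //.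
- rewrite -mem_rcons => /IH[C hC]; exists (refl s C).
  by apply/mapP; exists (C, r).
- rewrite inE => /orP[/eqP ->|/IH[C hC]]; first by exists (alpha s); rewrite mem_head.
  by exists C; rewrite inE hC orbT.
Qed.

Lemma cone_supp J (P : V gT -> Prop) x : (forall y, P y -> supp J y) -> cone P x -> supp J x.
Proof.
move=> H C; apply/suppP => a aJ; apply/eqP; rewrite eq_le.
have h1 : x a <= 0.
  apply: (C (fun y : V gT => y a)) => [k y z|y /H h]; first by rewrite !vE.
  by rewrite (supp_notin h).
have h2 : - x a <= 0.
  apply: (C (fun y : V gT => - y a)) => [k y z|y /H h]; first by rewrite !vE; ring.
  by rewrite (supp_notin h) // oppr0.
by rewrite h1 -oppr_le0 h2.
Qed.

(** The reflection of [alpha s + z] is the root [z - alpha s], with coordinate -1 at [s]; so it is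
    negative, which leaves no room for [z]. *)
Lemma root_split s z : s \in S -> root (alpha s + z) -> pos z -> z s = 0 ->
  bil (alpha s) z = 0 -> z = 0.
Proof.
move=> sS rz pz z0 b0; have rz' : root (z - alpha s).
  suff -> : z - alpha s = refl s (alpha s + z) by apply: root_refl.
  by rewrite reflD refl_self // addrC /refl b0 scale0r subr0.
have nz : pos (- (z - alpha s)).
  apply: root_negP => //; apply/negP => /posP /(_ s).
  by rewrite !vE z0 eqxx sub0r oppr_ge0 ler10.
apply: pos_antisym => //; apply/posP => a; have := posP _ nz a; rewrite !vE.
have [->|_] := eqVneq a s; first by rewrite z0 oppr0.
by rewrite subr0.
Qed.

(* Between the position where the letter [r] is skipped for the first time and
   the end of the word, [w alpha_r] changes only by a nonnegative combination of
   the inversions [L2] read in between. *)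
Lemma srt_skipped c w L F : wf c -> srt c w L F -> forall C r, (C, r) \in F ->
  exists L1 L2 z, [/\ L = L1 ++ L2, act w (alpha r) = C + z,
    cone (fun y => y \in L2) z,
    forall y, y \in L2 -> omle c C y &
    (eul c C z = eul c z C -> z = 0) /\ (pos C \/ - C \in L1)].
Proof.
move=> W h; elim: h W => [|{}s {}c {}w {}L {}F sS nw h IH|{}s {}c {}w {}L {}F sS nw h IH] W C r //.
- case/mapP=> -[C' r'] pF [-> ->] /=.
  have W' : wf (rcons c s) by rewrite wf_rcons.
  have [L1 [L2 [z [eL ez cz hom [hz hC]]]]] := IH W' _ _ pF.
  have [rC] := srt_F h pF; rewrite supp_rcons /= => sC.
  have hL2 y : y \in L2 -> supp (mem (s :: c)) y.
    move=> yL; rewrite -supp_rcons; apply: (srt_supp h); apply/(srt_invP h).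
    by rewrite eL mem_cat yL orbT.
  have sz : supp (mem (s :: c)) z by apply: cone_supp cz.
  exists (alpha s :: map (refl s) L1), (map (refl s) L2), (refl s z); split.
  + by rewrite /= eL map_cat.
  + by rewrite actM (act_gen _ sS) ez reflD.
  + by apply: cone_refl cz => y; rewrite mem_map_refl // refl_inv.
  + move=> y; rewrite mem_map_refl // => yL; have := hom _ yL.
    rewrite /omle -!(eul_refl' W) ?refl_inv //; exact: hL2.
  split; first by rewrite !eul_refl' // => /hz ->; rewrite -(scale0r (0 : V gT)) reflZ !scale0r.
  case: hC => hC; last by right; rewrite inE mem_map_refl // reflN refl_inv // hC orbT.
  have [->|ne] := eqVneq C' (alpha s); last by left; apply: pos_refl.
  by right; rewrite refl_self // opprK mem_head.
- move: (W); rewrite wf_cons => /and3P[sc _ Wc].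
  have hL y : y \in L -> y s = 0.
    by move/(srt_invP h)/(srt_supp h) => hx; apply: supp_notin hx _.
  have hI y : inv w y -> y s = 0 by move/(srt_invP h); apply: hL.
  rewrite inE => /orP[/eqP[-> ->]|pF]; last first.
    have [L1 [L2 [z [eL ez cz hom [hz hC]]]]] := IH Wc _ _ pF.
    have [rC sC] := srt_F h pF.
    have C0 : C s = 0 by apply: supp_notin sC _.
    have z0 : z s = 0.
      apply: (supp_notin (J := mem c)) => //.
      apply: cone_supp cz => y yL; apply: (srt_supp h); apply/(srt_invP h).
      by rewrite eL mem_cat yL orbT.
    exists L1, L2, z; split => //; last by rewrite !eul_skip.
    move=> y yL; have y0 : y s = 0 by apply: hL; rewrite eL mem_cat yL orbT.
    by rewrite /omle !eul_skip //; apply: hom.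
  have cz := cone_act sS hI; set z := act w (alpha s) - alpha s in cz.
  have ez : act w (alpha s) = alpha s + z by rewrite /z addrC subrK.
  clearbody z.
  have cz' : cone (fun y => y \in L) z.
    by move=> f lf Hf; apply: cz => // y /(srt_invP h); apply: Hf.
  exists [::], L, z; split=> //.
    by move=> y /(srt_invP h)/inv_pos; apply: omle_head.
  split; last by left; apply: pos_alpha.
  have pz : pos z by apply: cone_pos cz => y /inv_pos.
  have z0 : z s = 0.
    apply: (supp_notin (J := [pred a | a != s])); last by rewrite inE eqxx.
    apply: cone_supp cz => y /hI e; apply/suppP => a; rewrite inE negbK => /eqP ->.
    exact: e.
  have sz : supp (mem (s :: c)) z.
    apply: cone_supp cz' => y /(srt_invP h)/(srt_supp h); exact: supp_cons.
  (* The form at [(z, alpha s)] is the [s]-coordinate of [z], which is zero. Equality therefore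
     makes [z] orthogonal to [alpha s], and [root_split] applies. *)
  rewrite eul_head // eul_headl // z0 add0r => q0.
  have := bil_alpha_supp W sz; rewrite z0 mulr0 q0 addr0 => b0.
  apply: (root_split sS) => //; rewrite -ez; exact/root_act/root_alpha.
Qed.

Lemma srt_des_mem c w L F r : srt c w L F -> des w r -> r \in c.
Proof.
move=> h dr; apply/negPn/negP => rc; have rS := des_S dr.
have e : act w (alpha r) r = 1.
  by apply: act_coef => // x /(srt_supp h) hx; apply: supp_notin hx _.
by have /posP /(_ r) := des_neg dr; rewrite oppE e oppr_ge0 ler10.
Qed.

(** A positive skipped root [C] would keep [act w (alpha r)] positive, so [- C] was read before
    [L2]. Then [srt_sorted] and [hom] give opposite inequalities on [L2], hence equality on its
    cone, and the correction [z] vanishes. *)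
Lemma srt_des c w L F r : wf c -> srt c w L F -> des w r -> (act w (alpha r), r) \in F.
Proof.
move=> W h dr; have rS := des_S dr.
have [C hC] := srt_mem h (srt_des_mem h dr).
have [L1 [L2 [z [eL ez cz hom [hz hC']]]]] := srt_skipped W h hC.
have L2i y : y \in L2 -> inv w y.
  by move=> yL; apply/(srt_invP h); rewrite eL mem_cat yL orbT.
suff -> : act w (alpha r) = C by [].
case: hC' => hC'.
  exfalso; apply: (root_pos_neg (root_act w (root_alpha rS)) _ (des_neg dr)).
  by rewrite ez posD //; apply: cone_pos cz => y /L2i/inv_pos.
have := srt_sorted W h; rewrite eL pairwise_cat => /and3P[/allrelP al _ _].
have f0 y : y \in L2 -> eul c C y = eul c y C.
  move=> yL; apply/eqP; rewrite eq_le [_ <= _]hom //=.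
  by have := al _ _ hC' yL; rewrite /omle eulNl eulNr lerN2.
rewrite ez (hz _) ?addr0 //; apply/eqP; rewrite eq_le -subr_le0 -[in X in _ && X]subr_le0.
apply/andP; split.
  apply: (cz (fun y => eul c C y - eul c y C)) => [k y y'|y /f0 ->]; last by rewrite subrr.
  by rewrite eul_linl eul_linr; ring.
apply: (cz (fun y => eul c y C - eul c C y)) => [k y y'|y /f0 ->]; last by rewrite subrr.
by rewrite eul_linl eul_linr; ring.
Qed.

Lemma pairwise_mem (T : eqType) (r : rel T) (l : seq T) p q :
  pairwise r l -> p \in l -> q \in l -> p != q -> r p q \/ r q p.
Proof.
elim: l => // a l IH; rewrite pairwise_cons => /andP[/allP al pl].
rewrite !inE => /orP[/eqP ->|pl'] /orP[/eqP ->|ql']; rewrite ?eqxx //.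
- by move=> _; left; apply: al.
- by move=> _; right; apply: al.
- exact: IH.
Qed.

Lemma srt_des_eul c w L F r r' : wf c -> srt c w L F -> des w r -> des w r' -> r != r' ->
  eul c (act w (alpha r)) (act w (alpha r')) = 0 \/
  eul c (act w (alpha r')) (act w (alpha r)) = 0.
Proof.
move=> W h dr dr' ne.
have p1 := srt_des W h dr; have p2 := srt_des W h dr'.
case: (pairwise_mem (srt_tri W h) p1 p2) => [|/eqP|/eqP] /=; try by [left|right].
by apply: contraNneq ne => -[_ ->].
Qed.

Lemma des_bil w r r' : des w r -> des w r' -> r != r' ->
  bil (act w (alpha r)) (act w (alpha r')) <= 0.
Proof. by move=> dr dr' ne; rewrite act_bil bil_alpha kf_le0 // invol // (des_S dr). Qed.

Lemma srt_des_supp c w L F r : srt c w L F -> des w r -> supp (mem c) (act w (alpha r)).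
Proof. by move=> h /inv_des /(srt_supp h); rewrite suppN. Qed.

Lemma des_coef_le0 w r a : des w r -> act w (alpha r) a <= 0.
Proof. by move=> /des_neg/posP /(_ a); rewrite oppE oppr_ge0. Qed.

(** By triangularity the Euler form vanishes in one of the two orders. One order is the
    [s]-coordinate itself. In the other, that coordinate equals the pairing with [alpha s], which is
    nonnegative because distinct simple roots pair nonpositively, while a negative root has
    nonpositive coordinates. *)
Lemma init_cover s c w L F r r' : wf (s :: c) -> srt (s :: c) w L F ->
  des w r -> des w r' -> r != r' -> act w (alpha r) = - alpha s ->
  act w (alpha r') s = 0.
Proof.
move=> W h dr dr' ne e; move: (W); rewrite wf_cons => /and3P[sc sS Wc].
have sa : supp (mem (s :: c)) (alpha s) by apply: supp_alpha; rewrite memhd.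
have sr' := srt_des_supp h dr'.
have le0 := des_coef_le0 s dr'.
have := srt_des_eul W h dr dr' ne; rewrite e eulNl eulNr eul_head // => -[|] h0.
  have := des_bil dr dr' ne; rewrite e bilNl -(eul_bil W sa sr') eul_head //.
  move: h0 => /eqP; rewrite oppr_eq0 => /eqP ->; rewrite add0r oppr_le0 => ge0.
  by apply/eqP; rewrite eq_le le0.
by apply/eqP; rewrite -oppr_eq0 h0.
Qed.

Lemma final_cover s c w L F r r' : wf (s :: c) -> srt (rcons c s) w L F ->
  des w r -> des w r' -> r != r' -> act w (alpha r) = - alpha s ->
  act w (alpha r') s = 0.
Proof.
move=> W h dr dr' ne e; move: (W); rewrite wf_cons => /and3P[sc sS Wc].
have W' : wf (rcons c s) by rewrite wf_rcons.
have sa : supp (mem (rcons c s)) (alpha s).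
  by apply: supp_alpha; rewrite memlast.
have sr' := srt_des_supp h dr'.
have le0 := des_coef_le0 s dr'.
have := srt_des_eul W' h dr dr' ne; rewrite e eulNl eulNr eul_last // => -[|] h0.
  by apply/eqP; rewrite -oppr_eq0 h0.
have := des_bil dr dr' ne; rewrite e bilNl -(eul_bil W' sa sr') eul_last //.
move: h0 => /eqP; rewrite oppr_eq0 => /eqP ->; rewrite addr0 oppr_le0 => ge0.
by apply/eqP; rewrite eq_le le0.
Qed.

Lemma Srt_take s c w : s \in S -> ~ inv w (alpha s) -> Srt (rcons c s) w ->
  Srt (s :: c) (s * w).
Proof. by move=> sS nw [L [F h]]; do 2!eexists; apply: srt_take h. Qed.

Lemma Srt_skip s c w : s \in S -> ~ inv w (alpha s) -> Srt c w -> Srt (s :: c) w.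
Proof. by move=> sS nw [L [F h]]; do 2!eexists; apply: srt_skip h. Qed.

Lemma Srt_takeV s c w : Srt (s :: c) w -> inv w (alpha s) -> Srt (rcons c s) (s * w).
Proof.
case=> L [F h]; inversion h as [|s' c' w' L' F' sS nw h'|s' c' w' L' F' sS nw h'] => //; subst.
by move=> _; rewrite involK //; exists L', F'.
Qed.

Lemma Srt_skipV s c w : Srt (s :: c) w -> ~ inv w (alpha s) -> Srt c w.
Proof.
case=> L [F h]; inversion h as [|s' c' w' L' F' sS nw h'|s' c' w' L' F' sS nw h']; subst.
  by case; apply/(inv_mul _ sS nw); left.
by move=> _; exists L, F'.
Qed.

Lemma Srt_nil w : Srt [::] w -> w = 1%g.
Proof. by case=> L [F h]; inversion h. Qed.

Lemma Srt1 c : wf c -> Srt c 1.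
Proof.
elim: c => [|s c IH]; first by do 2!eexists; apply: srt_nil.
by rewrite wf_cons => /and3P[sc sS Wc]; apply: Srt_skip => //; [apply: inv1|apply: IH].
Qed.

Lemma Srt_supp c w x : Srt c w -> inv w x -> supp (mem c) x.
Proof. by case=> L [F /srt_supp]; apply. Qed.

Lemma wsub_mul s u w : s \in S -> ~ inv u (alpha s) -> ~ inv w (alpha s) ->
  wsub (s * u) (s * w) <-> wsub u w.
Proof.
move=> sS nu nw; split=> H x hx; last first.
  by apply/(inv_mul _ sS nw); case: (proj1 (inv_mul _ sS nu) hx); [left|right; apply: H].
have hx' : inv (s * u) (refl s x) by apply/(inv_mul _ sS nu); right; rewrite refl_inv.
case: (proj1 (inv_mul _ sS nw) (H _ hx')) => [e|]; last by rewrite refl_inv.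
case: hx => _ /posP /(_ s); rewrite -(refl_inv x sS) e refl_self // oppE alphaE eqxx.
by rewrite oppr_ge0 ler10.
Qed.

Lemma wsub_gen s w : s \in S -> inv w (alpha s) -> wsub s w.
Proof.
move=> sS h x; rewrite -[s]mulg1 => /(inv_mul _ sS (@inv1 _)).
by case=> [-> //|/inv1].
Qed.

Lemma srt_prefix c w L F L1 L2 : wf c -> srt c w L F -> L = L1 ++ L2 ->
  exists u, Srt c u /\ forall x, inv u x <-> x \in L1.
Proof.
move=> W h; elim: h W L1 L2 => [|{}s {}c {}w {}L {}F sS nw h IH|{}s {}c {}w {}L {}F sS nw h IH] W L1 L2.
- case: L1 => // _; exists 1%g; split; first exact: Srt1.
  by move=> x; split=> [/inv1|].
- case: L1 => [_|y L1 /= [<- e]].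
    by exists 1%g; split; [exact: Srt1|move=> x; split=> [/inv1|]].
  have W' : wf (rcons c s) by rewrite wf_rcons.
  have e' : L = map (refl s) L1 ++ map (refl s) L2.
    rewrite -map_cat -e -map_comp -[LHS]map_id.
    by apply: eq_map => z /=; rewrite refl_inv.
  have [u [hu iu]] := IH W' _ _ e'.
  have nu : ~ inv u (alpha s).
    by move/iu => hx; apply: nw; apply/(srt_invP h); rewrite e' mem_cat hx.
  exists (s * u)%g; split; first exact: Srt_take.
  move=> x; rewrite (inv_mul _ sS nu) iu mem_map_refl // refl_inv // inE.
  by split=> [[->|->]|/orP[/eqP ->|->]]; rewrite ?eqxx ?orbT //; [left|right].
- move=> e; move: (W); rewrite wf_cons => /and3P[_ _ Wc].
  have [u [hu iu]] := IH Wc _ _ e; exists u; split=> //; apply: Srt_skip => //.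
  by move/iu => hx; apply: nw; apply/(srt_invP h); rewrite e mem_cat hx.
Qed.

Lemma alpha_neq s r : s != r -> alpha s r = 0.
Proof. by rewrite alphaE eq_sym => /negbTE ->. Qed.

Lemma Srt_restrict c w r : Srt c w -> (forall x, inv w x -> x r = 0) ->
  Srt (filter (predC1 r) c) w.
Proof.
case=> L [F h]; elim: h => [|{}s {}c {}w {}L {}F sS nw h IH|{}s {}c {}w {}L {}F sS nw h IH] H /=.
- by do 2!eexists; apply: srt_nil.
- have sr : s != r.
    have h0 : inv (s * w) (alpha s) by apply/(inv_mul _ sS nw); left.
    apply/eqP => e; have := H _ h0; rewrite alphaE e eqxx => /eqP.
    by rewrite oner_eq0.
  rewrite sr; apply: Srt_take => //.
  have := IH _; rewrite filter_rcons /= sr; apply => x hx.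
  rewrite -(refl_neq (a := s)) 1?eq_sym //; apply: H.
  by apply/(inv_mul _ sS nw); right; rewrite refl_inv.
- have [e|sr] := eqVneq s r; first exact: IH.
  by apply: Srt_skip => //; apply: IH.
Qed.

Lemma Srt_last s c w : wf (s :: c) -> Srt (rcons c s) w ->
  (forall x, inv w x -> x s = 0) -> Srt c w.
Proof.
rewrite wf_cons => /and3P[sc sS Wc] h /(Srt_restrict h).
rewrite filter_rcons /= eqxx /= (_ : filter _ c = c) //.
by apply/all_filterP/allP => a ac /=; apply: contraNneq sc => <-.
Qed.

Lemma perp_fix w s : (forall y, inv w y -> bil (alpha s) y = 0) -> s \in S ->
  act w (alpha s) = alpha s /\ forall y, inv w y -> y s = 0.
Proof.
move=> H sS; elim/inv_ind: w H => [|b w bS nw IH] H.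
  by rewrite act1; split=> // y /inv1.
have hb : bil (alpha s) (alpha b) = 0.
  by apply: H; apply/(inv_mul _ bS nw); left.
have bs : b != s.
  apply: contra_eq_neq hb => ->; rewrite bil_alpha kf1 ?invol //.
  by apply/eqP; lra.
have fb : refl b (alpha s) = alpha s by rewrite /refl bilC hb scale0r subr0.
have [|e H'] := IH.
  move=> y hy; rewrite -(bil_refl (alpha s) y (invol bS)) fb; apply: H.
  by apply/(inv_mul _ bS nw); right; rewrite refl_inv.
split; first by rewrite actM e act_gen.
move=> y /(inv_mul _ bS nw)[->|/H']; first exact: alpha_neq.
by rewrite refl_neq // eq_sym.
Qed.

Lemma srt_last_root c w L F L1 x L2 : wf c -> srt c w L F -> L = L1 ++ x :: L2 ->
  (forall y, y \in L2 -> bil x y = 0) ->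
  exists a, [/\ des w a, act w (alpha a) = - x & Srt c (w * a)].
Proof.
move=> W h; elim: h W L1 x L2 => [|{}s {}c {}w {}L {}F sS nw h IH|{}s {}c {}w {}L {}F sS nw h IH] W L1 x L2.
- by case: L1.
- have W' : wf (rcons c s) by rewrite wf_rcons.
  have refl2 (l : seq (V gT)) : map (refl s) (map (refl s) l) = l.
    by rewrite -map_comp -[RHS]map_id; apply: eq_map => z /=; rewrite refl_inv.
  case: L1 => [[<- e]|y L1 /= [_ e]] H; last first.
    have e' : L = map (refl s) L1 ++ refl s x :: map (refl s) L2.
      by rewrite -[LHS]refl2 e map_cat.
    have [|a [da ea ha]] := IH W' _ _ _ e'.
      move=> y'; rewrite mem_map_refl // => /H e1.
      by rewrite -(refl_inv y' sS) bil_refl ?invol.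
    have xw : inv (s * w) x.
      apply/(inv_mul _ sS nw); right; apply/(srt_invP h).
      by rewrite e' mem_cat mem_head orbT.
    have ea' : act (s * w) (alpha a) = - x.
      by rewrite actM (act_gen _ sS) ea reflN refl_inv.
    exists a; split=> //; first by apply: desI; rewrite ?(des_S da) // ea' opprK; case: xw.
    by rewrite -mulgA; apply: Srt_take => // /(wsub_des da).
  (* When [x] is the first root, [s] commutes with [w] and does not occur in it; deleting it turns
     the taken first letter into a skipped one. *)
  have H' y : inv w y -> bil (alpha s) y = 0.
    move=> /(srt_invP h) yL; apply/eqP; rewrite -oppr_eq0 -bilNl -refl_self //.
    by rewrite -(refl_inv y sS) bil_refl ?invol // H // -e mem_map_refl // refl_inv.
  have [fw sw] := perp_fix H' sS.
  have cw := act_simple sS sS fw.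
  have ea : act (s * w) (alpha s) = - alpha s by rewrite actM fw (act_gen _ sS) refl_self.
  exists s; split=> //; first by apply: desI; rewrite // ea opprK pos_alpha.
  rewrite -mulgA cw involK //; apply: Srt_skip => //; apply: (Srt_last W) => //.
  by exists L, F.
- move: (W); rewrite wf_cons => /and3P[_ _ Wc] e H.
  have [a [da ea ha]] := IH Wc _ _ _ e H; exists a; split=> //.
  by apply: Srt_skip => // /(wsub_des da).
Qed.

Lemma srt_uniq c w L F : srt c w L F -> uniq L.
Proof.
elim=> [|{}s {}c {}w {}L {}F sS nw h IH|{}s {}c {}w {}L {}F sS nw h IH] //=.
rewrite map_inj_uniq ?IH ?andbT; last by apply: (can_inj (g := refl s)) => z; rewrite refl_inv.
rewrite mem_map_refl // refl_self //; apply/negP => /(srt_invP h)/inv_pos/posP /(_ s).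
by rewrite oppE alphaE eqxx oppr_ge0 ler10.
Qed.

Lemma perp_head s c y : wf (s :: c) -> root y -> pos y -> supp (mem (s :: c)) y ->
  \sum_(b <- c) y b * kf s b = 0 -> y != alpha s -> bil (alpha s) y = 0.
Proof.
move=> W ry py sy q0 ne; have sS : s \in S by move: W; rewrite wf_cons => /and3P[].
have b2 := bil_alpha_supp W sy; rewrite q0 addr0 in b2.
have /posP /(_ s) := pos_refl sS ry py ne; rewrite reflE eqxx /= b2 => h.
by have := posP _ py s; move: (y s) h => k h1 h2; lra.
Qed.

(* When [s] is the last letter of the Coxeter word, the inversions read after
   [alpha s] are orthogonal to it, since both orders are forced on them. *)
Lemma final_cover_exists s c w : wf (s :: c) -> Srt (rcons c s) w -> inv w (alpha s) ->
  exists a, [/\ des w a, act w (alpha a) = - alpha s, Srt (rcons c s) (s * w) &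
    forall r, des w r -> r != a -> act w (alpha r) s = 0].
Proof.
move=> W [L [F h]] hs; have sS : s \in S by move: W; rewrite wf_cons => /and3P[].
have W' : wf (rcons c s) by rewrite wf_rcons.
have sc : s \notin c by move: W; rewrite wf_cons => /and3P[].
have sL : alpha s \in L by apply/(srt_invP h).
have [L1 [L2 eL]] : exists L1 L2, L = L1 ++ alpha s :: L2 by case/splitPr: sL; do 2!eexists.
have Hp y : y \in L2 -> bil (alpha s) y = 0.
  move=> yL; have yw : inv w y by apply/(srt_invP h); rewrite eL mem_cat inE yL !orbT.
  have [ry py _] := yw.
  have sy : supp (mem (s :: c)) y by rewrite -supp_rcons; apply: (srt_supp h).
  apply: (perp_head W) => //; last first.
    have := srt_uniq h; rewrite eL cat_uniq /= => /and3P[_ _ /andP[h1 _]].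
    by apply/eqP => ey; move: h1; rewrite -ey yL.
  have := srt_sorted W' h; rewrite eL pairwise_cat pairwise_cons.
  move=> /and3P[_ _ /andP[/allP /(_ _ yL) h1 _]].
  have := omle_last W py; move: h1; rewrite /omle eul_last // eul_rcons alphaE eqxx mulr1.
  rewrite (eul_ext (x' := y) (y' := 0)) // ?eul0r ?add0r; last first.
    by move=> a ac; rewrite !ffunE; case: eqVneq ac sc => // -> ->.
  under eq_bigr do rewrite kfC.
  by rewrite lerDl gerDl => h1 h2; apply/eqP; rewrite eq_le h1 h2.
have [a [da ea ha]] := srt_last_root W' h eL Hp.
exists a; split=> //; last by move=> r dr ra; apply: (final_cover W h da dr); rewrite // eq_sym.
have aS := des_S da.
suff -> : (s * w)%g = (w * a)%g by [].
have : act (w * a) (alpha a) = alpha s by rewrite actM (act_gen _ aS) refl_self // actN ea opprK.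
by move=> /(act_simple aS sS); rewrite involKr // => e; rewrite {1}e involK.
Qed.

(** * Inversion sequences of words, and sortability read off from them *)

Fixpoint rts l : seq (V gT) :=
  if l is a :: l' then alpha a :: map (refl a) (rts l') else [::].

Lemma size_rts l : size (rts l) = size l.
Proof. by elim: l => //= a l IH; rewrite size_map IH. Qed.

Lemma rts_cat l1 l2 : inS l1 -> rts (l1 ++ l2) = rts l1 ++ map (act (prodw l1)) (rts l2).
Proof.
elim: l1 => [|a l1 IH] /=.
  by move=> _; rewrite prodw_nil -[LHS]map_id; apply: eq_map => x; rewrite act1.
case/andP=> aS lS; rewrite IH // map_cat -map_comp; congr (_ :: _ ++ _).
by apply: eq_map => x /=; rewrite prodw_cons actM (act_gen _ aS).
Qed.

Lemma reducedP l : reflect (inS l /\ size l = ell (prodw l)) (reduced l).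
Proof. by apply: (iffP andP) => -[h1 h2]; split=> //; apply/eqP. Qed.

Lemma reduced_cons a l : reduced (a :: l) <->
  [/\ a \in S, reduced l & ~ inv (prodw l) (alpha a)].
Proof.
split=> [/reducedP[/andP[/= aS lS] e]|[aS /reducedP[lS e] na]].
  rewrite prodw_cons in e; have h := ell_prodw lS.
  have [e1|e1] := ell_mull (prodw l) aS; last first.
    exfalso; move: e h; rewrite e1.
    by move: (ell (a * prodw l)) (size l) => i j; lia.
  split=> //; first by apply/reducedP; split=> //; move: e; rewrite e1 => -[].
  by move/(inv_alpha _ aS); rewrite e1; move: (ell (prodw l)) => i; lia.
by apply/reducedP; rewrite /= aS lS prodw_cons (ell_ninv aS na) e.
Qed.

Lemma rts_inv l x : reduced l -> x \in rts l <-> inv (prodw l) x.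
Proof.
elim: l x => [|a l IH] x; first by rewrite prodw_nil; split=> // /inv1.
move/reduced_cons => [aS rl na]; rewrite prodw_cons (inv_mul _ aS na) /= inE mem_map_refl //.
by rewrite -(IH _ rl); split=> [/orP[/eqP ->|->]|[->|->]]; rewrite ?eqxx ?orbT //; [left|right].
Qed.

Lemma rts_uniq l : reduced l -> uniq (rts l).
Proof.
elim: l => //= a l IH /reduced_cons[aS rl na].
rewrite map_inj_uniq ?IH ?andbT //; last by apply: (can_inj (g := refl a)) => z; rewrite refl_inv.
rewrite mem_map_refl // refl_self //; apply/negP => /(rts_inv _ rl)/inv_pos/posP /(_ a).
by rewrite oppE alphaE eqxx oppr_ge0 ler10.
Qed.

Lemma srt_word c w L F : srt c w L F -> exists l, [/\ reduced l, prodw l = w & rts l = L].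
Proof.
elim=> [|{}s {}c {}w {}L {}F sS nw h [l [rl pl el]]|{}s {}c {}w {}L {}F sS nw h [l [rl pl el]]].
- exists [::]; rewrite prodw_nil; split=> //; apply/reducedP.
  by rewrite prodw_nil ell1.
- exists (s :: l); rewrite prodw_cons pl /= el; split=> //.
  by apply/reduced_cons; rewrite pl.
- by exists l.
Qed.

Lemma alpha_inj : injective (@alpha gT).
Proof.
move=> a b /ffunP /(_ a); rewrite !alphaE eqxx; case: eqVneq => // _ /eqP.
by rewrite oner_eq0.
Qed.

Lemma perp_commute a b : a \in S -> b \in S -> bil (alpha a) (alpha b) = 0 ->
  (a * b = b * a)%g.
Proof.
move=> aS bS h; have ab : a != b.
  apply: contra_eq_neq h => ->; rewrite bil_alpha kf1 ?invol //.
  by apply/eqP; lra.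
by apply/eqP; rewrite -kf_eq0 ?invol // -bil_alpha h.
Qed.

(** Orthogonality makes [b] commute with the letters before it, so it travels to the front. The
    roots of [M1] are fixed by [refl b], hence unchanged in the new sequence. *)
Lemma word_move l b M1 M2 : b \in S -> reduced l -> rts l = M1 ++ alpha b :: M2 ->
  (forall x, x \in M1 -> bil x (alpha b) = 0) ->
  exists l', [/\ reduced l', (b * prodw l')%g = prodw l & rts l' = M1 ++ map (refl b) M2].
Proof.
move=> bS; elim: l M1 M2 => [|a l IH] [|x M1] M2 //=.
  move=> /reduced_cons[aS rl na] [/alpha_inj -> <-] _; exists l; split=> //.
    by rewrite prodw_cons.
  by rewrite -map_comp -[LHS]map_id; apply: eq_map => z /=; rewrite refl_inv.
move=> /reduced_cons[aS rl na] [<- e] H.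
have pab : bil (alpha a) (alpha b) = 0 by apply: H; rewrite mem_head.
have cab := perp_commute aS bS pab.
have fab : refl a (alpha b) = alpha b by rewrite /refl pab scale0r subr0.
have refl2 (l' : seq (V gT)) : map (refl a) (map (refl a) l') = l'.
  by rewrite -map_comp -[RHS]map_id; apply: eq_map => z /=; rewrite refl_inv.
have e' : rts l = map (refl a) M1 ++ alpha b :: map (refl a) M2.
  by rewrite -[LHS]refl2 e map_cat /= fab.
have [|l' [rl' pl' el']] := IH _ _ rl e'.
  move=> y; rewrite mem_map_refl // => yM.
  by rewrite -fab -(refl_inv y aS) bil_refl ?invol // H // inE yM orbT.
exists (a :: l'); have pe : (b * prodw (a :: l') = prodw (a :: l))%g.
  by rewrite !prodw_cons mulgA -cab -mulgA pl'.
split=> //.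
  apply/reduced_cons; split=> // hi; apply: na; rewrite -pl'.
  have bl' : ~ inv (prodw l') (alpha b).
    move=> hb; have := size_rts l; have := size_rts l'; rewrite e' el' !size_cat /= !size_map.
    move: rl rl' => /reducedP[_ ->] /reducedP[_ ->] h1; rewrite -pl'.
    by have := ell_inv bS hb; move: (ell _) h1 => i h1; lia.
  by apply/(inv_mul _ bS bl'); right; rewrite /refl bilC pab scale0r subr0.
rewrite /= el' map_cat refl2 -!map_comp; congr (_ :: _ ++ _); apply: eq_map => z /=.
rewrite -(act_gen _ aS) -(act_gen _ bS) -(act_gen _ aS) -!actM -(act_gen _ bS).
by rewrite cab -mulgA invol // mulg1.
Qed.

Lemma act_fix_coef w b z : (forall x, inv w x -> x b = 0) -> act w z b = z b.
Proof.
elim/inv_ind: w z => [|a w aS na IH] z H; first by rewrite act1.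
have ab : b != a.
  have h0 : inv (a * w) (alpha a) by apply/(inv_mul _ aS na); left.
  by apply/eqP => e; have := H _ h0; rewrite alphaE e eqxx => /eqP; rewrite oner_eq0.
rewrite actM (act_gen _ aS) refl_neq // IH // => x hx; rewrite -(refl_neq (a := a)) //.
by apply: H; apply/(inv_mul _ aS na); right; rewrite refl_inv.
Qed.

Lemma omle_skip s c x y : x s = 0 -> y s = 0 -> omle (s :: c) x y = omle c x y.
Proof. by move=> hx hy; rewrite /omle !eul_skip. Qed.

Lemma omle_rcons s c x y : x s = 0 -> y s = 0 -> omle (rcons c s) x y = omle c x y.
Proof. by move=> hx hy; rewrite /omle !eul_rcons hx hy !mulr0 !addr0. Qed.

(* The first inversion with nonzero [b]-coordinate is [alpha b + z], with [z] in
   the cone of the earlier inversions; comparing the two forms on [z] gives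
   [z = 0]. *)
Lemma word_head_coef b c l : wf (b :: c) -> reduced l ->
  (forall x, x \in rts l -> supp (mem (b :: c)) x) ->
  pairwise (omle (b :: c)) (rts l) -> alpha b \notin rts l ->
  forall x, x \in rts l -> x b = 0.
Proof.
move=> W rl sl pl nb; have bS : b \in S by move: W; rewrite wf_cons => /and3P[].
have bc : b \notin c by move: W; rewrite wf_cons => /and3P[].
suff H k : (k <= size l)%N -> forall x, x \in rts (take k l) -> x b = 0.
  by move=> x; rewrite -{1}(take_size l); apply: H.
elim: k => [|k IH] kl x; first by rewrite take0.
set l1 := take k l; have [lS _] := reducedP _ rl.
have l1S : inS l1 by move: lS; rewrite -{1}(cat_take_drop k l) all_cat => /andP[].
case E : (drop k l) => [|a l2]; first by move: kl (congr1 size E); rewrite size_drop /=; lia.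
have el : l = l1 ++ a :: l2 by rewrite -E cat_take_drop.
have aS : a \in S by move: lS; rewrite el all_cat /= => /and3P[].
have -> : take k.+1 l = rcons l1 a.
  have sk : size l1 = k by rewrite size_take; case: ltnP => // h; lia.
  by rewrite {1}el -[l1 ++ _]/(l1 ++ [:: a] ++ l2) catA cats1 -sk -(size_rcons l1 a) take_size_cat.
have r1 : reduced l1.
  apply/reducedP; split=> //; apply/eqP; rewrite eqn_leq ell_prodw // andbT.
  have [_ e] := reducedP _ rl; move: e; rewrite el prodw_cat size_cat => e.
  have := ellM (prodw l1) (prodw (a :: l2)); rewrite -e.
  have h2 : inS (a :: l2) by move: lS; rewrite el all_cat => /andP[].
  by have := ell_prodw h2; move: (ell (prodw _)) (ell _) (size l1) (size _) => i j m n; lia.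
have IH' y : inv (prodw l1) y -> y b = 0.
  by move/(rts_inv _ r1); apply: IH; apply: ltnW.
set th := act (prodw l1) (alpha a).
have eM : rts l = rts l1 ++ th :: map (act (prodw l1)) (map (refl a) (rts l2)).
  by rewrite el rts_cat.
have thL : th \in rts l by rewrite eM mem_cat mem_head orbT.
rewrite -cats1 rts_cat //= mem_cat inE => /orP[|/eqP ->]; first by apply: IH; apply: ltnW.
have [ab|ab] := eqVneq a b; last by rewrite act_fix_coef // alpha_neq.
exfalso; subst a; have cz := cone_act bS IH'.
set z := _ - _ in cz; have ez : th = alpha b + z by rewrite /z addrC subrK.
clearbody z.
have pz : pos z by apply: cone_pos cz => y /inv_pos.
have z0 : z b = 0.
  apply: (supp_notin (J := [pred a | a != b])); last by rewrite inE eqxx.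
  apply: cone_supp cz => y /IH' e; apply/suppP => a; rewrite inE negbK => /eqP ->.
  exact: e.
have sz : supp (mem (b :: c)) z.
  by apply: cone_supp cz => y /(rts_inv _ r1) hy; apply: sl; rewrite eM mem_cat hy.
have h : eul (b :: c) z th - eul (b :: c) th z <= 0.
  apply: (cz (fun y => eul (b :: c) y th - eul (b :: c) th y)) => [q y y'|y].
    by rewrite eul_linl eul_linr; ring.
  move/(rts_inv _ r1) => hy; rewrite subr_le0.
  by move: pl; rewrite eM pairwise_cat => /and3P[/allrelP al _ _]; apply: al; rewrite // mem_head.
move: h; rewrite ez eulDl eulDr eul_head // eul_headl // z0 add0r => h.
have q0 := sum_head_le0 W pz.
have {}q0 : \sum_(a <- c) z a * kf b a = 0 by move: q0 h; set q := \sum_(_ <- _) _; lra.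
have b0 := bil_alpha_supp W sz; rewrite z0 mulr0 q0 addr0 in b0.
have zz : z = 0.
  by apply: (root_split bS) => //; rewrite -ez; exact/root_act/root_alpha.
by move: thL; rewrite ez zz addr0; apply/negP.
Qed.

Lemma word_Srt c l : wf c -> reduced l -> (forall x, x \in rts l -> supp (mem c) x) ->
  pairwise (omle c) (rts l) -> Srt c (prodw l).
Proof.
move: {2}(size l + size c)%N (leqnn (size l + size c)) => n.
elim: n c l => [|n IH] c l len W rl sl pl.
  have -> : c = [::] by apply: size0nil; lia.
  have -> : l = [::] by apply: size0nil; lia.
  by rewrite prodw_nil; apply: Srt1.
case: c len W sl pl => [|b c] len W sl pl.
  case: l {len pl} rl sl => [|a l] rl sl; first by rewrite prodw_nil; apply: Srt1.
  have := sl (alpha a) (mem_head _ _) => /suppP /(_ a); rewrite alphaE eqxx => h.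
  by have /eqP := h isT; rewrite oner_eq0.
have bS : b \in S by move: W; rewrite wf_cons => /and3P[].
have Wc : wf c by move: W; rewrite wf_cons => /and3P[].
have bc : b \notin c by move: W; rewrite wf_cons => /and3P[].
have W' : wf (rcons c b) by rewrite wf_rcons.
have [bL|bL] := boolP (alpha b \in rts l); last first.
  have H := word_head_coef W rl sl pl bL.
  apply: Srt_skip => //; first by move/(rts_inv _ rl) => h; rewrite h in bL.
  apply: IH => //; first by rewrite /= addnS ltnS in len.
    move=> x xl; have /suppP sx := sl _ xl; apply/suppP => a ac.
    have [->|ab] := eqVneq a b; first exact: H.
    by apply: sx; change (a \notin b :: c); rewrite inE negb_or ab.
  apply: (sub_in_pairwise (P := mem (rts l)) _ _ pl); last by apply/allP.
  by move=> x y /H x0 /H y0; rewrite omle_skip.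
have [M1 [M2 eM]] : exists M1 M2, rts l = M1 ++ alpha b :: M2.
  by case/splitPr: bL => M1 M2; exists M1, M2.
have inL x : x \in rts l -> root x /\ pos x by move/(rts_inv _ rl) => [].
have H x : x \in M1 -> bil x (alpha b) = 0.
  move=> xM; have xl : x \in rts l by rewrite eM mem_cat xM.
  have [rx px] := inL _ xl; rewrite bilC; apply: (perp_head W) => //; first exact: sl.
    move: pl; rewrite eM pairwise_cat => /and3P[/allrelP /(_ x (alpha b) xM (mem_head _ _)) h _ _].
    have := omle_head W px; move: h; rewrite /omle eul_head // eul_headl //.
    by rewrite gerDl lerDl => h1 h2; apply/eqP; rewrite eq_le h1 h2.
  have := rts_uniq rl; rewrite eM cat_uniq /= negb_or => /and3P[_ /andP[h _] _].
  by apply/eqP => e; move: h; rewrite -e xM.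
have [l' [rl' pl' el']] := word_move bS rl eM H.
have fM : map (refl b) M1 = M1.
  rewrite -[RHS]map_id; apply/eq_in_map => x /H h.
  by rewrite /refl bilC h scale0r subr0.
have el'' : rts l' = map (refl b) (M1 ++ M2) by rewrite map_cat fM.
have subM x : x \in M1 ++ M2 -> x \in rts l.
  by rewrite eM !mem_cat inE => /orP[->|->]; rewrite ?orbT.
have nb : ~ inv (prodw l') (alpha b).
  move=> hb; have := ell_inv bS hb; rewrite pl'.
  move: rl rl' (size_rts l) (size_rts l') => /reducedP[_ <-] /reducedP[_ <-].
  by rewrite eM el' !size_cat /= !size_map; lia.
rewrite -pl'; apply: Srt_take => //; apply: IH => //.
- move: len; rewrite size_rcons -(size_rts l) -(size_rts l') eM el' !size_cat /= size_map; lia.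
- move=> x; rewrite el'' mem_map_refl // supp_rcons => /subM/sl.
  by rewrite supp_refl // memhd.
- rewrite el'' pairwise_map.
  have pM : pairwise (omle (b :: c)) (M1 ++ M2).
    apply: subseq_pairwise pl; rewrite eM cat_subseq //; exact: subseq_cons.
  apply: (sub_in_pairwise (P := mem (M1 ++ M2)) _ _ pM); last by apply/allP.
  move=> x y /subM/sl sx /subM/sl sy xy.
  by change (omle (rcons c b) (refl b x) (refl b y)); rewrite /omle !eul_refl.
Qed.

Lemma wsub_upper u v : wsub u v -> u <> v -> exists b, [/\ b \in S,
  inv v (act u (alpha b)), ~ inv u (act u (alpha b)) &
  forall x, inv (u * b) x <-> inv u x \/ x = act u (alpha b)].
Proof.
move=> uv ne; have : (u^-1 * v)^-1%g != 1%g.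
  by rewrite -[X in _ != X]invg1 (inj_eq invg_inj) -eq_mulVg1; apply/eqP.
move=> /des_exists[b hb]; have bS := des_S hb; exists b.
have /andP[_ h1] := hb.
have h2 : (ell (b * (u^-1 * v)) < ell (u^-1 * v))%N.
  have ey : ((u^-1 * v)^-1 * b = (b * (u^-1 * v))^-1)%g by rewrite [RHS]invMg (involV bS).
  by move: h1; rewrite ey !ellV.
have e := proj1 (wsub_lenP u v) uv.
have h3 : (ell v <= ell (u * b) + ell (b * (u^-1 * v)))%N.
  by apply: leq_trans (ellM _ _); rewrite -!mulgA involK // mulgA mulgV mul1g.
have h4 : ell (u * b) = (ell u).+1.
  case: (ell_mulr u bS) => // h4; exfalso; move: h2 h3; rewrite e h4.
  by move: (ell (u * b)) (ell (u^-1 * v)) (ell (b * (u^-1 * v))) => i j k; lia.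
have db : des (u * b) b by apply/andP; split; rewrite // involKr // h4.
have eb : - act (u * b) (alpha b) = act u (alpha b).
  by rewrite actM (act_gen _ bS) refl_self // actN opprK.
have iff x : inv u x <-> inv (u * b) x /\ x <> act u (alpha b).
  by have := inv_mulr x db; rewrite involKr // eb.
have nb : ~ inv u (act u (alpha b)) by move/iff => [].
have ib : inv (u * b) (act u (alpha b)) by rewrite -eb; apply: inv_des.
have E x : inv (u * b) x <-> inv u x \/ x = act u (alpha b).
  split=> [hx|[/iff[]//|-> //]].
  by have [->|/eqP h] := eqVneq x (act u (alpha b)); [right|left; apply/iff].
split=> //.
have : wsub (u * b) v.
  apply/wsub_lenP; rewrite invMg (involV bS) -mulgA h4.
  have h5 : ell (u^-1 * v) = (ell (b * (u^-1 * v))).+1.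
    by case: (ell_mull (u^-1 * v) bS) h2 => [->|//]; move: (ell _) => i; lia.
  by rewrite e h5 addnS.
by apply.
Qed.

(** Each letter adds one root, so the projection of a longer prefix gains that root or nothing, and
    going up by a single root in the weak order is multiplication by one more letter. *)
Lemma word_filter J l : reduced l ->
  exists l', reduced l' /\ rts l' = filter (supp J) (rts l).
Proof.
elim/last_ind: l => [|l a IH] rla; first by exists [::].
have [h1 h2] := reducedP _ rla; move: h1 h2; rewrite all_rcons size_rcons prodw_rcons => /= /andP[aS lS] e.
have rl : reduced l.
  apply/reducedP; split=> //; apply/eqP; rewrite eqn_leq ell_prodw // andbT.
  case: (ell_mulr (prodw l) aS); rewrite -e => h; have := ell_prodw lS.
    by move: h => [->].
  by rewrite h; move: (size l) => i; lia.
have [l' [rl' el']] := IH rl.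
have ra : rts (rcons l a) = rcons (rts l) (act (prodw l) (alpha a)).
  by rewrite -!cats1 rts_cat.
rewrite ra filter_rcons; set th := act _ _; case: ifPn => sth; last by exists l'.
have [v hv] := proj J (prodw (rcons l a)).
have iv x : inv v x <-> inv (prodw l') x \/ x = th.
  rewrite hv -(rts_inv _ rla) -(rts_inv _ rl') el' mem_filter ra mem_rcons inE.
  split=> [[/orP[/eqP ->|->] ->]|[/andP[-> ->]|->]]; rewrite ?eqxx ?orbT; auto.
have nth : ~ inv (prodw l') th.
  move/(rts_inv _ rl'); rewrite el' mem_filter => /andP[_ hth].
  by have := rts_uniq rla; rewrite ra rcons_uniq hth.
have uv : wsub (prodw l') v by move=> x hx; apply/iv; left.
have ne : prodw l' <> v by move=> h; apply: nth; rewrite h; apply/iv; right.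
have [b [bS vb nb eb]] := wsub_upper uv ne.
have ebth : act (prodw l') (alpha b) = th by case: (proj1 (iv _) vb) => // /nb.
have [l'S sl'] := reducedP _ rl'.
exists (rcons l' b); split; last by rewrite -cats1 rts_cat //= ebth el' cats1.
apply/reducedP; rewrite all_rcons /= bS l'S size_rcons prodw_rcons; split=> //.
case: (ell_mulr (prodw l') bS) => h; first by rewrite h sl'.
have : des (prodw l') b by apply/andP; rewrite h.
move=> /(inv_mulr (act (prodw l') (alpha b)))[h' _]; exfalso.
by apply: nb; case: h' => //; apply/eb; right.
Qed.

(** The skew inequalities survive filtering, and on roots without [s]-coordinate they are the same
    for [c0] and [c]; [word_Srt] concludes. *)
Lemma Srt_proj s c c0 w v : wf (s :: c) -> c0 = s :: c \/ c0 = rcons c s -> Srt c0 w ->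
  (forall x, inv v x <-> inv w x /\ supp (mem c) x) -> Srt c v.
Proof.
move=> W e [L [F h]] hv.
have sc : s \notin c by move: W; rewrite wf_cons => /and3P[].
have Wc : wf c by move: W; rewrite wf_cons => /and3P[].
have W0 : wf c0 by case: e => ->; rewrite ?wf_rcons.
have [l [rl pl el]] := srt_word h.
have [l' [rl' el']] := word_filter (mem c) rl.
have -> : v = prodw l'.
  apply: inv_eq => x; rewrite hv -(rts_inv _ rl') el' mem_filter -pl -(rts_inv _ rl).
  by split=> [[-> ->]|/andP[]].
have s0 x : x \in rts l' -> x s = 0.
  by rewrite el' mem_filter => /andP[sx _]; apply: supp_notin sx _.
apply: word_Srt => //; first by move=> x; rewrite el' mem_filter => /andP[].
have p0 : pairwise (omle c0) (rts l').
  by rewrite el' el; apply: pairwise_filter; apply: srt_sorted W0 h.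
apply: (sub_in_pairwise (P := mem (rts l')) _ _ p0); last by apply/allP.
by move=> x y /s0 x0 /s0 y0; case: e => ->; rewrite ?omle_skip ?omle_rcons.
Qed.

(** * Counting sortable elements and the Cambrian projection *)

Lemma des_mul s w r : s \in S -> ~ inv w (alpha s) -> des w r -> des (s * w) r.
Proof.
move=> sS nw dr; have rS := des_S dr.
apply: desI => //; rewrite actM (act_gen _ sS) -reflN; apply: pos_refl => //.
- exact/root_opp/root_act/root_alpha.
- exact: des_neg.
by apply/eqP => e; apply: nw; rewrite -e; apply: inv_des.
Qed.

Lemma ndes_mul s w r : s \in S -> des (s * w) r -> ~~ des w r -> act w (alpha r) = alpha s.
Proof.
move=> sS dr ndr; have rS := des_S dr.
apply: simple_flip => //; first exact/root_act/root_alpha.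
  by case: (root_sign (root_act w (root_alpha rS))) => // h; case/negP: ndr; apply: desI.
by have := des_neg dr; rewrite actM (act_gen _ sS).
Qed.

Lemma supp_drop s c x : x s = 0 -> supp (mem (s :: c)) x -> supp (mem c) x.
Proof.
move=> x0 /suppP h; apply/suppP => a ac; have [->//|ne] := eqVneq a s.
by apply: h; change (a \notin s :: c); rewrite inE negb_or ne.
Qed.

(* If [alpha s] is the cover root of [r], with [s] the first letter, take for [u]
   the projection of [w] to the parabolic subgroup omitting [s]. *)
Lemma cover_sep c w r : wf c -> Srt c w -> des w r ->
  exists u, [/\ Srt c u, wsub u w, ~ inv u (- act w (alpha r)) &
    forall t, des w t -> t != r -> inv u (- act w (alpha t))].
Proof.
move=> W [L [F h]]; elim: h W => [|{}s {}c {}w {}L {}F sS nw h IH|{}s {}c {}w {}L {}F sS nw h IH] W dr.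
- by move: dr => /inv_des/inv1.
- have W' : wf (rcons c s) by rewrite wf_rcons.
  have Wc : wf c by move: W; rewrite wf_cons => /and3P[].
  have sc : s \notin c by move: W; rewrite wf_cons => /and3P[].
  have ea t : - act (s * w) (alpha t) = refl s (- act w (alpha t)).
    by rewrite actM (act_gen _ sS) reflN.
  have [dr'|ndr] := boolP (des w r).
    have [u [hu uw nu tu]] := IH W' dr'.
    have nus : ~ inv u (alpha s) by move/uw.
    exists (s * u)%g; split.
    + exact: Srt_take.
    + exact/wsub_mul.
    + rewrite ea => /(inv_mul _ sS nus)[e|]; last by rewrite refl_inv.
      have := des_neg dr'; rewrite -(refl_inv (- _) sS) e refl_self // => /posP /(_ s).
      by rewrite oppE alphaE eqxx oppr_ge0 ler10.
    move=> t dt tr; apply/(inv_mul _ sS nus); rewrite ea.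
    have [dt'|ndt] := boolP (des w t); first by right; rewrite refl_inv //; apply: tu.
    by left; rewrite (ndes_mul sS dt ndt) reflN refl_self // opprK.
  have er : act (s * w) (alpha r) = - alpha s.
    by rewrite actM (ndes_mul sS dr ndr) (act_gen _ sS) refl_self.
  have hw : Srt (s :: c) (s * w) by do 2!eexists; apply: srt_take h.
  have [v hv] := proj (mem c) (s * w)%g.
  have nv : ~ inv v (alpha s).
    by move/hv => [_ /supp_notin /(_ sc)] /eqP; rewrite alphaE eqxx oner_eq0.
  have cv : Srt c v by apply: (Srt_proj W (or_introl erefl) hw hv).
  exists v; split=> //.
  + exact: Srt_skip.
  + by move=> x /hv[].
  + by rewrite er opprK.
  move=> t dt tr; apply/hv; split; first exact: inv_des.
  rewrite suppN; apply: (@supp_drop s); last first.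
    by rewrite -suppN; apply: (Srt_supp hw); apply: inv_des.
  case: hw => L' [F' hw].
  by apply: (init_cover W hw dr dt _ er); rewrite eq_sym.
- move: (W); rewrite wf_cons => /and3P[_ _ Wc].
  have [u [hu uw nu tu]] := IH Wc dr.
  by exists u; split=> //; apply: Srt_skip => // /uw.
Qed.

Definition sset c : {set gT} := [set w | `[< Srt c w >]].

Lemma ssetP c w : reflect (Srt c w) (w \in sset c).
Proof. by rewrite inE; apply: asboolP. Qed.

(** The two terms count the elements that skip [s] and those that take it. *)
Lemma card_sset_cons s c : wf (s :: c) ->
  #|sset (s :: c)| = (#|sset c| + #|[set w in sset (rcons c s) | (ell w < ell (s * w))%N]|)%N.
Proof.
move=> W; move: (W); rewrite wf_cons => /and3P[sc sS Wc].
rewrite -(cardsID [set w | (ell w < ell (s * w))%N]); congr (_ + _)%N.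
  apply: eq_card => w; rewrite in_setI; apply/andP/idP => [[/ssetP h]|/ssetP h].
    rewrite inE => hl; apply/ssetP; apply: Srt_skipV h _ => /(inv_alpha _ sS).
    by move: hl; move: (ell w) (ell _) => i j; lia.
  have nw : ~ inv w (alpha s).
    by move/(Srt_supp h)/supp_notin => /(_ _ sc) /eqP; rewrite alphaE eqxx oner_eq0.
  split; first by apply/ssetP; apply: Srt_skip.
  by rewrite inE (ell_ninv sS nw).
rewrite -[RHS](card_imset _ (mulgI s)); apply: eq_card => w; apply/setDP/imsetP => [[/ssetP h]|].
  rewrite inE -leqNgt => hl.
  have hi : inv w (alpha s).
    apply/(inv_alpha _ sS); case: (ell_mull w sS) => e; rewrite e //.
    by move: hl; rewrite e ltnn.
  exists (s * w)%g; last by rewrite involK.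
  rewrite inE; apply/andP; split; first by apply/ssetP; apply: Srt_takeV.
  by rewrite involK // (ell_inv sS hi).
case=> v; rewrite inE => /andP[/ssetP h hl] ->.
have nv : ~ inv v (alpha s) by move/(inv_alpha _ sS); move: hl; move: (ell v) (ell _) => i j; lia.
split; first by apply/ssetP; apply: Srt_take.
by rewrite inE involK // -leqNgt (ell_ninv sS nv).
Qed.

(** In other words, [w] is the join of [s] and its projection to [c]. Every cover root of [w] is
    [alpha s] or has no [s]-coordinate, so a meet with [v] strictly below [w] would contain a cover
    root it has to miss. *)
Lemma final_join s c w v : wf (s :: c) -> Srt (rcons c s) w -> inv w (alpha s) ->
  (forall x, inv w x -> supp (mem c) x -> inv v x) -> inv v (alpha s) -> wsub w v.
Proof.
move=> W h hs H vs; have sS : s \in S by move: W; rewrite wf_cons => /and3P[].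
have [a [da ea _ hr]] := final_cover_exists W h hs.
have [m [mw mv mz]] := meet w v.
have ms : inv m (alpha s).
  have := mz s (wsub_gen sS hs) (wsub_gen sS vs); apply.
  by rewrite -[s in inv s _]mulg1; apply/(inv_mul _ sS (@inv1 _)); left.
suff <- : m = w by [].
apply: contrapT => ne; have [r [dr mr]] := wsub_lower mw ne.
suff hm : inv m (- act w (alpha r)) by have /(inv_mulr _ dr)[] := mr _ hm.
have [->|ra] := eqVneq r a; first by rewrite ea opprK.
have [p hp] := proj (mem c) w.
apply: (mz p) => [x /hp[]//|x /hp[]|]; first exact: H.
apply/hp; split; first exact: inv_des.
rewrite suppN; apply: (@supp_drop s); first exact: hr.
by rewrite -suppN -supp_rcons; apply: (Srt_supp h); apply: inv_des.
Qed.

Lemma final_proj_inj s c w w' v : wf (s :: c) -> Srt (rcons c s) w -> Srt (rcons c s) w' ->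
  inv w (alpha s) -> inv w' (alpha s) ->
  (forall x, inv v x <-> inv w x /\ supp (mem c) x) ->
  (forall x, inv v x <-> inv w' x /\ supp (mem c) x) -> w = w'.
Proof.
move=> W h h' hs hs' hv hv'; apply: wsub_anti.
  by apply: (final_join W h hs) => // x h1 h2; case: (proj1 (hv' x)) => //; apply/hv.
by apply: (final_join W h' hs') => // x h1 h2; case: (proj1 (hv x)) => //; apply/hv'.
Qed.

(* By [final_proj_inj], [fset s c] injects into [sset c] by projection to the
   parabolic subgroup generated by [c]. *)
Definition fset s c : {set gT} := [set w in sset (rcons c s) | (ell (s * w) < ell w)%N].

Lemma fsetP s c w : s \in S -> reflect (Srt (rcons c s) w /\ inv w (alpha s)) (w \in fset s c).
Proof.
move=> sS; rewrite inE; apply: (iffP andP) => -[h1 h2]; split; try exact/ssetP.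
  exact/(inv_alpha _ sS).
exact/(inv_alpha _ sS).
Qed.

Lemma card_rot1 s c : wf (s :: c) ->
  (#|sset (s :: c)| + #|fset s c| = #|sset c| + #|sset (rcons c s)|)%N.
Proof.
move=> W; move: (W); rewrite wf_cons => /and3P[sc sS Wc].
rewrite card_sset_cons // -addnA; congr (_ + _)%N.
rewrite -[in RHS](cardsID [set w | (ell w < ell (s * w))%N]); congr (_ + _)%N.
  by apply: eq_card => w; rewrite !inE.
apply: eq_card => w; rewrite !inE andbC; congr (_ && _).
by case: (ell_mull w sS) => ->; move: (ell _) => i; lia.
Qed.

Lemma fset_proj s c : wf (s :: c) -> exists f : gT -> gT,
  [/\ {in fset s c &, injective f}, f @: fset s c \subset sset c &
   forall w x, inv (f w) x <-> inv w x /\ supp (mem c) x].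
Proof.
move=> W; move: (W); rewrite wf_cons => /and3P[sc sS Wc].
have [f hf] := choice (proj (mem c)); exists f; split=> //.
  move=> w w' /(fsetP _ _ sS)[h hs] /(fsetP _ _ sS)[h' hs'] e.
  by apply: (final_proj_inj (v := f w) W h h') => // x; rewrite e.
apply/subsetP => v /imsetP[w /(fsetP _ _ sS)[h hs] ->]; apply/ssetP.
exact: (Srt_proj W (or_intror erefl) h (hf w)).
Qed.

Lemma card_fset_le s c : wf (s :: c) -> (#|fset s c| <= #|sset c|)%N.
Proof.
move=> W; have [f [fi fs _]] := fset_proj W.
by rewrite -(card_in_imset fi) subset_leq_card.
Qed.

Lemma wf_rot k c : wf c -> wf (rot k c).
Proof. by case/andP=> u a; apply/andP; rewrite rot_uniq (eq_all_r (mem_rot k c)). Qed.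

(** By [card_rot1] and [card_fset_le], rotating by one letter never increases the count. *)
Lemma card_rot_le c k : wf c -> (#|sset (rot k c)| <= #|sset c|)%N.
Proof.
move=> W; elim: k => [|k IH]; first by rewrite rot0.
have [kc|kc] := ltnP k (size c); last by rewrite rot_oversize ?leqW.
apply: leq_trans IH; have -> : rot k.+1 c = rot 1 (rot k c) by rewrite -rotD ?add1n.
have := wf_rot k W; case: (rot k c) => // s c' W'.
have := card_rot1 W'; have := card_fset_le W'; rewrite rot1_cons.
by move: #|_| #|_| #|_| #|_| => i j m n; lia.
Qed.

(* Rotating the word all the way around cannot decrease the number of sortable
   elements, hence no rotation does, which makes the injection above bijective. *)
Lemma card_fset s c : wf (s :: c) -> #|fset s c| = #|sset c|.
Proof.
move=> W; have W' : wf (rcons c s) by rewrite wf_rcons.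
have := card_rot_le (size c) W'; rewrite -cats1 rot_size_cat cats1 /=.
have := card_rot1 W; have := card_fset_le W.
by move: #|_| #|_| #|_| #|_| => i j m n; lia.
Qed.

Lemma final_lift s c v : wf (s :: c) -> Srt c v -> exists w,
  [/\ Srt (rcons c s) w, inv w (alpha s) & forall x, inv v x <-> inv w x /\ supp (mem c) x].
Proof.
move=> W hv; have sS : s \in S by move: W; rewrite wf_cons => /and3P[].
have [f [fi fs hf]] := fset_proj W.
have /eqP e : f @: fset s c == sset c.
  by rewrite eqEcard fs card_in_imset // (card_fset W) leqnn.
have : v \in f @: fset s c by rewrite e; apply/ssetP.
by case/imsetP => w /(fsetP _ _ sS)[h hs] ->; exists w.
Qed.

(** The lift of [u] is the join of [s] and [u], sortable for [rcons c s]. By [final_cover_exists] so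
    is [s * w], and taking [s] first makes [w] sortable for [s :: c]. *)
Lemma init_join s c u v : wf (s :: c) -> Srt c u -> wsub u v -> inv v (alpha s) ->
  exists w, [/\ Srt (s :: c) w, inv w (alpha s), wsub u w & wsub w v].
Proof.
move=> W hu uv vs; have sS : s \in S by move: W; rewrite wf_cons => /and3P[].
have [w [hw ws eu]] := final_lift W hu.
have [a [da ea hsw _]] := final_cover_exists W hw ws.
exists w; split=> //.
- by rewrite -(involK w sS); apply: Srt_take => //; apply: inv_nmul.
- by move=> x /eu[].
by apply: (final_join W hw ws) => // x h1 h2; apply: uv; apply/eu.
Qed.

Lemma max_sortable c v : wf c -> exists z : gT, [/\ Srt c z, wsub z v &
  forall u : gT, Srt c u -> wsub u v -> wsub u z].
Proof.
move: {2}(ell v + size c)%N (leqnn (ell v + size c)) => n.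
elim: n c v => [|n IH] [|s c] v len W; try by move: len; rewrite addnS.
- by exists 1%g; split; [exact: Srt1|exact: wsub1|by move=> u /Srt_nil -> _; apply: wsub1].
- by exists 1%g; split; [exact: Srt1|exact: wsub1|by move=> u /Srt_nil -> _; apply: wsub1].
move: (W); rewrite wf_cons => /and3P[sc sS Wc].
have [hs|hs] := pselect (inv v (alpha s)); last first.
  have [|z [hz zv zm]] := IH c v _ Wc; first by rewrite /= addnS ltnS in len.
  exists z; split=> //; first by apply: Srt_skip => // /zv.
  by move=> u hu uv; apply: zm => //; apply: Srt_skipV hu _ => /uv.
have W' : wf (rcons c s) by rewrite wf_rcons.
have [|z [hz zv zm]] := IH (rcons c s) (s * v)%g _ W'.
  by rewrite size_rcons; move: len; rewrite (ell_inv sS hs).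
have nv := inv_nmul sS hs.
have nz : ~ inv z (alpha s) by move/zv.
have zsv : wsub (s * z) v by rewrite -(involK v sS); apply/wsub_mul.
exists (s * z)%g; split=> //; first exact: Srt_take.
have main u : Srt (s :: c) u -> inv u (alpha s) -> wsub u v -> wsub u (s * z).
  move=> hu us uv; have nu := inv_nmul sS us; rewrite -(involK u sS).
  apply/wsub_mul => //; apply: zm; first exact: Srt_takeV.
  by apply/(wsub_mul sS nu nv); rewrite !involK.
move=> u hu uv; have [us|us] := pselect (inv u (alpha s)); first exact: main.
(* A sortable element without [alpha s] is first enlarged to its join with [s], which stays below
   [v]. *)
have [w [hw ws uw wv]] := init_join W (Srt_skipV hu us) uv hs.
by apply: wsub_trans uw _; apply: main.
Qed.

End RootSystem.

(** * Intervals below a sortable element *)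

Lemma weak_leP u v : le u v <-> wsub u v.
Proof.
split=> [[s1 [s2 [/reducedP[h1 e1] /reducedP[h2 e2] <- <-]]]|/wsub_lenP e].
  apply/wsub_lenP; rewrite -e1 -e2 prodw_cat mulKg size_cat; congr (_ + _)%N.
  move: h2; rewrite all_cat => /andP[_ h2]; apply/eqP; rewrite eqn_leq ell_prodw // andbT.
  have := ellM (prodw s1) (prodw s2); rewrite -prodw_cat -e1 -e2 size_cat.
  by rewrite leq_add2l.
have [l1 [h1 p1 z1]] := ell_word u; have [l2 [h2 p2 z2]] := ell_word (u^-1 * v).
exists l1, l2; have p : prodw (l1 ++ l2) = v by rewrite prodw_cat p1 p2 mulgA mulgV mul1g.
split=> //; apply/reducedP; first by rewrite p1.
by rewrite all_cat h1 h2 p size_cat z1 z2 -e.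
Qed.

Lemma descentP w a : descent S w a <-> des w a.
Proof. by split=> [[h1 h2]|/andP[]//]; apply/andP. Qed.

Section Lattice.
Variable Q : gT -> Prop.

Lemma weak_anti u v : le u v -> le v u -> u = v.
Proof. by move=> /weak_leP h1 /weak_leP h2; apply: wsub_anti. Qed.
Lemma weak_refl u : le u u.
Proof. exact/weak_leP. Qed.
Lemma weak_trans v u w : le u v -> le v w -> le u w.
Proof. by move=> /weak_leP h1 /weak_leP h2; apply/weak_leP; apply: wsub_trans h2. Qed.

(** Distributivity is tested on the meet of [y2] with [y1 \/ z]: it is [y2], while the meets of [y2]
    with [y1] and with [z] both lie below [y1]. The last two hypotheses replace explicit joins and
    meets, so both intervals are covered. *)
Lemma pentagon (y1 y2 z w : gT) : Q y1 -> Q y2 -> Q z -> Q w ->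
  le y1 y2 -> le y2 w -> le z w -> y1 <> y2 ->
  (forall u, Q u -> le y1 u -> le z u -> u = w) ->
  (forall u, Q u -> le u y2 -> le u z -> le u y1) ->
  ~ distributive_lattice Q le.
Proof.
move=> Q1 Q2 Qz Qw y12 y2w zw ne H1 H2 [latt dist].
have [[m hm] _] := latt _ _ Q2 Qz; have [Qm mA mB] := hm.
have my1 : le m y1 by apply: H2 => //; apply: mA; [left|right].
have [] := dist _ _ _ _ _ _ _ Q2 Q1 Qz (_ : is_lub Q le (pairp y1 z) w)
  (_ : is_glb Q le (pairp y2 w) y2) (_ : is_glb Q le (pairp y2 y1) y1) hm.
- split=> //.
    by move=> a [->|->] //; apply: weak_trans y12 y2w.
  by move=> u Qu hu; rewrite (H1 u Qu); [exact: weak_refl|apply: hu; left|apply: hu; right].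
- split=> //; first by move=> a [->|->] //; apply: weak_refl.
  by move=> u Qu hu; apply: hu; left.
- split=> //; first by move=> a [->|->] //; apply: weak_refl.
  by move=> u Qu hu; apply: hu; right.
move=> _ _ /(_ y1 Q1) h; apply: ne; apply: weak_anti y12 _; apply: h.
by move=> a [->|->] //; apply: weak_refl.
Qed.

Lemma boolean_distributive : boolean_lattice Q le -> distributive_lattice Q le.
Proof.
case=> n [f [fi fs fl]].
have glbE x y m : Q x -> Q y -> is_glb Q le (pairp x y) m -> f m = f x :&: f y.
  move=> Qx Qy [Qm mA mB]; have [k [Qk ek]] := fs (f x :&: f y).
  apply/eqP; rewrite eqEsubset -ek; apply/andP; split.
    by rewrite ek subsetI; apply/andP; split; apply/(fl _ _ Qm) => //; apply: mA; [left|right].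
  apply/(fl _ _ Qk) => //; apply: mB => // a [->|->]; apply/(fl _ _ Qk) => //; rewrite ek.
    exact: subsetIl.
  exact: subsetIr.
have lubE x y m : Q x -> Q y -> is_lub Q le (pairp x y) m -> f m = f x :|: f y.
  move=> Qx Qy [Qm mA mB]; have [k [Qk ek]] := fs (f x :|: f y).
  apply/eqP; rewrite eqEsubset -ek; apply/andP; split; last first.
    by rewrite ek subUset; apply/andP; split; apply/(fl _ _ _ Qm) => //; apply: mA; [left|right].
  apply/(fl _ _ Qm) => //; apply: mB => // a [->|->]; apply/(fl _ _ _ Qk) => //; rewrite ek.
    exact: subsetUl.
  exact: subsetUr.
split=> [x y Qx Qy|x y z a b c d Qx Qy Qz ha hb hc hd].
  have [k [Qk ek]] := fs (f x :&: f y); have [j [Qj ej]] := fs (f x :|: f y).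
  split; [exists k|exists j]; split=> //.
  - by move=> a [->|->]; apply/(fl _ _ Qk) => //; rewrite ek ?subsetIl ?subsetIr.
  - move=> z Qz hz; apply/(fl _ _ Qz) => //; rewrite ek subsetI.
    by apply/andP; split; apply/(fl _ _ Qz) => //; apply: hz; [left|right].
  - by move=> a [->|->]; apply/(fl _ _ _ Qj) => //; rewrite ej ?subsetUl ?subsetUr.
  - move=> z Qz hz; apply/(fl _ _ Qj) => //; rewrite ej subUset.
    by apply/andP; split; apply/(fl _ _ _ Qz) => //; apply: hz; [left|right].
have [Qa _ _] := ha; have [Qb _ _] := hb; have [Qc _ _] := hc; have [Qd _ _] := hd.
have eb : f b = f c :|: f d.
  by rewrite (glbE _ _ _ Qx Qa hb) (lubE _ _ _ Qy Qz ha) (glbE _ _ _ Qx Qy hc)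
    (glbE _ _ _ Qx Qz hd) setIUr.
split=> //.
  by move=> u [->|->]; apply/(fl _ _ _ Qb) => //; rewrite eb ?subsetUl ?subsetUr.
move=> u Qu hu; apply/(fl _ _ Qb) => //; rewrite eb subUset.
by apply/andP; split; apply/(fl _ _ _ Qu) => //; apply: hu; [left|right].
Qed.

End Lattice.

Lemma boolean_ext (P Q : gT -> Prop) : (forall x, P x <-> Q x) ->
  boolean_lattice P le -> boolean_lattice Q le.
Proof.
move=> PQ [n [f [fi fs fl]]]; exists n, f; split.
- by move=> x y /PQ hx /PQ hy; apply: fi.
- by move=> A; have [x [/PQ Qx ex]] := fs A; exists x.
- by move=> x y /PQ hx /PQ hy; apply: fl.
Qed.

(** * Commuting descents: the Boolean case *)

Lemma kf_comm a b : a \in S -> b \in S -> a != b -> (a * b = b * a)%g -> kf a b = 0.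
Proof. by move=> aS bS ab e; apply/eqP; rewrite kf_eq0 ?invol //; apply/eqP. Qed.

Lemma refl_comm a b : a \in S -> b \in S -> a != b -> (a * b = b * a)%g ->
  refl a (alpha b) = alpha b.
Proof. by move=> aS bS ab e; rewrite /refl bil_alpha kf_comm // scale0r subr0. Qed.

(** Distinct commuting descents are orthogonal simple roots, so removing one leaves the cover roots
    of the others unchanged. *)
Lemma inv_prod_des w l x : uniq l -> {in l, forall a, des w a} ->
  {in l &, forall a b, (a * b = b * a)%g} ->
  inv (w * prodw l) x <-> (inv w x /\ forall a, a \in l -> x <> - act w (alpha a)).
Proof.
elim: l w => [|k l IH] w /=; first by rewrite prodw_nil mulg1; split=> [h|[]].
case/andP=> kl ul hd hc; have dk : des w k by apply: hd; rewrite mem_head.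
have kS := des_S dk.
have ea a : a \in l -> act (w * k) (alpha a) = act w (alpha a).
  move=> al; have ak : k != a by apply: contraNneq kl => ->.
  have da : des w a by apply: hd; rewrite inE al orbT.
  have aS := des_S da.
  by rewrite actM (act_gen _ kS) refl_comm // hc // inE ?eqxx // al orbT.
rewrite prodw_cons mulgA (IH (w * k)%g) //; last first.
- by move=> a b al bl; apply: hc; rewrite inE ?al ?bl orbT.
- move=> a al; have da : des w a by apply: hd; rewrite inE al orbT.
  by apply: desI; rewrite ?(des_S da) // ea //; apply: des_neg.
rewrite (inv_mulr _ dk); split=> [[[h1 h2] h3]|[h1 h2]].
  by split=> // a; rewrite inE => /orP[/eqP ->//|al]; rewrite -ea //; apply: h3.
split; first by split=> //; apply: h2; rewrite mem_head.
by move=> a al; rewrite ea //; apply: h2; rewrite inE al orbT.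
Qed.

Lemma prodw_rem l k : k \in l -> {in l &, forall a b, (a * b = b * a)%g} ->
  prodw l = (k * prodw (rem k l))%g.
Proof.
elim: l => //= a l IH; rewrite inE prodw_cons => /orP[/eqP ->|kl] hc; first by rewrite eqxx.
have [->//|ak] := eqVneq a k.
rewrite IH // => [|b b' bl bl']; last by apply: hc; rewrite inE ?bl ?bl' orbT.
by rewrite prodw_cons !mulgA; congr (_ * _)%g; apply: hc; rewrite inE ?eqxx ?kl ?orbT.
Qed.

(** All cover roots are supported on [s] and the letters commuting with it; by [cov_supp] so are all
    inversions of [s * w]. There [refl s] negates the [s]-coordinate, which is nonnegative before
    and after, hence zero. *)
Lemma inv_take_fix c s w L F : wf (s :: c) -> srt (s :: c) (s * w) L F ->
  s \in S -> ~ inv w (alpha s) ->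
  (forall r, des (s * w) r -> act (s * w) (alpha r) = - alpha s \/
     (act (s * w) (alpha r) s = 0 /\ bil (alpha s) (act (s * w) (alpha r)) = 0)) ->
  forall x, inv w x -> bil (alpha s) x = 0.
Proof.
move=> W h sS nw H; pose J := [pred b | (b == s) || (kf s b == 0)].
have HJ : forall x, inv (s * w) x -> supp J x.
  apply: cov_supp => r dr; case: (H r dr) => [->|[x0 b0]].
    by rewrite suppN supp_alpha // inE eqxx.
  set x := act _ _ in x0 b0 *; have sx : supp (mem (s :: c)) (- x).
    exact/(srt_supp h)/inv_des.
  have px : pos (- x) by apply: des_neg.
  have := bil_alpha_supp W sx; rewrite bilNr b0 oppr0 oppE x0 oppr0 mulr0 add0r => /esym q0.
  rewrite -suppN; apply/suppP => b; rewrite inE negb_or => /andP[bs kb].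
  have [bc|bc] := boolP (b \in c).
    by have /eqP := sum_head_eq0 W px q0 bc; rewrite mulf_eq0 (negbTE kb) orbF => /eqP.
  by move/suppP: sx; apply; change (b \notin s :: c); rewrite inE negb_or bs.
move=> x hx; have hy : inv (s * w) (refl s x) by apply/(inv_mul _ sS nw); right; rewrite refl_inv.
have sy := srt_supp h hy; have Jy := HJ _ hy.
set y := refl s x in hy sy Jy; have ex : x = refl s y by rewrite refl_inv.
have by2 : bil (alpha s) y = 2 * y s.
  rewrite (bil_alpha_supp W sy) big_seq big1 ?addr0 // => b bc.
  have [kb|kb] := eqVneq (kf s b) 0; first by rewrite kb mulr0.
  rewrite (supp_notin Jy) ?mul0r // inE negb_or kb andbT.
  by move: W; rewrite wf_cons => /andP[sc _]; apply: contraNneq sc => <-.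
have y0 : 0 <= y s by case: hy => _ /posP.
have x0 : 0 <= x s by case: hx => _ /posP.
rewrite ex -[alpha s]opprK -refl_self // bilNl bil_refl ?invol // by2.
move: x0; rewrite {1}ex reflE eqxx by2 => x0.
move: (y s) y0 x0 => k k0; rewrite mulr1 => k1; lra.
Qed.

Lemma Srt_prod_des c w l : wf c -> Srt c w ->
  (forall a b, des w a -> des w b -> (a * b = b * a)%g) ->
  uniq l -> {in l, forall a, des w a} -> Srt c (w * prodw l).
Proof.
move=> W [L [F h]]; elim: h W l => [|{}s {}c {}w {}L {}F sS nw h IH|{}s {}c {}w {}L {}F sS nw h IH] W l hc ul hl.
- case: l ul hl => [_ _|a l _ /(_ a (mem_head _ _))/inv_des/inv1 //].
  by rewrite prodw_nil mulg1; do 2!eexists; apply: srt_nil.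
- have W' : wf (rcons c s) by rewrite wf_rcons.
  have sc : s \notin c by move: W; rewrite wf_cons => /and3P[].
  have hcw a b : des w a -> des w b -> (a * b = b * a)%g.
    by move=> da db; apply: hc; apply: des_mul.
  have [hl'|] := boolP (all (fun a => des w a) l).
    have lw a : a \in l -> des w a by move/allP: hl'; apply.
    rewrite -mulgA; apply: Srt_take => //; last exact: IH.
    by move/(inv_prod_des _ ul lw) => []// a b al bl; apply: hcw; apply: lw.
  (* A descent of [s * w] that [w] lacks has cover root [alpha s]. The others commute with it, so
     the inversions of [w] are orthogonal to [alpha s] and [j] is [s], which commutes with [w];
     dropping it turns the taken [s] into a skipped one. *)
  case/allPn => j jl ndj; have dj := hl _ jl; have jS := des_S dj.
  have ej := ndes_mul sS dj ndj.
  have ej' : act (s * w) (alpha j) = - alpha s by rewrite actM ej (act_gen _ sS) refl_self.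
  have hs : srt (s :: c) (s * w) _ _ := srt_take sS nw h.
  have fix_ : forall x, inv w x -> bil (alpha s) x = 0.
    apply: (inv_take_fix W hs sS nw) => r dr.
    have [->|rj] := eqVneq r j; [by left|right].
    have jr : j != r by rewrite eq_sym.
    split; first exact: (init_cover W hs dj dr jr ej').
    rewrite -[alpha s]opprK -ej' bilNl act_bil bil_alpha kf_comm ?oppr0 // ?(des_S dr) //.
    exact: hc.
  have [fw w0] := perp_fix fix_ sS.
  have js : j = s by apply: alpha_inj; rewrite -(actK w (alpha j)) ej -{1}fw actK.
  have cw := act_simple sS sS fw.
  have hcl : {in l &, forall a b, (a * b = b * a)%g} by move=> a b al bl; apply: hc; apply: hl.
  have sl : s \in l by rewrite -js.
  rewrite (prodw_rem sl hcl) mulgA -(mulgA s) cw involK //.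
  have lw : {in rem s l, forall a, des w a}.
    move=> a; rewrite mem_rem_uniq // inE => /andP[as_ al].
    apply/negPn/negP => nda; have := ndes_mul sS (hl _ al) nda.
    rewrite -[in RHS]fw => e; case/negP: as_; apply/eqP/alpha_inj.
    by rewrite -(actK w (alpha a)) e actK.
  have ul' : uniq (rem s l) by apply: rem_uniq.
  have hsub x : inv (w * prodw (rem s l)) x -> inv w x.
    by move/(inv_prod_des _ ul' lw) => []// a b al bl; apply: hcw; apply: lw.
  apply: Srt_skip => //; first by move/hsub.
  by apply: (Srt_last W) => [|x /hsub/w0 //]; apply: IH.
- move: (W); rewrite wf_cons => /and3P[_ _ Wc].
  apply: Srt_skip => //; last exact: IH.
  by move/(inv_prod_des _ ul hl) => []// a b al bl; apply: hc; apply: hl.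
Qed.

Lemma des_neq w r : des w r -> (w * r)%g <> w.
Proof. by case/andP=> _ h e; rewrite e ltnn in h. Qed.

Lemma wsub_between w r z : des w r -> wsub (w * r) z -> wsub z w -> z = (w * r)%g \/ z = w.
Proof.
move=> dr h1 h2; have [hz|hz] := pselect (inv z (- act w (alpha r))).
  right; apply: wsub_anti => // x hx.
  by have [->//|/eqP ne] := eqVneq x (- act w (alpha r)); apply/h1/(inv_mulr _ dr).
by left; apply: wsub_anti => //; apply: wsub_desN.
Qed.

Lemma covered_des P w r : P w -> P (w * r)%g -> des w r -> covered P le (w * r)%g w.
Proof.
move=> Pw Pr dr; split=> //; first exact/weak_leP/wsub_des.
  exact: des_neq.
by move=> z _ /weak_leP h1 /weak_leP h2; apply: wsub_between.
Qed.

Lemma des_covered P w y : (forall r, des w r -> P (w * r)%g) -> covered P le y w ->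
  exists r, des w r /\ y = (w * r)%g.
Proof.
move=> Pr [Py Pw /weak_leP yw ne cov]; have [r [dr yr]] := wsub_lower yw ne.
exists r; split=> //; case: (cov _ (Pr _ dr)) => [||-> //|e].
- exact/weak_leP.
- exact/weak_leP/wsub_des.
- by case: (des_neq dr).
Qed.

(** Stated for any [P] containing the weak lower covers of [w], which are then also the covers in
    [P]; so it evaluates both pops. *)
Lemma pop_eq (P : gT -> Prop) w q z : P w -> P q -> (forall r, des w r -> P (w * r)%g) ->
  (forall x, inv q x <-> inv w x /\ forall r, des w r -> x <> - act w (alpha r)) ->
  is_pop P le w z -> z = q.
Proof.
move=> Pw Pq Pr iq [Pz lz gz].
have zr r : des w r -> wsub z (w * r).
  by move=> dr; apply/weak_leP; apply: lz; right; apply: covered_des => //; apply: Pr.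
apply: wsub_anti.
  move=> x hx; apply/iq; split; last by move=> r dr; have /(inv_mulr _ dr)[] := zr _ dr _ hx.
  by have /weak_leP h := lz w (or_introl erefl); apply: h.
apply/weak_leP; apply: gz => // a [->|/(des_covered Pr)[r [dr ->]]]; apply/weak_leP.
  by move=> x /iq[].
by move=> x /iq[h1 h2]; apply/(inv_mulr _ dr); split=> //; apply: h2.
Qed.

Definition deslist w := [seq a <- enum S | des w a].

Lemma mem_deslist w a : (a \in deslist w) = des w a.
Proof. by rewrite mem_filter mem_enum andb_idr // => /des_S. Qed.

Lemma deslist_uniq w : uniq (deslist w).
Proof. by rewrite filter_uniq // enum_uniq. Qed.

Section Commuting.
Variables (w : gT).
Hypothesis comm : forall a b, des w a -> des w b -> (a * b = b * a)%g.

Lemma inv_bottom x : inv (w * prodw (deslist w)) x <->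
  inv w x /\ forall r, des w r -> x <> - act w (alpha r).
Proof.
rewrite inv_prod_des ?deslist_uniq //; last first.
- by move=> a b; rewrite !mem_deslist; apply: comm.
- by move=> a; rewrite mem_deslist.
split=> -[h1 h2]; split=> // a ha; apply: h2; first by rewrite mem_deslist.
by rewrite -mem_deslist.
Qed.

Lemma inv_part (l : seq gT) x : uniq l -> {in l, forall a, des w a} ->
  inv (w * prodw l) x <-> inv w x /\ forall a, a \in l -> x <> - act w (alpha a).
Proof.
by move=> ul hl; apply: inv_prod_des => // a b al bl; apply: comm; apply: hl.
Qed.

Lemma between_bottom y : wsub (w * prodw (deslist w)) y -> wsub y w ->
  exists l, [/\ uniq l, {in l, forall a, des w a} & y = (w * prodw l)%g].
Proof.
move=> h1 h2; pose p a := ~~ `[< inv y (- act w (alpha a)) >].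
exists (filter p (deslist w)); have hl : {in filter p (deslist w), forall a, des w a}.
  by move=> a; rewrite mem_filter mem_deslist => /andP[].
have ul : uniq (filter p (deslist w)) by rewrite filter_uniq // deslist_uniq.
split=> //; apply: inv_eq => x; rewrite inv_part //; split=> [hx|[hx hn]].
  split; first exact: h2.
  move=> a; rewrite mem_filter => /andP[/asboolPn ny _] e; apply: ny.
  by rewrite -e.
have [[r [dr e]]|H] := pselect (exists r, des w r /\ x = - act w (alpha r)).
  apply: contrapT => ny; apply: (hn r _ e).
  by rewrite mem_filter mem_deslist dr andbT; apply/asboolPn; rewrite -e.
by apply: h1; apply/inv_bottom; split=> // r dr e; apply: H; exists r.
Qed.

(** An element of the interval is determined by the cover roots of [w] that it keeps, and every set
    of them occurs. *)
Lemma boolean_bottom : boolean_lattice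
  (interval (@Weak gT) le (w * prodw (deslist w))%g w) le.
Proof.
pose D : {set gT} := [set a | des w a].
have dD (i : 'I_#|D|) : des w (enum_val i) by have := enum_valP i; rewrite inE.
pose f y : {set 'I_#|D|} := [set i | `[< inv y (- act w (alpha (enum_val i))) >]].
have inf y (i : 'I_#|D|) : reflect (inv y (- act w (alpha (enum_val i)))) (i \in f y).
  by rewrite inE; apply: asboolP.
have Dr r : des w r -> exists i : 'I_#|D|, r = enum_val i.
  move=> dr; have rD : r \in D by rewrite inE.
  by exists (enum_rank_in rD r); rewrite enum_rankK_in.
have mono x y : interval (@Weak gT) le (w * prodw (deslist w))%g w x ->
    interval (@Weak gT) le (w * prodw (deslist w))%g w y -> f x \subset f y -> wsub x y.
  move=> [_ /weak_leP bx /weak_leP xw] [_ /weak_leP by_ /weak_leP yw] /subsetP sub z hz.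
  have [[r [dr e]]|H] := pselect (exists r, des w r /\ z = - act w (alpha r)).
    have [i ei] := Dr _ dr; rewrite e ei; apply/inf/sub/inf.
    by rewrite -ei -e.
  by apply: by_; apply/inv_bottom; split=> [|r dr e]; [apply: xw|apply: H; exists r].
exists #|D|, f; split.
- by move=> x y hx hy e; apply: wsub_anti; apply: mono; rewrite // e.
- move=> A; pose l := [seq enum_val i | i <- enum (~: A)].
  have hl : {in l, forall a, des w a} by move=> a /mapP[i _ ->].
  have ul : uniq l by rewrite map_inj_uniq ?enum_uniq //; apply: enum_val_inj.
  exists (w * prodw l)%g; split.
    split=> //; apply/weak_leP => x; last by move/(inv_part _ ul hl) => [].
    move/inv_bottom => [h1 h2]; apply/(inv_part _ ul hl); split=> // a /hl; exact: h2.
  apply/setP => i; apply/inf/idP => [/(inv_part _ ul hl)[_ h]|iA].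
    apply: contraT => iA; case: (h (enum_val i)) => //.
    by apply: map_f; rewrite mem_enum inE.
  apply/(inv_part _ ul hl); split; first exact: inv_des.
  move=> a /mapP[j]; rewrite mem_enum inE => jA -> /oppr_inj e.
  have : enum_val i = enum_val j.
    by apply: alpha_inj; rewrite -(actK w (alpha (enum_val i))) e actK.
  by move=> /enum_val_inj ij; rewrite -ij iA in jA.
- move=> x y hx hy; split=> [/weak_leP h|h]; last exact/weak_leP/mono.
  by apply/subsetP => i /inf/h/inf.
Qed.

End Commuting.

(** * Noncommuting descents: pentagons *)

Lemma scale_coef w a b : des w a -> des w b -> (a * b <> b * a)%g ->
  exists k : R, [/\ 0 < k, des (w * b) a, des (w * a) b,
   - act (w * b) (alpha a) = - act w (alpha a) + k *: - act w (alpha b) &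
   - act (w * a) (alpha b) = - act w (alpha b) + k *: - act w (alpha a)].
Proof.
move=> da db nc; have aS := des_S da; have bS := des_S db.
have ab : a != b by apply/eqP => e; apply: nc; rewrite e.
(* This is [2 cos (pi / m)], where [m > 2] because the letters do not commute. *)
exists (- kf a b); have k0 : 0 < - kf a b.
  rewrite oppr_gt0 lt_neqAle kf_le0 ?invol // andbT kf_eq0 ?invol //.
  exact/eqP.
have e1 : - act (w * b) (alpha a) = - act w (alpha a) + (- kf a b) *: - act w (alpha b).
  rewrite actM (act_gen _ bS) /refl bil_alpha actB actZ kfC.
  by apply/ffunP => x; rewrite !vE; ring.
have e2 : - act (w * a) (alpha b) = - act w (alpha b) + (- kf a b) *: - act w (alpha a).
  rewrite actM (act_gen _ aS) /refl bil_alpha actB actZ.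
  by apply/ffunP => x; rewrite !vE; ring.
split=> //; apply: desI => //; rewrite ?e1 ?e2; apply: posD; rewrite ?des_neg //.
all: by apply: posZ; [apply: ltW|apply: des_neg].
Qed.

Lemma noncomm_weak w pW a b : is_pop (@Weak gT) le w pW -> des w a -> des w b ->
  (a * b <> b * a)%g -> ~ distributive_lattice (interval (@Weak gT) le pW w) le.
Proof.
move=> [_ lW gW] da db nc.
have [k [k0 dba dab e1 e2]] := scale_coef da db nc.
have ab : a != b by apply/eqP => e; apply: nc; rewrite e.
set mid := - act (w * b) (alpha a) in e1.
have inva : inv w (- act w (alpha a)) by apply: inv_des.
have invb : inv w (- act w (alpha b)) by apply: inv_des.
(* Such a [u] contains neither cover root, hence not their nonnegative combination [mid], the only
   root by which [w * b] exceeds [w * b * a]. *)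
have low u : wsub u (w * a) -> wsub u (w * b) -> wsub u (w * b * a).
  move=> ua ub; apply: wsub_desN => //; apply: (ninv_closed (x := - act w (alpha a)) (y := - act w (alpha b)) (c := 1) (d := k)).
  - exact: inv_root inva.
  - exact: inv_root invb.
  - exact: inv_pos inva.
  - exact: inv_pos invb.
  - by move/ua/(inv_mulr _ da) => [].
  - by move/ub/(inv_mulr _ db) => [].
  - exact: ler01.
  - exact: ltW.
  by rewrite scale1r.
have cov r : des w r -> wsub pW (w * r).
  by move=> dr; apply/weak_leP; apply: lW; right; apply: covered_des.
have ne : - act w (alpha a) <> mid.
  rewrite e1 => /eqP; rewrite -subr_eq0 opprD addNKr scalerN opprK scaler_eq0.
  rewrite (gt_eqF k0) /= => /eqP h; have := root_neq0 (root_act w (root_alpha (des_S db))).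
  by rewrite h eqxx.
have ne2 : - act w (alpha a) <> - act w (alpha b).
  by move=> /oppr_inj h; case/eqP: ab; apply: alpha_inj; rewrite -(actK w (alpha a)) h actK.
have iy1 : inv (w * b * a) (- act w (alpha a)).
  by apply/(inv_mulr _ dba); split=> //; apply/(inv_mulr _ db).
apply: (@pentagon _ (w * b * a)%g (w * b)%g (w * a)%g w).
- split=> //; apply/weak_leP; first by apply: low; apply: cov.
  by move=> x /(wsub_des dba)/(wsub_des db).
- by split=> //; apply/weak_leP; [apply: cov|apply: wsub_des].
- by split=> //; apply/weak_leP; [apply: cov|apply: wsub_des].
- by split=> //; [apply: lW; left|apply: weak_refl].
- exact/weak_leP/wsub_des.
- exact/weak_leP/wsub_des.
- exact/weak_leP/wsub_des.
- exact: des_neq.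
- move=> u [_ _ /weak_leP uw] /weak_leP y1u /weak_leP zu.
  case: (wsub_between da zu uw) => // e; exfalso.
  by have := y1u _ iy1; rewrite e => /(inv_mulr _ da)[].
- by move=> u _ /weak_leP h1 /weak_leP h2; apply/weak_leP; apply: low.
Qed.

(** Otherwise [w * r] would skip its first letter [a], whereas its cover root for [t] has a positive
    [a]-coordinate by [scale_coef]. *)
Lemma noncomm_sortable1 a c w r t : wf (a :: c) -> Srt (a :: c) (w * r) -> des w r ->
  des w t -> (r * t <> t * r)%g -> - act w (alpha r) <> alpha a.
Proof.
move=> W h dr dt nc e; have [k [k0 _ drt _ e2]] := scale_coef dr dt nc.
have na : ~ inv (w * r) (alpha a) by rewrite -e => /(inv_mulr _ dr)[].
have sc : a \notin c by move: W; rewrite wf_cons => /and3P[].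
have := Srt_supp (Srt_skipV h na) (inv_des drt).
move=> /supp_notin /(_ sc); rewrite e2 e !vE eqxx mulr1 => h0.
have := posP _ (des_neg dt) a; rewrite oppE => h1.
by have := ltr_wpDl h1 k0; rewrite h0 ltxx.
Qed.

(** Letters are stripped from the front: by [noncomm_sortable1] neither cover root is the first
    simple root, so both descents persist down to the identity, which has none. *)
Lemma noncomm_sortable c w r t : wf c -> Srt c w -> des w r -> des w t ->
  (r * t <> t * r)%g -> Srt c (w * r) -> Srt c (w * t) -> False.
Proof.
move=> W [L [F h]]; elim: h W => [|{}s {}c {}w {}L {}F sS nw h IH|{}s {}c {}w {}L {}F sS nw h IH] W dr dt nc hr ht.
- by move/inv_des/inv1: dr.
- have W' : wf (rcons c s) by rewrite wf_rcons.
  have nr := noncomm_sortable1 W hr dr dt nc.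
  have nt := noncomm_sortable1 W ht dt dr (nesym nc).
  have hs : inv (s * w) (alpha s) by apply/(inv_mul _ sS nw); left.
  have step u : des (s * w) u -> - act (s * w) (alpha u) <> alpha s -> Srt (s :: c) (s * w * u) ->
      des w u /\ Srt (rcons c s) (w * u).
    move=> du nu hu; split.
      apply/negPn/negP => ndu; apply: nu.
      by rewrite actM (ndes_mul sS du ndu) (act_gen _ sS) refl_self // opprK.
    have hi : inv (s * w * u) (alpha s) by apply/(inv_mulr _ du); split=> // e; apply: nu.
    by have := Srt_takeV hu hi; rewrite -mulgA involK.
  have [dr' hr'] := step _ dr nr hr; have [dt' ht'] := step _ dt nt ht.
  exact: IH.
- move: (W); rewrite wf_cons => /and3P[_ _ Wc].
  by apply: (IH Wc dr dt nc); [apply: Srt_skipV hr _|apply: Srt_skipV ht _] => /wsub_des; 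
    move=> /(_ _) h'; apply: nw; apply: h'.
Qed.

(** [z] is the largest sortable element below [w * r]. The element from [cover_sep] lies below it
    and keeps all other cover roots, so [w * r] is the only weak lower cover of [w] above [z], and
    no sortable element fits strictly between [z] and [w]. *)
Lemma Srt_meet_cover c w r : wf c -> Srt c w -> des w r -> exists z : gT,
  [/\ covered (Srt c) le z w, wsub z (w * r),
   (forall u, Srt c u -> wsub u (w * r) -> wsub u z) &
   forall t, des w t -> t != r -> inv z (- act w (alpha t))].
Proof.
move=> W hw dr; have [z [hz zr zm]] := max_sortable (w * r)%g W.
have [u [hu uw nu ut]] := cover_sep W hw dr.
have uz : wsub u z by apply: zm => //; apply: wsub_desN.
exists z; split=> //; last by move=> t dt tr; apply: uz; apply: ut.
split=> //.
- by apply/weak_leP => x /zr/(wsub_des dr).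
- by move=> e; have := zr _; rewrite e => /(_ _ (inv_des dr)) /(inv_mulr _ dr)[].
move=> v hv /weak_leP zv /weak_leP vw.
have [->|/eqP ne] := eqVneq v w; [by right|left].
have [t [dt vt]] := wsub_lower vw ne.
have [e|tr] := eqVneq t r; last first.
  by have := vt _ (zv _ (uz _ (ut _ dt tr))) => /(inv_mulr _ dt)[].
by apply: wsub_anti => //; apply: zm; rewrite -?e.
Qed.

(** The pentagon consists of [w] and the projections [y1], [y2], [z] of [w * b * a], [w * b],
    [w * a], where [a] is the descent whose cover root is read first. The danger is that [y1] and
    [y2] coincide; the root [mid] separates them. *)
Lemma noncomm_camb c w pC a b : wf c -> Srt c w -> is_pop (Srt c) le w pC ->
  des w a -> des w b -> (a * b <> b * a)%g ->
  ~ distributive_lattice (interval (Srt c) le pC w) le.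
Proof.
move=> W hw hpop; have [L [F h]] := hw.
have main : forall a b L1 L2, des w a -> des w b -> (a * b <> b * a)%g ->
    L = L1 ++ - act w (alpha a) :: L2 -> - act w (alpha b) \in L2 ->
    ~ distributive_lattice (interval (Srt c) le pC w) le.
  move=> {}a {}b L1 L2 da db nc eL bL2; have [hC lC gC] := hpop.
  have [k [k0 dba dab e1 e2]] := scale_coef da db nc.
  have ab : a != b by apply/eqP => e; apply: nc; rewrite e.
  set mid := - act (w * b) (alpha a) in e1.
  have inva : inv w (- act w (alpha a)) by apply: inv_des.
  have invb : inv w (- act w (alpha b)) by apply: inv_des.
  have imid : inv (w * b) mid by apply: inv_des.
  have rmid : root mid := inv_root imid.
  have nmid u : ~ inv u (- act w (alpha a)) -> ~ inv u (- act w (alpha b)) -> ~ inv u mid.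
    move=> ua ub; apply: (ninv_closed (x := - act w (alpha a)) (y := - act w (alpha b)) (c := 1) (d := k)) => //; try exact: ltW.
    - exact: inv_root inva.
    - exact: inv_root invb.
    - exact: inv_pos inva.
    - exact: inv_pos invb.
    by rewrite scale1r.
  have ymid u : inv u (- act w (alpha a)) -> inv u (- act w (alpha b)) -> inv u mid.
    move=> ua ub; apply: (inv_closed (c := 1) (d := k) ua ub) => //; first exact: ltW.
    by rewrite scale1r.
  have low u : wsub u (w * a) -> wsub u (w * b) -> wsub u (w * b * a).
    move=> ua ub; apply: wsub_desN => //; apply: nmid.
      by move/ua/(inv_mulr _ da) => [].
    by move/ub/(inv_mulr _ db) => [].
  have uL := srt_uniq h; rewrite eL in uL.
  have [L3 [L4 eL2]] : exists L3 L4, L2 = L3 ++ - act w (alpha b) :: L4.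
    by case/splitPr: bL2 => L3 L4; exists L3, L4.
  (* Four prefixes of the reading order: just before and just after the root of [a], just before and
     just after that of [b]. The first contains neither root, hence not [mid]; the last contains
     both, hence [mid]. So [mid] is read strictly between the two. *)
  have [u0 [hu0 iu0]] := srt_prefix W h eL.
  have [u1 [hu1 iu1]] : exists u, Srt c u /\ forall x, inv u x <-> x \in rcons L1 (- act w (alpha a)).
    by apply: (srt_prefix (L2 := L2) W h); rewrite eL cat_rcons.
  have [u2 [hu2 iu2]] : exists u, Srt c u /\ forall x, inv u x <-> x \in L1 ++ - act w (alpha a) :: L3.
    by apply: (srt_prefix (L2 := - act w (alpha b) :: L4) W h); rewrite eL eL2 -catA.
  have [u3 [hu3 iu3]] : exists u, Srt c u /\ forall x, inv u x <-> x \in rcons (L1 ++ - act w (alpha a) :: L3) (- act w (alpha b)).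
    by apply: (srt_prefix (L2 := L4) W h); rewrite eL eL2 cat_rcons -catA.
  have subw u Lu : (forall x, inv u x <-> x \in Lu) -> {subset Lu <= L} -> wsub u w.
    by move=> iu sL x /iu/sL/(srt_invP h).
  have u1w : wsub u1 w.
    apply: subw iu1 _ => x; rewrite mem_rcons eL mem_cat !inE => /orP[->|->]; by rewrite ?orbT.
  have u2w : wsub u2 w.
    apply: subw iu2 _ => x; rewrite eL eL2 !(mem_cat, inE) => /orP[->|/orP[->|->]]; by rewrite ?orbT.
  have nab : - act w (alpha a) <> - act w (alpha b).
    by move=> /oppr_inj e; case/eqP: ab; apply: alpha_inj; rewrite -(actK w (alpha a)) e actK.
  move: uL; rewrite eL2 cat_uniq /= mem_cat inE !negb_or has_cat /= !negb_or -!andbA.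
  move=> /and5P[_ aL1 _ bL1 /and5P[_ aL3 _ _]] uL4.
  have u0a : ~ inv u0 (- act w (alpha a)) by move/iu0; apply/negP.
  have u0b : ~ inv u0 (- act w (alpha b)) by move/iu0; apply/negP.
  have nem : mid <> - act w (alpha a).
    move/eqP; rewrite e1 -subr_eq0 addrC addKr scalerN oppr_eq0 scaler_eq0.
    rewrite (gt_eqF k0) /= => /eqP h'; have := root_neq0 (root_act w (root_alpha (des_S db))).
    by rewrite h' eqxx.
  have nemb : mid <> - act w (alpha b) by move=> e; have := imid; rewrite e => /(inv_mulr _ db)[].
  have u1b : ~ inv u1 (- act w (alpha b)).
    move/iu1; rewrite mem_rcons inE => /orP[/eqP e|]; last exact/negP.
    by apply: nab.
  have u1m : ~ inv u1 mid.
    move/iu1; rewrite mem_rcons inE => /orP[/eqP //|]; move/iu0; exact: nmid.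
  have u1a : inv u1 (- act w (alpha a)) by apply/iu1; rewrite mem_rcons mem_head.
  have u2b : ~ inv u2 (- act w (alpha b)).
    move/iu2; rewrite mem_cat inE => /or3P[|/eqP e|]; try exact/negP.
      by apply: nab.
    move: uL4; rewrite cat_uniq /= => /and3P[_]; rewrite negb_or => /andP[h1 _] _ h2.
    by rewrite h2 in h1.
  have u2m : inv u2 mid.
    apply/iu2; have : inv u3 mid.
      apply: ymid; apply/iu3; rewrite mem_rcons inE ?eqxx ?mem_cat ?mem_head ?orbT //.
    by move/iu3; rewrite mem_rcons inE => /orP[/eqP|].
  have [z [cz za zm zt]] := Srt_meet_cover W hw da.
  have [y2 [cy2 y2b y2m y2t]] := Srt_meet_cover W hw db.
  have [y1 [hy1 y1b y1m]] := max_sortable (w * b * a)%g W.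
  have Cz : wsub pC z by apply/weak_leP; apply: lC; right.
  have Cy2 : wsub pC y2 by apply/weak_leP; apply: lC; right.
  have y1w : wsub y1 w by move=> x /y1b/(wsub_des dba)/(wsub_des db).
  have [Pz _ /weak_leP zw _ _] := cz; have [Py2 _ /weak_leP y2w _ _] := cy2.
  (* [u1] contains the root of [a] but neither [mid] nor the root of [b], so it lies below
     [w * b * a]; [u2] contains [mid] and lies below [w * b]. *)
  have u1y1 : wsub u1 y1 by apply: y1m => //; do 2?apply: wsub_desN.
  have u2y2 : wsub u2 y2 by apply: y2m => //; apply: wsub_desN.
  apply: (@pentagon _ y1 y2 z w).
  - split=> //; apply/weak_leP => //; apply: y1m => //.
    by apply: low => x; [move/Cz/za|move/Cy2/y2b].
  - by split=> //; apply/weak_leP.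
  - by split=> //; apply/weak_leP.
  - by split=> //; [apply: lC; left|apply: weak_refl].
  - by apply/weak_leP; apply: y2m => // x /y1b/(wsub_des dba).
  - exact/weak_leP.
  - exact/weak_leP.
  - move=> e; have := u2y2 _ u2m; rewrite -e => /y1b/(inv_mulr _ dba)[_]; exact.
  - move=> u [hu _ /weak_leP uw] /weak_leP y1u /weak_leP zu.
    apply: contrapT => ne; have [t [dt ut]] := wsub_lower uw ne.
    have [e|ta] := eqVneq t a.
      by have := ut _ (y1u _ (u1y1 _ u1a)); rewrite e => /(inv_mulr _ da)[].
    by have := ut _ (zu _ (zt _ dt ta)) => /(inv_mulr _ dt)[].
  - move=> u [hu _ _] /weak_leP h1 /weak_leP h2; apply/weak_leP; apply: y1m => //.
    by apply: low => x; [move/h2/za|move/h1/y2b].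
move=> da db nc.
have aL : - act w (alpha a) \in L by apply/(srt_invP h)/inv_des.
have bL : - act w (alpha b) \in L by apply/(srt_invP h)/inv_des.
have [L1 [L2 eL]] : exists L1 L2, L = L1 ++ - act w (alpha a) :: L2.
  by case/splitPr: aL => L1 L2; exists L1, L2.
move: (bL); rewrite {1}eL mem_cat inE => /or3P[bL1|/eqP e|bL2].
- have [L3 [L4 eL1]] : exists L3 L4, L1 = L3 ++ - act w (alpha b) :: L4.
    by case/splitPr: bL1 => L3 L4; exists L3, L4.
  apply: (main b a L3 (L4 ++ - act w (alpha a) :: L2) db da (nesym nc)).
    by rewrite eL eL1 -catA.
  by rewrite mem_cat mem_head orbT.
- case: nc; suff -> : b = a by [].
  by apply: alpha_inj; rewrite -(actK w (alpha b)) (oppr_inj e) actK.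
- exact: (main a b L1 L2 da db nc).
Qed.

Implicit Types (p q : seq nat).

(** * Positions in the infinite word *)

Lemma one_notin_S : (1 \notin S)%g.
Proof. by case: HS. Qed.

Lemma letter_rot s c i : letter (s :: c) i.+1 = letter (rcons c s) i.
Proof.
rewrite /letter size_rcons /= modnS; have := ltn_pmod i (ltn0Sn (size c)).
case: ifP => [d|d] h.
  have -> : (i %% (size c).+1)%N = size c.
    have : (i.+1 %% (size c).+1 == 0)%N by [].
    rewrite -addn1 -modnDml; move: h; set m := (i %% _)%N => h.
    have [//|ne] := eqVneq m (size c); rewrite modn_small; last by lia.
    by rewrite addn1.
  by rewrite nth_rcons ltnn eqxx.
have ne : (i %% (size c).+1)%N != size c.
  apply/eqP => e; move: d; rewrite /dvdn -addn1 -modnDml e addn1 modnn.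
  by [].
by rewrite nth_rcons; case: ltnP => //; move: h ne; move: (_ %% _)%N => m; lia.
Qed.

Lemma letter0 s c : letter (s :: c) 0 = s.
Proof. by rewrite /letter mod0n. Qed.

Lemma map_letter_rot s c p :
  [seq letter (s :: c) i | i <- [seq i.+1 | i <- p]] = [seq letter (rcons c s) i | i <- p].
Proof. by rewrite -map_comp; apply: eq_map => i /=; rewrite letter_rot. Qed.

Lemma sorted_succ p : sorted ltn [seq i.+1 | i <- p] = sorted ltn p.
Proof. by rewrite sorted_map. Qed.

Lemma succ_pred p : 0%N \notin p -> p = [seq i.+1 | i <- [seq i.-1 | i <- p]].
Proof.
move=> h; rewrite -map_comp -[LHS]map_id; apply/eq_in_map => i ip /=.
by case: i ip => // ip; rewrite ip in h.
Qed.

Lemma sorted_cons0 p : sorted ltn (0%N :: p) -> 0%N \notin p.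
Proof.
move=> /= h; have := order_path_min ltn_trans h.
by move/allP=> a; apply/negP => /a.
Qed.

Lemma sorted_mem0 p : sorted ltn p -> 0%N \in p -> exists p1, p = 0%N :: [seq i.+1 | i <- p1].
Proof.
case: p => // i p h; rewrite inE => /orP[/eqP e|hp]; last first.
  have := order_path_min ltn_trans h => /allP /(_ _ hp).
  by rewrite ltn0.
rewrite -e in h *; exists [seq i.-1 | i <- p].
by rewrite -succ_pred // sorted_cons0.
Qed.

(* On positions, the inclusions of consecutive blocks say that a letter used in
   one copy of [c] is used in the previous one. *)
Definition nested (n : nat) p := forall i, i \in p -> (n <= i)%N -> (i - n)%N \in p.

Lemma nested_mod n p i : nested n p -> i \in p -> (i %% n)%N \in p.
Proof.
move=> H; elim/ltn_ind: i => i IH ip; case: (posnP n) => [->|n0]; first by rewrite modn0.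
have [h|h] := ltnP i n; first by rewrite modn_small.
have -> : (i %% n = (i - n) %% n)%N by rewrite -{1}(subnK h) modnDr.
by apply: IH; [rewrite ltn_subrL n0 (leq_trans n0) | apply: H].
Qed.

Lemma nested_succ n p : nested n [seq i.+1 | i <- p] -> nested n p.
Proof.
move=> H i ip ni; have := H i.+1; rewrite mem_map; last exact: succn_inj.
by move=> /(_ ip (leqW ni)); rewrite subSn // mem_map //; exact: succn_inj.
Qed.

Lemma letter_mod c i : letter c (i %% size c) = letter c i.
Proof. by rewrite /letter modn_mod. Qed.

Lemma wf_filter P c : wf c -> wf (filter P c).
Proof.
case/andP=> u /allP a; apply/andP; rewrite filter_uniq //; split=> //.
by apply/allP => x; rewrite mem_filter => /andP[_ /a].
Qed.

(** [X] holds the letters already dropped: [srt] deletes a skipped letter from its word, whereas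
    positions always refer to the full word, which is only rotated. *)
Lemma nested_Srt c (X : seq gT) p : wf c -> sorted ltn p ->
  reduced [seq letter c i | i <- p] -> nested (size c) p ->
  (forall i, i \in p -> letter c i \notin X) ->
  Srt [seq a <- c | a \notin X] (prodw [seq letter c i | i <- p]).
Proof.
have [m] : exists m, all (fun i => i < m)%N p.
  exists (\max_(i <- p) i).+1; apply/allP => i ip; rewrite ltnS.
  exact: leq_bigmax_seq.
elim: m c X p => [|m IH] c X p hm W sp rp np dp.
  case: p hm sp rp np dp => // _ _ _ _ _.
  by rewrite prodw_nil; apply: Srt1; apply: wf_filter.
case: c W rp np dp => [|s c] W rp np dp.
  case: p hm sp rp np dp => [|i p] _ _ rp _ _; first by rewrite prodw_nil; apply: Srt1.
  have [/= /andP[h _] _] := reducedP _ rp.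
  by move: h; rewrite /letter nth_nil (negbTE one_notin_S).
have W' : wf (rcons c s) by rewrite wf_rcons.
have sc : s \notin c by move: W; rewrite wf_cons => /and3P[].
have sS : s \in S by move: W; rewrite wf_cons => /and3P[].
have hm' p1 : all (fun i => i < m.+1)%N [seq i.+1 | i <- p1] -> all (fun i => i < m)%N p1.
  by rewrite all_map.
have [p0|p0] := boolP (0%N \in p).
  have sX : s \notin X by rewrite -[s](letter0 s c); apply: dp.
  have [p1 ep] := sorted_mem0 sp p0.
  move: hm sp rp np dp; rewrite ep /= letter0 map_letter_rot prodw_cons sX => hm sp.
  move=> /reduced_cons[_ rp na] np dp; apply: Srt_take => //.
  have -> : rcons [seq a <- c | a \notin X] s = [seq a <- rcons c s | a \notin X].
    by rewrite filter_rcons sX.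
  apply: IH => //; first exact: hm'.
  - by have := path_sorted sp; rewrite sorted_succ.
  - move=> i ip ni; have := np i.+1; rewrite !inE mem_map; last exact: succn_inj.
    rewrite size_rcons in ni; move=> /(_ ip (leqW ni)); rewrite subSn // /=.
    by rewrite mem_map ?size_rcons //; exact: succn_inj.
  - by move=> i ip; rewrite -letter_rot; apply: dp; rewrite inE map_f ?orbT.
have ep := succ_pred p0; set p1 := map _ p in ep.
move: hm sp rp np dp; rewrite ep map_letter_rot sorted_succ => hm sp rp np dp.
have modc0 i : i \in p1 -> (i.+1 %% (size c).+1)%N != 0%N.
  move=> ip; apply: contraNneq p0 => e; rewrite ep -e.
  by apply: nested_mod => //; apply: map_f.
have hX i : i \in p1 -> letter (rcons c s) i \notin s :: X.
  move=> ip; rewrite inE negb_or -letter_rot dp ?map_f // andbT.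
  have := modc0 i ip; have := ltn_pmod i.+1 (ltn0Sn (size c)).
  rewrite /letter /=; case: (_ %% _)%N => // k; rewrite ltnS => kc _ /=.
  by apply: contraNneq sc => <-; apply: mem_nth.
have := IH (rcons c s) (s :: X) p1 (hm' _ hm) W' sp rp _ hX.
rewrite size_rcons => /(_ (nested_succ np)).
rewrite filter_rcons inE eqxx /=.
have -> : [seq a <- c | a \notin s :: X] = [seq a <- c | a \notin X].
  by apply: eq_in_filter => a ac; rewrite inE negb_or; case: eqVneq ac sc => // -> ->.
move=> h; case: ifP => // sX; apply: Srt_skip => // hi.
have := Srt_supp h hi => /supp_notin h1.
have /h1 /eqP : s \notin mem [seq a <- c | a \notin X].
  by change (s \notin filter (fun a => a \notin X) c); rewrite mem_filter (negbTE sc) andbF.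
by rewrite alphaE eqxx oner_eq0.
Qed.

Lemma word_letters l s : reduced l -> (forall x, inv (prodw l) x -> x s = 0) -> s \notin l.
Proof.
elim: l => //= a l IH /reduced_cons[aS rl na] H; rewrite prodw_cons in H.
have as_ : s != a.
  have h0 : inv (a * prodw l) (alpha a) by apply/(inv_mul _ aS na); left.
  by apply/eqP => e; have := H _ h0; rewrite alphaE e eqxx => /eqP; rewrite oner_eq0.
rewrite inE negb_or as_ IH // => x hx; rewrite -(refl_neq (a := a)) //.
by apply: H; apply/(inv_mul _ aS na); right; rewrite refl_inv.
Qed.

Definition sorting_spec c w p := [/\ sorted ltn p, reduced [seq letter c i | i <- p],
  prodw [seq letter c i | i <- p] = w, nested (size c) p &
  forall q, sorted ltn q -> reduced [seq letter c i | i <- q] ->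
    prodw [seq letter c i | i <- q] = w -> lex_le p q].

Lemma lex_le_succ p q : lex_le [seq i.+1 | i <- p] [seq i.+1 | i <- q] = lex_le p q.
Proof. by elim: p q => [|i p IH] [|j q] //=; rewrite IH. Qed.

Lemma sorting_spec1 c : sorting_spec c 1 [::].
Proof. by split=> //=; rewrite ?prodw_nil //; apply/reducedP; rewrite prodw_nil ell1. Qed.

(** Every reduced word of [w] avoids [s], so each competitor [q] skips position 0 as well and the
    comparison shifts by one. *)
Lemma sorting_shift s c w p : wf (s :: c) -> (forall x, inv w x -> x s = 0) ->
  sorting_spec (rcons c s) w p -> sorting_spec (s :: c) w [seq i.+1 | i <- p].
Proof.
move=> W w0 [sp rp pw np lp].
have ns q : reduced [seq letter (s :: c) i | i <- q] ->
    prodw [seq letter (s :: c) i | i <- q] = w -> 0%N \notin q.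
  move=> rq pq; have : s \notin [seq letter (s :: c) i | i <- q].
    by apply: word_letters => //; rewrite pq.
  by apply: contra => q0; apply/mapP; exists 0%N; rewrite ?letter0.
split; rewrite ?map_letter_rot ?sorted_succ //.
  move=> i /mapP[j jp ->]; rewrite /= ltnS leq_eqVlt => /orP[/eqP e|lt].
    exfalso; have := word_letters rp; rewrite pw => /(_ s w0) /negP; apply.
    apply/mapP; exists j => //; rewrite /letter size_rcons -e modn_small //.
    by rewrite nth_rcons ltnn eqxx.
  have := np j jp; rewrite size_rcons => /(_ lt) h.
  by rewrite subSS -[(j - size c)%N]prednK ?subn_gt0 // -subnS map_f.
move=> q sq rq pq; have eq := succ_pred (ns q rq pq).
move: sq rq pq; rewrite eq lex_le_succ sorted_succ map_letter_rot; exact: lp.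
Qed.

(** A competitor that skips position 0 is lexicographically larger at once; one that uses it is
    compared after removing it. *)
Lemma sorting_take s c w p : wf (s :: c) -> inv w (alpha s) ->
  sorting_spec (rcons c s) (s * w) p -> sorting_spec (s :: c) w (0%N :: [seq i.+1 | i <- p]).
Proof.
move=> W ws [sp rp pw np lp].
have sS : s \in S by move: W; rewrite wf_cons => /and3P[].
split; rewrite /= ?letter0 ?map_letter_rot.
- case: p sp {rp pw np lp} => //= i p.
  by rewrite -[path ltn i.+1 _]/(sorted ltn [seq j.+1 | j <- i :: p]) sorted_succ.
- by apply/reduced_cons; rewrite pw; split=> //; apply: inv_nmul.
- by rewrite prodw_cons pw involK.
- move=> i; rewrite inE => /orP[/eqP -> //|/mapP[j jp ->]].
  rewrite ltnS leq_eqVlt => /orP[/eqP e|lt]; first by rewrite e subSS subnn mem_head.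
  have := np j jp; rewrite size_rcons => /(_ lt) h.
  by rewrite subSS inE -[(j - size c)%N]prednK ?subn_gt0 // -subnS map_f ?orbT.
move=> q sq rq pq; case: q sq rq pq => [|[|j] q] //=.
  by rewrite prodw_nil => _ _ e; move: ws; rewrite -e => /inv1.
move=> sq; have q0 := sorted_cons0 sq; have sq' := path_sorted sq.
rewrite (succ_pred q0) letter0 map_letter_rot => /reduced_cons[_ rq _].
rewrite prodw_cons lex_le_succ => e; apply: lp => //.
  by rewrite -sorted_succ -succ_pred.
by rewrite -e involK.
Qed.

Lemma Srt_sorting c (X : seq gT) w : wf c -> Srt [seq a <- c | a \notin X] w ->
  exists p, sorting_spec c w p.
Proof.
pose f (X : seq gT) c := [seq a <- c | a \notin X].
move: {2}(ell w + size (f X c))%N (leqnn (ell w + size (f X c))) => n.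
elim: n c X w => [|n IH] c X w len W hw.
  have -> : w = 1%g by apply/eqP; rewrite -ell_eq0 -leqn0; move: len; lia.
  by exists [::]; apply: sorting_spec1.
(* Rotating away a dropped letter at the front lowers neither the length nor the number of remaining
   letters, so an inner induction counts the leading dropped letters. Some letter remains as long as
   [w] is not 1. *)
move: {2}(find [predC X] c) (erefl (find [predC X] c)) => j.
elim: j c len W hw => [|j IHj] c len W hw ej;
  (have [->|w1] := eqVneq w 1%g; first by exists [::]; apply: sorting_spec1);
  (have hc : has [predC X] c
     by rewrite has_filter; apply: contra_neq w1 => e; apply: Srt_nil; rewrite -e; exact: hw);
  case: c ej len W hw hc => // s c ej len W hw hc;
  (have W' : wf (rcons c s) by rewrite wf_rcons);
  (have sS : s \in S by move: W; rewrite wf_cons => /and3P[]);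
  (have sc : s \notin c by move: W; rewrite wf_cons => /and3P[]).
  have sX : s \notin X by move: ej => /=; case: ifP.
  move: hw len; rewrite /f /= sX => hw len.
  have [ws|ws] := pselect (inv w (alpha s)).
    have [p hp] : exists p, sorting_spec (rcons c s) (s * w) p.
      apply: (IH _ X) => //; last by rewrite filter_rcons sX; apply: Srt_takeV.
      rewrite /f filter_rcons sX size_rcons; move: len; rewrite /= (ell_inv sS ws).
      by rewrite addSn ltnS.
    by exists (0%N :: [seq i.+1 | i <- p]); apply: sorting_take.
  have hw' := Srt_skipV hw ws.
  have efX : [seq a <- rcons c s | a \notin s :: X] = [seq a <- c | a \notin X].
    rewrite filter_rcons inE eqxx /=.
    by apply: eq_in_filter => a ac; rewrite inE negb_or; case: eqVneq ac sc => // -> ->.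
  have [p hp] : exists p, sorting_spec (rcons c s) w p.
    apply: (IH _ (s :: X)) => //; last by rewrite efX.
    by rewrite /f efX; move: len; rewrite /= addnS ltnS.
  exists [seq i.+1 | i <- p]; apply: sorting_shift => // x /(Srt_supp hw')/supp_notin; apply.
  by change (s \notin filter (fun a => a \notin X) c); rewrite mem_filter (negbTE sc) andbF.
have sX : s \in X by move: ej => /=; case: ifP => // /negbFE.
have ef : f X (rcons c s) = f X (s :: c) by rewrite /f filter_rcons /= sX.
have hw' : Srt [seq a <- c | a \notin X] w by move: hw; rewrite /= sX.
have [p hp] : exists p, sorting_spec (rcons c s) w p.
  apply: IHj => //; first by rewrite ef.
    by rewrite -/(f _ _) ef.
  move: ej hc => /=; rewrite sX /= => -[e] hc.
  by rewrite -cats1 find_cat hc.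
exists [seq i.+1 | i <- p]; apply: sorting_shift => // x /(Srt_supp hw')/supp_notin; apply.
by change (s \notin filter (fun a => a \notin X) c); rewrite mem_filter (negbTE sc) andbF.
Qed.

Lemma filter_nil c : [seq a <- c | a \notin ([::] : seq gT)] = c.
Proof. by apply/all_filterP/allP. Qed.

Lemma sortableP c w : wf c -> sortable S c w <-> Srt c w.
Proof.
move=> W; split=> [[p [[sp rp pw _] hI]]|hw]; last first.
  have [|p [sp rp pw np lp]] := @Srt_sorting c [::] w W; first by rewrite filter_nil.
  exists p; split=> // k; apply/subsetP => a; rewrite !inE => /mapP[i].
  rewrite mem_filter => /andP[/eqP ik ip] ->.
  have n0 : (0 < size c)%N by case: (size c) ik => //; rewrite divn0.
  have ni : (size c <= i)%N.
    by rewrite leqNgt; apply/negP => lt; rewrite divn_small in ik.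
  apply/mapP; exists (i - size c)%N; last first.
    by rewrite -[LHS]letter_mod -[RHS]letter_mod -{1}(subnK ni) modnDr.
  rewrite mem_filter np // andbT; apply/eqP/succn_inj; rewrite -ik -{2}(subnK ni).
  by rewrite divnDr // divnn n0 addn1.
have := @nested_Srt c [::] p W sp rp; rewrite filter_nil pw; apply=> // i ip ni.
have n0 : (0 < size c)%N.
  (* Over the empty word every letter is the default value 1, which is not in [S]. *)
  case: c {W hI pw ni} rp => // rp; have [/allP h _] := reducedP _ rp.
  have := h _ (map_f (letter [::]) ip); rewrite /letter nth_nil.
  by move=> h1; case/negP: one_notin_S.
have ek : (i %/ size c = (i - size c) %/ size c + 1)%N.
  by rewrite -{1}(subnK ni) divnDr // divnn n0.
have : letter c i \in Iblock c p ((i - size c) %/ size c).+1.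
  rewrite inE; apply/mapP; exists i => //; rewrite mem_filter ip andbT ek addn1.
  exact: eqxx.
move/(subsetP (hI _)); rewrite inE => /mapP[i2]; rewrite mem_filter => /andP[/eqP e2 i2p].
(* The letters of [c] are distinct, so equal letters have equal residues; the block numbers of [i2]
   and [i - size c] agree by [e2], hence so do the positions. *)
move=> e; have em : (i %% size c = i2 %% size c)%N.
  by apply/eqP; rewrite -(nth_uniq 1%g _ _ (proj1 (andP W))) ?ltn_pmod // -/(letter c i) -/(letter c i2) e.
suff <- : i2 = (i - size c)%N by [].
rewrite [LHS](divn_eq _ (size c)) [RHS](divn_eq _ (size c)) e2 -em; congr (_ + _)%N.
by rewrite -[in LHS](subnK ni) modnDr.
Qed.

Lemma coxeter_word_wf c : coxeter_word S c -> wf c.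
Proof.
move=> h; apply/andP; split; first by rewrite (perm_uniq h) enum_uniq.
by apply/allP => a; rewrite (perm_mem h) mem_enum.
Qed.

Lemma pop_equivalences c w pW pC : wf c -> Srt c w ->
  is_pop (@Weak gT) le w pW -> is_pop (Srt c) le w pC ->
  [<-> (forall a b, descent S w a -> descent S w b -> (a * b = b * a)%g);
       distributive_lattice (interval (@Weak gT) le pW w) le;
       boolean_lattice (interval (@Weak gT) le pW w) le;
       distributive_lattice (interval (Srt c) le pC w) le;
       boolean_lattice (interval (Srt c) le pC w) le;
       (forall y, interval (Srt c) le pC w y <-> interval (@Weak gT) le pW w y)].
Proof.
move=> W hw hW hC.
set P1 := forall a b, _; set P2 := distributive_lattice _ _; set P3 := boolean_lattice _ _.
set P4 := distributive_lattice _ _; set P5 := boolean_lattice _ _; set P6 := forall y, _.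
have commE : P1 -> forall a b, des w a -> des w b -> (a * b = b * a)%g.
  by move=> h a b /descentP da /descentP db; apply: h.
have ncP (Q : Prop) : (forall a b, des w a -> des w b -> (a * b <> b * a)%g -> ~ Q) -> Q -> P1.
  by move=> H q a b /descentP da /descentP db; apply: contrapT => nc; apply: (H a b da db nc q).
have eW : P1 -> pW = (w * prodw (deslist w))%g.
  move=> p1; apply: (pop_eq (P := @Weak gT) _ _ _ _ hW) => //; exact: (inv_bottom (commE p1)).
have srtl : P1 -> forall l, uniq l -> {in l, forall a, des w a} -> Srt c (w * prodw l).
  by move=> p1 l; apply: (Srt_prod_des W hw (commE p1)).
have eC : P1 -> pC = (w * prodw (deslist w))%g.
  move=> p1; apply: (pop_eq (P := Srt c) _ _ _ _ hC) => //; last exact: (inv_bottom (commE p1)).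
    by apply: srtl; rewrite // ?deslist_uniq // => a; rewrite mem_deslist.
  move=> r dr; have -> : r = prodw [:: r] by rewrite prodw_cons prodw_nil mulg1.
  by apply: srtl => // a; rewrite inE => /eqP ->.
have h16 : P1 -> P6.
  move=> p1 y; rewrite (eW p1) (eC p1); split=> [[_ h1 h2]|[_ h1 h2]]; split=> //.
  have [l [ul hl ->]] := between_bottom (commE p1) (proj1 (weak_leP _ _) h1) (proj1 (weak_leP _ _) h2).
  exact: srtl.
have h13 : P1 -> P3 by move=> p1; rewrite /P3 (eW p1); exact: (boolean_bottom (commE p1)).
have h21 : P2 -> P1 by apply: ncP => a b; apply: noncomm_weak.
have h41 : P4 -> P1 by apply: ncP => a b; apply: noncomm_camb.
have h15 : P1 -> P5.
  by move=> p1; apply: boolean_ext (h13 p1) => y; split=> /(h16 p1 y).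
have h32 : P3 -> P2 by apply: boolean_distributive.
have h54 : P5 -> P4 by apply: boolean_distributive.
(* If the intervals agree, then [w * a] and [w * b], which lie in the weak one, are both sortable,
   against [noncomm_sortable]. *)
have h61 : P6 -> P1.
  apply: ncP => a b da db nc p6; have [_ lW _] := hW.
  have srt1 r : des w r -> Srt c (w * r).
    move=> dr; suff /p6[] : interval (@Weak gT) le pW w (w * r)%g by [].
    split=> //; last exact/weak_leP/wsub_des.
    by apply: lW; right; apply: covered_des.
  exact: (noncomm_sortable W hw da db nc (srt1 _ da) (srt1 _ db)).
by tfae; auto.
Qed.

End Coxeter.

Local Open Scope group_scope.

Theorem theorem7p6 (gT : finGroupType) (S : {set gT}) (cw : seq gT)
  (w pW pC : gT) :
  coxeter_system S -> coxeter_word S cw -> sortable S cw w ->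
  is_pop (@Weak gT) (weak_le S) w pW ->
  is_pop (Camb S cw) (weak_le S) w pC ->
  [<-> (forall a b, descent S w a -> descent S w b -> a * b = b * a);
       distributive_lattice (interval (@Weak gT) (weak_le S) pW w) (weak_le S);
       boolean_lattice (interval (@Weak gT) (weak_le S) pW w) (weak_le S);
       distributive_lattice (interval (Camb S cw) (weak_le S) pC w) (weak_le S);
       boolean_lattice (interval (Camb S cw) (weak_le S) pC w) (weak_le S);
       (forall y, interval (Camb S cw) (weak_le S) pC w y <->
                  interval (@Weak gT) (weak_le S) pW w y)].
Proof.
move=> HS /coxeter_word_wf W.
have eC : Camb S cw = Srt S cw.
  by apply/funext => u; apply/propext; apply: (sortableP HS).
move=> /(sortableP HS _ W) hw hW; rewrite eC => hC.
exact: (pop_equivalences HS W hw hW hC).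
Qed.
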